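(* Suppose $d\ge1$, $m\ge2$, $2\le r\le\binom{m+d}{d}$ and $q\ge d+1$ is a prime power. If for each integer $d'$ with $1\le d'\le d$ and $r\le\binom{m+d'}{d'}$ we have $$e_r^{\mathbb P}(d',m,m-2;q)=f_r^{\mathbb P}(d',m,m-2;q),$$ then $$e_r^{\mathbb P}(d,m,m-1;q)=f_r^{\mathbb P}(d,m,m-1;q).$$
   Context: $\mathbb F_q$ is the finite field with $q$ elements and $\mathbb N$ the set of non-negative integers. $S_d(m,\mathbb F_q)$ is the space of homogeneous polynomials of degree $d$ (together with $0$) in $\mathbb F_q[X_0,\dots,X_m]$. For $W\subseteq S_d(m,\mathbb F_q)$, $V(W)\subseteq\mathbb P^m$ is its common vanishing set, $\dim V(W)$ its dimension as an algebraic set (over $\overline{\mathbb F}_q$; the empty set satisfies every condition ''dimension $\le k$''), and $V(W)(\mathbb F_q)$ its set of $\mathbb F_q$-rational points. For $0\le k\le m-1$ and $m-k\le r\le\binom{m+d}{d}$ (with $W$ ranging over $\mathbb F_q$-linear subspaces), $$e_r^{\mathbb P}(d,m,k;q)=\max\{|V(W)(\mathbb F_q)|: W\subseteq S_d(m,\mathbb F_q),\ \dim_{\mathbb F_q} W=r,\ \dim V(W)\le k\}.$$ Let $\mathcal B(d,m,k;q)$ be the set of $(\alpha_1,\dots,\alpha_m)\in\mathbb N^m$ with $0\le\alpha_i\le d-1$ for $1\le i\le m-k$ and $0\le \alpha_j\le q-1$ for $m-k+1\le j\le m$. Let $\Omega'(d,m,k;q)$ be the set of $w=(\alpha_1,\dots,\alpha_m)\in\mathcal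 B(d,m,k;q)$ with $\sum_j\alpha_j\le d$; for $q\ge d+1$ it has $\binom{m+d}{d}-(m-k)$ elements. Order tuples lexicographically ($w<_{\mathrm{lex}}w'$ if $w_p<w'_p$ at the first index $p$ where they differ). For $1\le s\le|\Omega'(d,m,k;q)|$, $w'_s(d,m,k;q)$ is the $s$-th largest element of $\Omega'(d,m,k;q)$; by convention $w'_0(d,m,k;q)=(d,0,\dots,0)$. Write $w'_{r-(m-k)}(d,m,k;q)=(\alpha_1,\dots,\alpha_m)$. If $r>m-k$ define $$f_r^{\mathbb A}(d,m,k;q)=\sum_{j=1}^{m-k-1}\alpha_j d^{m-k-j}q^k+\sum_{j=m-k}^m\alpha_j q^{m-j},$$ and $f^{\mathbb A}_{m-k}(d,m,k;q)=d^{m-k}q^k$. Let $\pi_j(q)=\frac{q^{j+1}-1}{q-1}$ for $j\ge0$ and $\pi_j(q)=0$ for $j<0$. Let $l$ be the smallest index with $\alpha_l\ne0$ (if $r=\binom{m+d}{d}$, so that $(\alpha_1,\dots,\alpha_m)=(0,\dots,0)$, put $l=m+1$), let $s=\min(m-l-1,k-1)$, and define $f_r^{\mathbb P}(d,m,k;q)=f_r^{\mathbb A}(d,m,k;q)+\pi_s(q)$. *)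

(* Defs.v *)
From HB Require Import structures.
From mathcomp Require Import all_boot all_order all_algebra all_field.
From mathcomp Require Import boolp classical_sets.
From mathcomp Require Import mpoly.

Set Implicit Arguments.
Unset Strict Implicit.
Unset Printing Implicit Defensive.

Import Order.TTheory GRing.Theory Num.Theory.

Local Open Scope ring_scope.

(* A point of P^m(K) is given by its unique vector of homogeneous coordinates
   whose first nonzero coordinate is 1. *)
Definition normalized (K : fieldType) (m : nat) (x : 'rV[K]_m.+1) : bool :=
  [exists i, (x 0 i == 1) && [forall j : 'I_m.+1, (j < i)%N ==> (x 0 j == 0)]].

Notation proj_space K m := {x : 'rV[K]_m.+1 | normalized x}.

Section ProjectiveDimension.
Local Open Scope classical_set_scope.
Variables (K : fieldType) (m : nat).
Implicit Types Z V : set (proj_space K m).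

Definition zariski_closed Z : Prop :=
  exists2 S : set {mpoly K[m.+1]},
    forall p, S p -> p \is homog mdeg &
    Z = [set x : proj_space K m | forall p, S p -> p.@[sval x 0] = 0].

Definition irreducible_closed Z : Prop :=
  [/\ zariski_closed Z, Z !=set0 &
      forall A B, zariski_closed A -> zariski_closed B ->
        Z = A `|` B -> Z = A \/ Z = B].

(* Krull dimension, for V closed: every chain Z_0 < ... < Z_n of irreducible
   closed subsets of V has length n <= k.  In particular it holds for V empty. *)
Definition dim_le V (k : nat) : Prop :=
  forall (n : nat) (Z : nat -> set (proj_space K m)),
    (forall i, (i <= n)%N -> irreducible_closed (Z i) /\ Z i `<=` V) ->
    (forall i, (i < n)%N -> Z i `<` Z i.+1) ->
    (n <= k)%N.

End ProjectiveDimension.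

Definition alg_closure (F : finFieldType) : countClosedFieldType :=
  tag (countable_algebraic_closure F).

Definition to_alg_closure (F : finFieldType) : {rmorphism F -> alg_closure F} :=
  sval (tagged (countable_algebraic_closure F)).

Section MaximalNumberOfZeros.
Variables (F : finFieldType) (d m : nat).
Implicit Type W : {vspace dhomog m.+1 F d}.

Definition vanishing_set W : set (proj_space (alg_closure F) m) :=
  fun x => forall p : dhomog m.+1 F d, p \in W ->
    (map_mpoly (to_alg_closure F) (p : {mpoly F[m.+1]})).@[sval x 0] = 0.

Definition rational_points W : {pred proj_space F m} :=
  fun x => `[< forall p : dhomog m.+1 F d, p \in W ->
                 (p : {mpoly F[m.+1]}).@[sval x 0] = 0 >].

(* e_r^P(d, m, k; #|F|).  The attained values are bounded by #|P^m(F)|, and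
   some value is attained whenever 0 < d, k < m and m - k <= r <= 'C(m + d, d);
   otherwise the maximum may be over the empty set, and is then 0. *)
Definition eP (k r : nat) : nat :=
  \max_(n < #|{: proj_space F m}|.+1 |
      `[< exists W, [/\ \dim W = r, dim_le (vanishing_set W) k &
                        #|rational_points W| = n] >]) n.

End MaximalNumberOfZeros.

Section ConjecturalValue.
Local Open Scope nat_scope.
Variables (d m k q : nat).

(* Tuples are indexed from 0 (alpha_(i + 1) is tnth alpha i); entries are
   restricted to 0..d, which loses nothing in presence of the bound on the sum.
   The order on m.-tuplelexi is the lexicographic one. *)
Notation exponents := (m.-tuplelexi 'I_d.+1).

Definition Omega' : {pred exponents} := fun alpha =>
  [forall i : 'I_m, tnth alpha i < (if i < m - k then d else q)]
  && (\sum_(i < m) tnth alpha i <= d).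

Definition w'_zero : exponents :=
  [tuple if i == 0 :> nat then ord_max else ord0 | i < m].

Definition w' (s : nat) : exponents :=
  nth w'_zero
    (w'_zero :: sort (fun u v : exponents => (v <= u)%O) (enum Omega')) s.

Definition fA (r : nat) : nat :=
  let alpha := w' (r - (m - k)) in
  if m - k < r then
    \sum_(i < m | i.+1 < m - k) tnth alpha i * d ^ (m - k - i.+1) * q ^ k
    + \sum_(i < m | m - k <= i.+1) tnth alpha i * q ^ (m - i.+1)
  else d ^ (m - k) * q ^ k.

(* The number of F_q-points of P^j; the division is exact. *)
Definition proj_count (j : int) : nat :=
  if j is Posz n then (q ^ n.+1 - 1) %/ (q - 1) else 0.

(* The 1-based index of the first nonzero entry, m + 1 if there is none. *)
Definition first_nonzero (alpha : exponents) : nat :=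
  (find (fun a : 'I_d.+1 => a != 0 :> nat) alpha).+1.

Definition fP (r : nat) : nat :=
  let l := first_nonzero (w' (r - (m - k))) in
  let s : int := Num.min (m%:Z - l%:Z - 1)%R (k%:Z - 1)%R in
  fA r + proj_count s.

End ConjecturalValue.

(* Main.v *)
From HB Require Import structures.
Require Import Defs.
From mathcomp Require Import all_boot all_order all_algebra all_field.
From mathcomp Require Import boolp mpoly zify ring.
From mathcomp Require classical_sets.

Set Implicit Arguments.
Unset Strict Implicit.
Unset Printing Implicit Defensive.

Import GRing.Theory.

(* Reading a tuple of exponents (all at most d < q) as the base-q digits of a number n < q^m
   turns the lexicographic order into that of integers, and f_r^P(d, m, m-1) into
   n + pi_(j-1), where n is the r-th largest number with digit sum at most d and
   q^j <= n < q^(j+1).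

   Upper bound.  N affine points impose at least #{i < N : digsum i <= d} independent
   conditions on forms of degree d; this follows by induction on m from a combinatorial
   inequality between digit counts of N_0, ..., N_(q-1) and of their sum.  If W vanishes on an
   F_q-hyperplane, dividing by its equation reduces the claim to this bound in degree d - 1.
   Otherwise write W = G W', with W' without common factor and c = deg G.  Then V(W') has
   dimension at most m - 2, the hypothesis applies to W', and if c > 0 then G vanishes on no
   F_q-hyperplane, hence has at most c q^(m-1) + q^(m-2) points.

   The dimension of V(W) is read off from chains of irreducible closed sets: along a chain of
   length n the forms of degree t have at least C(s + n, n) independent restrictions, s growing
   linearly with t.  The multiples of a form, or of two forms without common factor, leave too
   little room for that as soon as n >= m, resp. n >= m - 1.

   Lower bound.  Let W be spanned by the products of the X_j - xi_a X_0 with a < alpha_j,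
   homogenized by a power of X_0, for the r largest alpha; it vanishes at the affine points
   with number below n and on the linear subspace at infinity with pi_(j-1) points. *)

(** What joins the cases is that multiplying a system by a form of degree c adds exactly c q^(m-1)
    to its number: the r-th largest number for degree D + c is c q^(m-1) plus the one for degree D,
    since D + c < q prevents carries. The common factor may have any degree while W' keeps dimension
    r, which is why the hypothesis is assumed in every degree d'. The value that the hypothesis
    gives for W' is not yet expressed by the number b of rank r for degree D: its set of tuples has
    one more omission, and its leading exponent has weight D q^(m-2) instead of q^(m-1). The
    omission can only replace b by the next larger number, and the smaller weight makes up for that;
    so W' has at most b + pi_s points with s <= m - 3. The case of a hyperplane has to be kept apart
    because there G could have c q^(m-1) + pi_(m-2) points, and adding pi_s to this could exceed the
    claim. Away from that case the bound for G leaves room for pi_s. *)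

(** * Digit sums and the combinatorial inequality for slices *)

Section Digits.

Lemma sum_ord_leq (x k T : nat) : \sum_(i < k) (x + i <= T) = minn k (T.+1 - x).
Proof.
elim: k => [|k IH]; first by rewrite big_ord0 min0n.
by rewrite big_ord_recr /= IH; case: (leqP (x + k) T) => /=; lia.
Qed.

(** The cells of an array with rows of width [b] are filled row by row; cell [n] has row [n %/ b]
    and column [n %% b]. Counted are those of the first [A] cells that lie on low antidiagonals. *)
Definition rowcount (b s T A : nat) := \sum_(n < A) (n %/ b + n %% b + s <= T).

Lemma rowcountDl b s T A : 0 < b ->
  rowcount b s T (b + A) = minn b (T.+1 - s) + rowcount b s.+1 T A.
Proof.
move=> b0; rewrite /rowcount big_split_ord /=; congr (_ + _).
  rewrite -sum_ord_leq; apply: eq_bigr => i _.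
  by rewrite divn_small // modn_small // add0n addnC.
apply: eq_bigr => i _.
by rewrite divnDl // divnn b0 modnDl; congr (nat_of_bool (_ <= _)); lia.
Qed.

Lemma rowcount_small b s T A : A <= b -> rowcount b s T A = minn A (T.+1 - s).
Proof.
move=> Ab; rewrite -sum_ord_leq; apply: eq_bigr => i _.
rewrite divn_small ?modn_small; first by rewrite add0n addnC.
  by apply: leq_trans Ab.
by apply: leq_trans Ab.
Qed.

(* Cutting a shape with rows of width [c + 1] down to width [c] moves the cells
   of the last column to the end; [j] counts the rows already cut. *)
Lemma rowcount_cut c T B : forall s j, B + j * c.+1 <= c * c ->
  rowcount c.+1 s T B + minn j (T.+1 - (c - j + s)) <= rowcount c s T (B + j).
Proof.
elim/ltn_ind: B => B IH s j Bj.
case: (posnP c) => [c0|c0].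
  have [-> ->] : B = 0 /\ j = 0 by lia.
  by rewrite /rowcount !big_ord0 min0n.
have jc : j < c by nia.
case: (leqP B c) => Bc; last first.
  have -> : B = c.+1 + (B - c.+1) by lia.
  have -> : c.+1 + (B - c.+1) + j = c + ((B - c.+1) + j.+1) by lia.
  rewrite !rowcountDl //.
  have := IH (B - c.+1) _ s.+1 j.+1; move: (rowcount _ _ _ _) => x.
  by move: (rowcount _ _ _ _) => y; lia.
rewrite rowcount_small //; last by lia.
case: (leqP (B + j) c) => Bjc; first by rewrite rowcount_small //; lia.
have -> : B + j = c + (B + j - c) by lia.
by rewrite rowcountDl // rowcount_small //; lia.
Qed.

Lemma rowcountS_le c s T A : A <= c * c -> rowcount c.+1 s T A <= rowcount c s T A.
Proof.
by move=> Ac; have := @rowcount_cut c T A s 0; rewrite min0n !addn0; apply.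
Qed.

(* Among the down-closed sets of cells of an [a] x [b] box, [a <= b], with a given number
   of cells, the row-filled one has the fewest cells on low antidiagonals. *)
Lemma young_antidiagonals N : forall a b s T (Y : nat -> nat -> bool), a + b <= N -> a <= b ->
  (forall u i u' i', Y u i -> u' <= u -> i' <= i -> Y u' i') ->
  rowcount b s T (\sum_(u < a) \sum_(i < b) Y u i)
  <= \sum_(u < a) \sum_(i < b) (Y u i && (u + i + s <= T)).
Proof.
elim: N => [|N IH] a b s T Y abN ab Yd.
  have -> : a = 0 by lia.
  by rewrite !big_ord0 /rowcount big_ord0.
case: a abN ab => [|a] abN ab; first by rewrite !big_ord0 /rowcount big_ord0.
case: b abN ab => [|b] // abN ab.
(* A full first row is removed from both shapes; the cells that remain move by one antidiagonal,
   whence [s.+1] in the induction. *)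
have full (Z : nat -> nat -> bool) :
    (forall u i u' i', Z u i -> u' <= u -> i' <= i -> Z u' i') -> Z 0 b ->
    rowcount b.+1 s T (\sum_(u < a.+1) \sum_(i < b.+1) Z u i)
    <= \sum_(u < a.+1) \sum_(i < b.+1) (Z u i && (u + i + s <= T)).
  move=> Zd Z0; have Z0i (i : 'I_b.+1) : Z 0 i by apply: Zd Z0 _ _; rewrite // -ltnS.
  rewrite !(big_ord_recl a) /=.
  have -> : \sum_(i < b.+1) Z 0 i = b.+1.
    by under eq_bigr do rewrite Z0i; rewrite sum_nat_const card_ord muln1.
  rewrite rowcountDl //; apply: leq_add.
    rewrite -sum_ord_leq; apply: leq_sum => i _.
    by rewrite Z0i add0n addnC.
  apply: leq_trans (IH a b.+1 s.+1 T (fun u => Z u.+1) _ _ _) _; try lia.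
    by move=> u i u' i' Zu uu ii; apply: Zd Zu _ ii.
  apply/eq_leq; apply: eq_bigr => u _; apply: eq_bigr => i _.
  by congr (nat_of_bool (_ && (_ <= _))); rewrite /= /bump /=; lia.
(* Without a full row the last column is empty. It is dropped by [rowcountS_le] as long as the box
   stays at least as wide as high. *)
case Y0b: (Y 0 b); first by apply: full.
have Yb u : Y u b = false by apply/negP => Yu; rewrite (Yd _ _ _ _ Yu) in Y0b.
have drop (F : nat -> nat -> bool) : \sum_(u < a.+1) \sum_(i < b.+1) (Y u i && F u i) =
              \sum_(u < a.+1) \sum_(i < b) (Y u i && F u i) :> nat.
  by apply: eq_bigr => u _; rewrite big_ord_recr /= Yb addn0.
have dropY : \sum_(u < a.+1) \sum_(i < b.+1) Y u i = \sum_(u < a.+1) \sum_(i < b) Y u i.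
  by apply: eq_bigr => u _; rewrite big_ord_recr /= Yb addn0.
have sq a' : a' <= b -> \sum_(u < a') \sum_(i < b) Y u i <= b * b.
  move=> a'b; apply: (@leq_trans (\sum_(u < a') b)).
    apply: leq_sum => u _; apply: (@leq_trans (\sum_(i < b) 1)).
      by apply: leq_sum => i _; case: (Y u i).
    by rewrite sum_nat_const card_ord muln1.
  by rewrite sum_nat_const card_ord leq_mul2r a'b orbT.
case: (ltnP a b) => a_b.
  rewrite dropY (drop (fun u i => u + i + s <= T)).
  by apply: leq_trans (rowcountS_le _ _ (sq _ a_b)) _; apply: IH => //; lia.
have eab : a = b by lia.
(* In a square box a full first column becomes a full row by transposition; otherwise the last row
   is empty as well and the square shrinks on both sides. *)
case Ya0: (Y a 0).
  rewrite exchange_big [leqRHS]exchange_big /= -eab.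
  rewrite -{1}eab in full; have := full (fun u i => Y i u).
  rewrite -eab => /(_ _ Ya0); under [leqRHS]eq_bigr do
    (under eq_bigr do rewrite [_ + nat_of_ord _]addnC).
  by apply => u i u' i' Yu uu ii; apply: Yd Yu ii uu.
have Ya i : Y a i = false by apply/negP => Yu; rewrite (Yd _ _ _ _ Yu) in Ya0.
have dropa (F : nat -> nat -> bool) : \sum_(u < a.+1) \sum_(i < b) (Y u i && F u i) =
              \sum_(u < a) \sum_(i < b) (Y u i && F u i) :> nat.
  by rewrite big_ord_recr /= [X in _ + X]big1 ?addn0 // => i _; rewrite Ya.
have dropYa : \sum_(u < a.+1) \sum_(i < b) Y u i = \sum_(u < a) \sum_(i < b) Y u i.
  by rewrite big_ord_recr /= [X in _ + X]big1 ?addn0 // => i _; rewrite Ya.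
rewrite dropY dropYa (drop (fun u i => u + i + s <= T)) (dropa (fun u i => u + i + s <= T)).
apply: leq_trans (rowcountS_le _ _ (sq _ _)) _; first by lia.
by apply: IH => //; lia.
Qed.

Variable q : nat.
Hypothesis q_gt0 : 0 < q.

Lemma sum_cells (f : nat -> nat -> nat) N : N <= q * q ->
  \sum_(n < N) f (n %/ q) (n %% q) =
  \sum_(u < q) \sum_(i < q) (u * q + i < N) * f u i.
Proof.
move=> Nq.
have -> : \sum_(n < N) f (n %/ q) (n %% q) =
  \sum_(n < q * q) (n < N) * f (n %/ q) (n %% q).
  rewrite (big_ord_widen _ (fun n => f (n %/ q) (n %% q)) Nq) big_mkcond /=.
  by apply: eq_bigr => i _; case: ifP => _; rewrite ?mul1n ?mul0n.
have gen k : \sum_(n < k * q) (n < N) * f (n %/ q) (n %% q) =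
    \sum_(u < k) \sum_(i < q) (u * q + i < N) * f u i.
  elim: k => [|k IH]; first by rewrite !big_ord0.
  rewrite big_ord_recr /= -IH mulSn addnC big_split_ord /=; congr (_ + _).
  apply: eq_bigr => i _; rewrite divnMDl // divn_small // addn0.
  by rewrite modnMDl modn_small.
exact: gen.
Qed.

(* Weighting the rows by [sigma] changes the previous count only through the comparison
   of rows above and below the last row [h] of the row-filled shape. *)
Lemma young_weighted (sigma nu : nat -> nat) b E :
  (forall u, sigma u.+1 <= (sigma u).+1) ->
  (forall i j, i <= j -> nu j <= nu i) -> nu 0 <= q ->
  \sum_(n < \sum_(j < q) nu j) (sigma (n %/ q) + n %% q + b <= E)
  <= \sum_(j < q) \sum_(u < nu j) (sigma u + j + b <= E).
Proof.
move=> sigS nuD nuq; set N := \sum_(j < q) nu j.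
have nule j : nu j <= q by apply: leq_trans (nuD 0 j _) nuq.
have sig u v : u <= v -> sigma v <= sigma u + (v - u).
  move/subnK => <-; rewrite addnK; elim: (v - u) => [|k IH]; first by rewrite addn0.
  by rewrite addSn; apply: leq_trans (sigS _) _; rewrite addnS ltnS.
pose Y u j := u < nu j.
have Yd u i u' i' : Y u i -> u' <= u -> i' <= i -> Y u' i'.
  by rewrite /Y => ui uu ii; apply: leq_ltn_trans uu _; apply: leq_trans ui (nuD _ _ ii).
have colE (f : nat -> nat) j : \sum_(u < nu j) f u = \sum_(u < q) Y u j * f u.
  rewrite (big_ord_widen _ f (nule j)) big_mkcond; apply: eq_bigr => u _.
  by rewrite /Y; case: ifP => _; rewrite ?mul1n ?mul0n.
have NE : N = \sum_(u < q) \sum_(j < q) Y u j.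
  rewrite exchange_big; apply: eq_bigr => j _.
  transitivity (\sum_(u < nu j) 1); first by rewrite sum_nat_const card_ord muln1.
  by rewrite (colE (fun=> 1)); apply: eq_bigr => u _; rewrite muln1.
have Nqq : N <= q * q.
  apply: (@leq_trans (\sum_(j < q) q)); first by apply: leq_sum.
  by rewrite sum_nat_const card_ord.
pose h := N %/ q.
pose P u j := sigma u + j + b <= E.
(* [P'] replaces [sigma] by the line of slope 1 that agrees with it at [h]. Then [P] implies [P'] in
   rows up to [h] and [P'] implies [P] from [h] on, so passing from [P'] to [P] cannot favour the
   row-filled shape over [Y]. *)
pose P' u j := u + j + (sigma h + b) <= E + h.
rewrite (sum_cells (fun u j => sigma u + j + b <= E)) //.
have -> : \sum_(j < q) \sum_(u < nu j) (sigma u + j + b <= E) =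
    \sum_(u < q) \sum_(j < q) Y u j * P u j.
  by rewrite exchange_big; apply: eq_bigr => j _; rewrite (colE (fun u => P u j)).
have := @young_antidiagonals (q + q) q q (sigma h + b) (E + h) Y (leqnn _) (leqnn _) Yd.
rewrite -NE /rowcount (sum_cells (fun u j => u + j + (sigma h + b) <= E + h)) //.
have -> : \sum_(u < q) \sum_(i < q) (Y u i && (u + i + (sigma h + b) <= E + h)) =
    \sum_(u < q) \sum_(i < q) Y u i * P' u i.
  by apply: eq_bigr => u _; apply: eq_bigr => j _; rewrite mulnb.
move=> le'; rewrite -(leq_add2r (\sum_(u < q) \sum_(i < q) Y u i * P' u i)).
apply: leq_trans (_ : \sum_(u < q) \sum_(j < q) Y u j * P u j +
  \sum_(u < q) \sum_(i < q) (u * q + i < N) * P' u i <= _); last by rewrite leq_add2l.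
rewrite -!big_split /=; apply: leq_sum => u _; rewrite -!big_split /=.
apply: leq_sum => j _; rewrite -/(P u j).
case: (ltnP (u * q + j) N) => Lx; case Yuj: (Y u j); rewrite !(mul1n, mul0n, addn0, add0n) //.
- have uh : u <= h by rewrite /h leq_divRL //; apply: leq_trans (ltnW Lx); apply: leq_addr.
  have := sig _ _ uh; rewrite /P /P' => s1.
  by case: (leqP (sigma u + j + b) E) => //= s2; rewrite lt0b; lia.
- have uh : h <= u by rewrite -ltnS /h ltn_divLR // mulSn addnC; apply: leq_ltn_trans Lx _;
    rewrite ltn_add2l.
  have := sig _ _ uh; rewrite /P /P' => s1.
  by case: (leqP (u + j + (sigma h + b)) (E + h)) => //= s2; rewrite lt0b; lia.
Qed.

(** Only the [m] lowest digits are summed, so that [m] can follow the dimension in inductions. *)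
Fixpoint digsum m n := if m is m'.+1 then n %% q + digsum m' (n %/ q) else 0.

Lemma digsumS m : forall n, digsum m n.+1 <= (digsum m n).+1.
Proof.
elim: m => //= m IH n.
rewrite modnS divnS //; case: ifP => [qn|qn] /=; last by rewrite add0n addSn.
have {}IH := IH (n %/ q); rewrite add0n add1n; apply: leq_trans IH _.
by rewrite ltnS leq_addl.
Qed.

(** The number of conditions that [G] affine points in dimension [m] will be shown to impose on
    forms of degree [E - b]; [b] is the degree already spent on equations of other slices. *)
Definition lowcount m b E G := \sum_(n < G) (digsum m n + b <= E).

Lemma lowcountD m b E G H :
  lowcount m b E (G + H) = lowcount m b E G + \sum_(n < H) (digsum m (G + n) + b <= E).
Proof. by rewrite /lowcount big_split_ord. Qed.

Lemma leq_lowcount m b E G H : G <= H -> lowcount m b E G <= lowcount m b E H.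
Proof. by move/subnKC => <-; rewrite lowcountD leq_addr. Qed.

(* The number of [n < G] with last digit [i]. *)
Definition lastcount i G := (G + (q - 1 - i)) %/ q.

Lemma lastcountE i G : i < q -> lastcount i G = G %/ q + (i < G %% q).
Proof.
move=> iq; rewrite /lastcount {1}(divn_eq G q) -addnA divnMDl //; congr (_ + _).
have eq := ltn_pmod G q_gt0; case: (ltnP i (G %% q)) => ie.
  rewrite (_ : _ + _ = 1 * q + (G %% q - 1 - i)); last by lia.
  by rewrite divnMDl // divn_small //; lia.
by rewrite divn_small //; lia.
Qed.

Lemma lowcountS m b E G :
  lowcount m.+1 b E G = \sum_(i < q) lowcount m (b + i) E (lastcount i G).
Proof.
elim: G => [|G IH].
  rewrite /lowcount big_ord0 big1 // => i _.
  by rewrite lastcountE // div0n mod0n ltn0 addn0 big_ord0.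
have eG := ltn_pmod G q_gt0; pose e := Ordinal eG.
rewrite -[G.+1]addn1 lowcountD IH big_ord_recl big_ord0 /= !addn0.
rewrite (bigD1 e) //= [RHS](bigD1 e) //= -addnA [_ + (_ <= E)]addnC addnA; congr (_ + _).
  have -> : lastcount (G %% q) G = G %/ q by rewrite lastcountE // ltnn addn0.
  have -> : lastcount (G %% q) (G + 1) = G %/ q + 1.
    rewrite /lastcount (_ : _ + _ = G %/ q * q + q); last by have := divn_eq G q; lia.
    by rewrite divnMDl // divnn q_gt0.
  rewrite lowcountD big_ord_recl big_ord0 /= !addn0; congr (_ + nat_of_bool (_ <= _)).
  by rewrite (addnC b) addnA; congr (_ + _); apply: addnC.
apply: eq_bigr => i ie; congr lowcount; rewrite !lastcountE // addn1 modnS divnS //.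
have {}ie : i != G %% q :> nat by [].
have iq := ltn_ord i.
case: ifP => qG.
  rewrite -addnA add1n; have : G %% q = q.-1.
    have := modn_dvdm q (dvdnn q); move: qG; rewrite /dvdn -addn1 -modnDml => /eqP qG _.
    move: qG; case: (ltnP (G %% q).+1 q) => [lt|ge]; last by lia.
    by rewrite addn1 modn_small.
  by move=> eGq; rewrite eGq in ie *; lia.
by rewrite add0n; congr (_ + _); lia.
Qed.

(** The numbers below all the [G i] are regrouped by their last digit [j]: these classes have
    [x + nu j] elements, and induction applies to each. It remains to compare, above the common
    level [x], columns of heights [nu j] with the same number of cells filled row by row, which is
    [young_weighted]. *)
Lemma lowcount_slices m : forall b E (G : nat -> nat),
  (forall i j, i <= j -> G j <= G i) -> G 0 <= q ^ m ->
  lowcount m.+1 b E (\sum_(i < q) G i) <= \sum_(i < q) lowcount m (b + i) E (G i).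
Proof.
elim: m => [|m IH] b E G Gd G0.
  have G1 i : G i <= 1 by apply: leq_trans (Gd 0 i _) G0.
  have Gk k : k <= q -> lowcount 1 b E (\sum_(i < k) G i) <= \sum_(i < k) lowcount 0 (b + i) E (G i).
    elim: k => [|k IHk] kq; first by rewrite !big_ord0 /lowcount big_ord0.
    rewrite !big_ord_recr /=; case Gk: (G k) => [|g].
      by rewrite addn0; apply: leq_trans (IHk (ltnW kq)) (leq_addr _ _).
    have g0 : g = 0 by have := G1 k; lia.
    subst g; have -> : \sum_(i < k) G i = k.
      rewrite (eq_bigr (fun=> 1)) ?sum_nat_const ?card_ord ?muln1 // => i _.
      by have := Gd i k; rewrite Gk => /(_ (ltnW (ltn_ord i))); have := G1 i; lia.
    have := IHk (ltnW kq); rewrite lowcountD => le; apply: leq_add.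
      apply: leq_trans le; apply/eq_leq; congr lowcount.
      rewrite (eq_bigr (fun=> 1)) ?sum_nat_const ?card_ord ?muln1 // => i _.
      by have := Gd i k; rewrite Gk => /(_ (ltnW (ltn_ord i))); have := G1 i; lia.
    rewrite /lowcount !big_ord_recl !big_ord0 /= !addn0 modn_small //.
    by rewrite add0n addnC.
  exact: Gk.
pose x := \sum_(i < q) G i %/ q.
pose nu j := \sum_(i < q) (j < G i %% q).
have cE (j : 'I_q) : \sum_(i < q) lastcount j (G i) = x + nu j.
  by rewrite -big_split; apply: eq_bigr => i _; rewrite lastcountE.
have sumG : \sum_(i < q) G i = q * x + \sum_(j < q) nu j.
  rewrite mulnC /x big_distrl /= exchange_big -big_split; apply: eq_bigr => i _ /=.
  rewrite {1}(divn_eq (G i) q); congr (_ + _).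
  have -> : G i %% q = minn q (G i %% q) by rewrite (minn_idPr _) // ltnW // ltn_pmod.
  have := sum_ord_leq 1 q (minn q (G i %% q)); rewrite subSS subn0.
  by move=> e0; transitivity (minn q (minn q (G i %% q))); [lia | rewrite -e0; exact: eq_bigr].
apply: leq_trans (_ : \sum_(j < q) lowcount m.+1 (b + j) E (x + nu j) <= _); last first.
  under [leqRHS]eq_bigr do rewrite lowcountS.
  rewrite [leqRHS]exchange_big /=; apply: leq_sum => j _; rewrite -cE.
  under [leqRHS]eq_bigr do rewrite -addnA (addnC (nat_of_ord _)) addnA.
  apply: (IH _ _ (fun i => lastcount j (G i))).
    by move=> i i' ii; rewrite /lastcount leq_div2r // leq_add2r Gd.
  rewrite /lastcount -ltnS ltn_divLR // mulSn addnC -expnSr.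
  by have := ltn_ord j; have := G0; lia.
rewrite sumG lowcountD; under [leqRHS]eq_bigr do rewrite lowcountD.
rewrite big_split /=; apply: leq_add.
  rewrite lowcountS; apply/eq_leq; apply: eq_bigr => j _; congr lowcount.
  by rewrite lastcountE // mulnC mulnK // modnMl addn0.
have sig u : digsum m.+1 (x + u.+1) <= (digsum m.+1 (x + u)).+1 by rewrite addnS digsumS.
have nuD i j : i <= j -> nu j <= nu i.
  move=> ij; apply: leq_sum => k _.
  by case: (ltnP j (G k %% q)) => //= jl; rewrite (leq_ltn_trans ij jl).
have nuq : nu 0 <= q.
  apply: (@leq_trans (\sum_(i < q) 1)); first by apply: leq_sum => i _; case: (_ < _).
  by rewrite sum_nat_const card_ord muln1.
apply: leq_trans (_ : _ <= \sum_(n < \sum_(j < q) nu j)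
    (digsum m.+1 (x + n %/ q) + n %% q + b <= E)) _.
  apply/eq_leq; apply: eq_bigr => n _.
  by rewrite mulnC modnMDl divnMDl // [digsum m.+1 _]/= (addnC (n %% q)).
apply: leq_trans (@young_weighted (fun u => digsum m.+1 (x + u)) nu b E sig nuD nuq) _.
apply/eq_leq; apply: eq_bigr => j _; apply: eq_bigr => u _.
by rewrite -addnA (addnC (nat_of_ord j)).
Qed.

(** Each digit has weight at most [q ^ m]. Hence no number of digit sum at most [D] exceeds
    [D * q ^ m]. *)
Lemma digsum_ge m n : n < q ^ m.+1 -> n <= digsum m.+1 n * q ^ m.
Proof.
elim: m n => [|m IH] n nq; first by rewrite /= addn0 muln1 modn_small.
rewrite [digsum m.+2 n]/= mulnDl {1}(divn_eq n q) addnC; apply: leq_add.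
  by rewrite leq_pmulr // expn_gt0 q_gt0.
rewrite (expnS q m) mulnA [X in X * q ^ m]mulnC -mulnA mulnC leq_mul2l.
by rewrite IH ?orbT // ltn_divLR // -expnSr.
Qed.

Lemma digsum_add_top m c n : n < q ^ m -> c < q ->
  digsum m.+1 (c * q ^ m + n) = digsum m.+1 n + c.
Proof.
elim: m n => [|m IH] n nq cq.
  have -> : n = 0 by move: nq; rewrite expn0; case: n.
  by rewrite /= muln1 !addn0 mod0n modn_small.
rewrite expnSr mulnA [digsum m.+2 _]/= -/(digsum m.+1 _) modnMDl divnMDl //.
by rewrite [digsum m.+1 (_ + _)]IH ?ltn_divLR -?expnSr // addnA.
Qed.

Lemma sum_binomial m e k : e < k ->
  \sum_(i < k) (if i <= e then 'C(e - i + m, m) else 0) = 'C(e + m.+1, m.+1).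
Proof.
elim: e k => [|e IH] [|k] // ek; rewrite big_ord_recl /= subn0.
  by rewrite big1 // !add0n !binn.
rewrite (eq_bigr (fun i : 'I_k => if i <= e then 'C(e - i + m, m) else 0)) //.
by rewrite IH // [e.+1 + m.+1]addSn binS addnC addSnnS.
Qed.

(** As [D < q], the digits are unrestricted and the numbers counted are the exponents of all
    monomials of degree at most [D - b] in [m] variables: the whole affine space imposes as many
    conditions as there are forms. *)
Lemma lowcount_full m b D : b <= D -> D < q -> lowcount m b D (q ^ m) = 'C(D - b + m, m).
Proof.
elim: m b => [|m IH] b bD Dq.
  by rewrite /lowcount big_ord_recl big_ord0 /= bD bin0.
rewrite lowcountS -(@sum_binomial _ _ q); last by apply: leq_ltn_trans Dq; apply: leq_subr.
apply: eq_bigr => i _.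
rewrite lastcountE // expnS mulKn // modnMr addn0.
case: ifP => iD; first by rewrite IH ?subnDA //; lia.
by rewrite /lowcount big1 // => n _; apply/eqP; rewrite eqb0; lia.
Qed.

End Digits.

(** * Functions that are independent on a set of points *)

Section Independence.
Local Open Scope ring_scope.
Variables (T : Type) (K : fieldType).
Implicit Types (P : (T -> K) -> Prop) (Z : T -> Prop).

(** A lower bound [N] for the dimension of the space of restrictions to [Z], that is for a Hilbert
    function, stated without forming that space. *)
Definition indep P Z (N : nat) :=
  exists2 fam : 'I_N -> T -> K, forall i, P (fam i) &
    forall a : 'I_N -> K, (forall z, Z z -> \sum_i a i * fam i z = 0) -> forall i, a i = 0.

Lemma indep0 P Z : indep P Z 0.
Proof. by exists (fun _ _ => 0) => [[]//|a _ []//]. Qed.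

Lemma indep_sub P Z Z' N : (forall z, Z z -> Z' z) -> indep P Z N -> indep P Z' N.
Proof. by move=> ZZ' [fam famP ind]; exists fam => // a aZ; apply: ind => z /ZZ'; apply: aZ. Qed.

Lemma indep_leq P Z N M : (M <= N)%N -> indep P Z N -> indep P Z M.
Proof.
move=> MN [fam famP ind]; exists (fun i => fam (widen_ord MN i)) => // a aZ i.
pose b (j : 'I_N) := if insub (j : nat) is Some k then a k else 0.
have bE (k : 'I_M) : b (widen_ord MN k) = a k by rewrite /b /= valK.
rewrite -bE; apply: ind => z Zz; rewrite -[RHS](aZ z Zz).
rewrite (bigID (fun j : 'I_N => (j < M)%N)) /= [X in _ + X]big1 ?addr0; last first.
  by move=> j jM; rewrite /b insubN ?mul0r.
under [RHS]eq_bigr => k _ do rewrite -bE.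
by rewrite (big_ord_narrow MN (F := fun j => b j * fam j z)).
Qed.

(* Multiplication by [f], which vanishes on [Z0], is injective on the second family. *)
Lemma indep_glue P0 P1 P Z0 Z1 Z (f : T -> K) N0 N1 :
  (forall z, Z0 z -> Z z) -> (forall z, Z0 z -> f z = 0) ->
  (forall g, P0 g -> P g) -> (forall g, P1 g -> P (fun z => f z * g z)) ->
  (forall N (fam : 'I_N -> T -> K) (a : 'I_N -> K), (forall i, P1 (fam i)) ->
     (forall z, Z z -> f z * \sum_i a i * fam i z = 0) ->
     forall z, Z1 z -> \sum_i a i * fam i z = 0) ->
  indep P0 Z0 N0 -> indep P1 Z1 N1 -> indep P Z (N0 + N1).
Proof.
move=> Z0Z fZ0 P0P P1P inj [g gP gi] [h hP hi].
pose fam (i : 'I_(N0 + N1)) := match split i with inl j => g j | inr k => fun z => f z * h k z end.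
have famL j : fam (lshift N1 j) = g j by rewrite /fam (unsplitK (inl j)).
have famR j : fam (rshift N0 j) = fun z => f z * h j z by rewrite /fam (unsplitK (inr j)).
exists fam => [i|a aZ].
  by case: (split_ordP i) => j ->; rewrite ?famL ?famR; [apply: P0P|apply: P1P].
have sumE z : \sum_i a i * fam i z = \sum_j a (lshift N1 j) * g j z +
    f z * \sum_j a (rshift N0 j) * h j z.
  rewrite big_split_ord /= mulr_sumr; congr (_ + _); apply: eq_bigr => j _.
    by rewrite famL.
  by rewrite famR mulrCA.
have aL j : a (lshift N1 j) = 0.
  apply: (gi (fun j => a (lshift N1 j))) => z Z0z; rewrite -[RHS](aZ z (Z0Z _ Z0z)) sumE.
  by rewrite fZ0 // mul0r addr0.
have aR j : a (rshift N0 j) = 0.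
  apply: (hi (fun j => a (rshift N0 j))) => z; apply: (inj _ h _ hP) => {}z Zz.
  rewrite -[RHS](aZ z Zz) sumE [X in X + _]big1 ?add0r // => i _.
  by rewrite aL mul0r.
by move=> i; case: (split_ordP i) => j ->.
Qed.

End Independence.

(** * Homogeneous forms as functions *)

Section HomogeneousFunctions.
Local Open Scope ring_scope.
Variable K : fieldType.

Definition linf n (l : 'cV[K]_n) (x : 'rV[K]_n) : K := (x *m l) 0 0.

Lemma linfB n (l : 'cV[K]_n) x y : linf l (x - y) = linf l x - linf l y.
Proof. by rewrite /linf mulmxBl !mxE. Qed.

Lemma linfZ n (l : 'cV[K]_n) a x : linf l (a *: x) = a * linf l x.
Proof. by rewrite /linf -scalemxAl mxE. Qed.

Lemma linf_comp k n (l : 'cV[K]_n) (M : 'M[K]_(k, n)) y : linf l (y *m M) = linf (M *m l) y.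
Proof. by rewrite /linf mulmxA. Qed.

Lemma linf_delta n (i : 'I_n) x : linf (delta_mx i 0) x = x 0 i.
Proof.
rewrite /linf mxE (bigD1 i) //= mxE !eqxx mulr1 big1 ?addr0 // => j ji.
by rewrite mxE (negPf ji) mulr0.
Qed.

(* The functions on [K^n] given by homogeneous polynomials: evaluation and linear changes
   of coordinates are easier for these than for [{mpoly K[n]}]. *)
Inductive hform n : nat -> ('rV[K]_n -> K) -> Prop :=
| hform_const c : hform 0 (fun=> c)
| hform_lin D l f : hform D f -> hform D.+1 (fun x => linf l x * f x)
| hform_add D f g : hform D f -> hform D g -> hform D (fun x => f x + g x).

Variable n : nat.
Implicit Types f g : 'rV[K]_n -> K.

Lemma eq_hform D f g : hform D f -> f =1 g -> hform D g.
Proof. by move=> hf /funext <-. Qed.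

Lemma hform0 D : @hform n D (fun=> 0).
Proof.
elim: D => [|D IH]; first exact: hform_const.
by apply: (eq_hform (hform_lin 0 IH)) => x; rewrite mulr0.
Qed.

Lemma hformZ D c f : hform D f -> hform D (fun x => c * f x).
Proof.
elim=> {D f} [c'|D l f _ IH|D f g _ IHf _ IHg]; first exact: hform_const.
  by apply: (eq_hform (hform_lin l IH)) => x; rewrite mulrCA.
by apply: (eq_hform (hform_add IHf IHg)) => x; rewrite mulrDr.
Qed.

Lemma hformB D f g : hform D f -> hform D g -> hform D (fun x => f x - g x).
Proof. by move=> hf /(hformZ (-1)) hg; apply: (eq_hform (hform_add hf hg)) => x; rewrite mulN1r. Qed.

Lemma hform_sum D (I : Type) (r : seq I) (F : I -> 'rV[K]_n -> K) :
  (forall i, hform D (F i)) -> hform D (fun x => \sum_(i <- r) F i x).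
Proof.
move=> hF; elim: r => [|i r IH]; first by apply: (eq_hform (hform0 D)) => x; rewrite big_nil.
by apply: (eq_hform (hform_add (hF i) IH)) => x; rewrite big_cons.
Qed.

Lemma hformM D E f g : hform D f -> hform E g -> hform (D + E) (fun x => f x * g x).
Proof.
move=> hf hg; elim: hf => {D f} [c|D l f _ IH|D f f' _ IHf _ IHg]; first exact: hformZ.
  by apply: (eq_hform (hform_lin l IH)) => x; rewrite mulrA.
by apply: (eq_hform (hform_add IHf IHg)) => x; rewrite mulrDl.
Qed.

Lemma hform_linf l : @hform n 1 (linf l).
Proof. by apply: (eq_hform (hform_lin l (hform_const _ 1))) => x; rewrite mulr1. Qed.

Lemma hform_coord i : @hform n 1 (fun x => x 0 i).
Proof. by apply: (eq_hform (hform_linf (delta_mx i 0))) => x; rewrite linf_delta. Qed.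

Lemma hform_expr D e f : hform D f -> hform (D * e) (fun x => f x ^+ e).
Proof.
move=> hf; elim: e => [|e IH]; first by rewrite muln0; apply: hform_const.
by rewrite mulnS; apply: (eq_hform (hformM hf IH)) => x; rewrite exprS.
Qed.

Lemma hform_prod (I : Type) (r : seq I) (d : I -> nat) (F : I -> 'rV[K]_n -> K) :
  (forall i, hform (d i) (F i)) -> hform (\sum_(i <- r) d i) (fun x => \prod_(i <- r) F i x).
Proof.
move=> hF; elim: r => [|i r IH].
  by rewrite big_nil; apply: (eq_hform (hform_const _ 1)) => x; rewrite big_nil.
by rewrite big_cons; apply: (eq_hform (hformM (hF i) IH)) => x; rewrite big_cons.
Qed.

Lemma hform_homog D f t x : hform D f -> f (t *: x) = t ^+ D * f x.
Proof.
elim=> {D f} [c|D l f _ IH|D f g _ IHf _ IHg]; first by rewrite mul1r.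
  by rewrite IH linfZ exprS mulrACA.
by rewrite IHf IHg mulrDr.
Qed.

Lemma hform_vanish0 D f : hform D.+1 f -> f 0 = 0.
Proof. by move=> /(hform_homog 0 0); rewrite scale0r exprS !mul0r. Qed.

Lemma hform_constP f : hform 0 f -> exists c, forall x, f x = c.
Proof.
move=> hf; exists (f 0) => x; have := hform_homog 0 x hf.
by rewrite scale0r expr0 mul1r.
Qed.

(** The vector [x - linf l x *: v] is the projection of [x] to the hyperplane [l = 0] along [v].
    This is division of [f] by [l], with the restriction to that hyperplane as remainder. *)
Lemma hform_split D f l v : linf l v = 1 -> hform D.+1 f ->
  exists2 g, hform D g & forall x, f x = linf l x * g x + f (x - linf l x *: v).
Proof.
move=> lv hf; move eE: D.+1 hf => E hf; elim: hf D eE => {E f} //.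
  move=> E k f hf IH D [->] {D}.
  pose x' x := x - linf l x *: v.
  have kE x : linf k x = linf k (x' x) + linf l x * linf k v.
    by rewrite linfB linfZ subrK.
  have hf' : hform E (fun x => f (x' x)).
    pose M := 1%:M - l *m v.
    have -> : (fun x => f (x' x)) = fun x => f (x *m M).
      apply/funext => x; rewrite /x' /M mulmxBr mulmx1 mulmxA /linf.
      by rewrite [x *m l]mx11_scalar mul_scalar_mx mxE eqxx mulr1n.
    elim: hf => {f IH} [c|D l' f _ IH|D f g _ IHf _ IHg]; first exact: hform_const.
      by apply: (eq_hform (hform_lin (M *m l') IH)) => x; rewrite linf_comp.
    exact: hform_add.
  case: E => [|E] in hf hf' IH *.
    have [c fc] := hform_constP hf; exists (fun=> linf k v * c); first exact: hform_const.
    move=> x; rewrite !fc {1}kE -/(x' x); ring.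
  have [g hg fE] := IH E (erefl _).
  exists (fun x => linf k x * g x + linf k v * f (x' x)).
    by apply: hform_add; [apply: hform_lin|apply: hformZ].
  move=> x; rewrite {1}fE -/(x' x) kE; ring.
move=> E f g _ IHf _ IHg D eD.
have [f' hf' fE] := IHf D eD; have [g' hg' gE] := IHg D eD.
exists (fun x => f' x + g' x); first exact: hform_add.
by move=> x; rewrite {1}fE {1}gE mulrDr addrACA.
Qed.

Lemma hform_factor D f l : l != 0 -> hform D.+1 f ->
  (forall x, linf l x = 0 -> f x = 0) ->
  exists2 g, hform D g & forall x, f x = linf l x * g x.
Proof.
move=> l0 hf fl.
have [i li] : exists i, l i 0 != 0.
  apply/existsP; apply: contraNT l0 => /existsPn li; apply/eqP/colP => i.
  by rewrite mxE; apply/eqP; rewrite -[_ == _]negbK li.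
pose v : 'rV[K]_n := (l i 0)^-1 *: delta_mx 0 i.
have lv : linf l v = 1 by rewrite linfZ /linf -rowE mxE mulVf.
have [g hg fE] := hform_split lv hf; exists g => // x.
by rewrite fE fl ?addr0 // linfB linfZ lv mulr1 subrr.
Qed.

End HomogeneousFunctions.

(** * Passage between form functions and homogeneous polynomials *)

Section FormsAndPolynomials.
Local Open Scope ring_scope.
Variable K : fieldType.

Lemma hform_comp k n D (f : 'rV[K]_n -> K) (M : 'M[K]_(k, n)) :
  hform D f -> hform D (fun y => f (y *m M)).
Proof.
elim=> {D f} [c|D l f _ IH|D f g _ IHf _ IHg]; first exact: hform_const.
  by apply: (eq_hform (hform_lin (M *m l) IH)) => x; rewrite linf_comp.
exact: hform_add.
Qed.

Lemma mpoly_hform n D (p : {mpoly K[n]}) :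
  p \is D.-homog -> hform D (fun x : 'rV_n => p.@[x 0]).
Proof.
move=> /dhomogP hp.
suff h : hform D (fun x : 'rV_n => \sum_(m <- msupp p) p@_m * \prod_(i < n) x 0 i ^+ m i).
  by apply: (eq_hform h) => x; rewrite mevalE.
elim: (msupp p) hp => [|m s IH] hp.
  by apply: (eq_hform (@hform0 K n D)) => x; rewrite big_nil.
have h1 : hform D (fun x : 'rV[K]_n => p@_m * \prod_(i < n) x 0 i ^+ m i).
  have <- : mdeg m = D by apply: hp; rewrite mem_head.
  apply: hformZ; rewrite mdegE.
  rewrite (eq_bigr (fun i => 1 * m i)%N) => [|i _]; last by rewrite mul1n.
  exact: hform_prod (fun i => hform_expr (m i) (@hform_coord K n i)).
apply: (eq_hform (hform_add h1 (IH _))) => [m' m's|x]; last by rewrite big_cons.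
by apply: hp; rewrite inE m's orbT.
Qed.

Lemma hform_mpoly n D (f : 'rV[K]_n -> K) : hform D f ->
  exists p : dhomog n K D, forall x, f x = (p : {mpoly K[n]}).@[x 0].
Proof.
suff : hform D f -> exists2 p : {mpoly K[n]}, p \is D.-homog & forall x, f x = p.@[x 0].
  by move=> h /h [p hp fE]; exists (DHomog hp).
elim=> {D f} [c|D l f _ [p hp fE]|D f g _ [p hp fE] _ [r hr gE]].
- exists c%:MP; last by move=> x; rewrite mevalC.
  by apply/dhomogP => m; rewrite msuppC; case: ifP => //; rewrite inE => _ /eqP ->; exact: mdeg0.
- exists ((\sum_i l i 0 *: 'X_i) * p).
    rewrite -[D.+1]add1n; apply: dhomogM => //; apply: rpred_sum => i _; apply: rpredZ.
    by rewrite dhomogX; apply/eqP; exact: mdeg1.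
  move=> x; rewrite mevalM -fE; congr (_ * _); rewrite raddf_sum /linf mxE.
  by apply: eq_bigr => i _; rewrite /= mevalZ mevalXU mulrC.
- by exists (p + r); [apply: rpredD | move=> x; rewrite mevalD fE gE].
Qed.

Lemma dim_dhomog n D : \dim {:dhomog n.+1 K D} = 'C(D + n, n).
Proof. by rewrite dimvf -(@bin_sub _ n) ?leq_addl // addnK. Qed.

(** The two families are independent together: evaluating a linear relation on [Z] removes [s] and
    kills the coefficients of the first family, after which freeness of [s] applies. *)
Lemma indep_bound n D (Z : 'rV[K]_n.+1 -> Prop) N (s : seq (dhomog n.+1 K D)) :
  indep (@hform K n.+1 D) Z N -> free s ->
  (forall (p : dhomog n.+1 K D) z, p \in s -> Z z -> (p : {mpoly K[n.+1]}).@[z 0] = 0) ->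
  (N + size s <= 'C(D + n, n))%N.
Proof.
move=> [fam famP ind] fs sZ.
have [G GE] : exists G : 'I_N -> dhomog n.+1 K D,
    forall i x, fam i x = (G i : {mpoly K[n.+1]}).@[x 0].
  by have /choice [G GE] := fun i => hform_mpoly (famP i); exists G.
pose t := [seq G i | i <- enum 'I_N].
have szt : size t = N by rewrite size_map size_enum_ord.
have tE (i : 'I_N) : t`_i = G i by rewrite /t (nth_map i) ?size_enum_ord // nth_ord_enum.
suff ft : free (t ++ s).
  have := ft; rewrite /free => /eqP e; rewrite -szt -size_cat -e -dim_dhomog.
  exact: dimvS (subvf _).
have eqt : size (t ++ s) = (N + size s)%N by rewrite size_cat szt.
pose ts : (N + size s).-tuple _ := tcast eqt (in_tuple (t ++ s)).
have tsE : ts = t ++ s :> seq _ by rewrite /ts val_tcast.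
rewrite -tsE; apply/freeP => a a0.
rewrite big_split_ord /= in a0.
have sumE z : \sum_i a (lshift (size s) i) * fam i z + \sum_i a (rshift N i) * (s`_i : {mpoly K[n.+1]}).@[z 0] = 0.
  transitivity (val (\sum_(i < N) a (lshift (size s) i) *: ts`_i + \sum_(i < size s) a (rshift N i) *: ts`_(N + i))).@[z 0].
    rewrite !raddfD /= !raddf_sum /=; congr (_ + _); apply: eq_bigr => i _.
      by rewrite mevalZ tsE nth_cat szt ltn_ord tE GE.
    by rewrite mevalZ tsE nth_cat szt ltnNge leq_addr /= addKn.
  by rewrite a0 /= meval0.
have aL i : a (lshift (size s) i) = 0.
  apply: (ind (fun i => a (lshift (size s) i))) => z Zz; rewrite -[RHS](sumE z).
  rewrite [X in _ + X]big1 ?addr0 // => j _.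
  by rewrite sZ ?mulr0 // mem_nth.
have fs' : free (in_tuple s) := fs.
have aR i : a (rshift N i) = 0.
  move/freeP: fs' => /(_ (fun i => a (rshift N i))); apply; rewrite -[RHS]a0.
  rewrite [X in _ = X + _]big1 ?add0r => [|j _]; last by rewrite aL scale0r.
  by apply: eq_bigr => j _; rewrite tsE nth_cat szt ltnNge leq_addr /= addKn.
by move=> i; case: (split_ordP i) => j ->.
Qed.

End FormsAndPolynomials.

(** * Conditions imposed by affine points, and zeros of a single form *)

Section AffinePoints.
Local Open Scope ring_scope.
Variable F : finFieldType.
Local Notation q := #|F|.
Let q_gt0 : (0 < q)%N. Proof. by apply/card_gt0P; exists 0. Qed.

Lemma digsum_lowcount0 m b E G : (E < b)%N -> lowcount q m b E G = 0%N.
Proof.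
by move=> Eb; rewrite /lowcount big1 // => n _; rewrite leqNgt (leq_trans Eb) ?leq_addl.
Qed.

Lemma affine_card m (Z : {set 'rV[F]_m.+1}) :
  (forall x, x \in Z -> x 0 0 = 1) -> (#|Z| <= q ^ m)%N.
Proof.
move=> Z1; pose r (x : 'rV[F]_m.+1) := \row_(i < m) x 0 (lift 0 i).
have rI : {in Z &, injective r}.
  move=> x y xZ yZ /rowP xy; apply/rowP => i; case: (unliftP 0 i) => [j|] ->.
    by have := xy j; rewrite !mxE.
  by rewrite !Z1.
rewrite -(card_in_imset rI) (leq_trans (max_card _)) // card_mx.
by rewrite mul1n.
Qed.

(* Peeling off slices by decreasing size, and multiplying the forms found on the remaining
   slices by the equation of the current one. *)
Lemma indep_affine m : forall D (Z : {set 'rV[F]_m.+1}),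
  (forall x, x \in Z -> x 0 0 = 1) ->
  indep (@hform F m.+1 D) (fun x => x \in Z) (lowcount q m 0 D #|Z|).
Proof.
elim: m => [|m IH] D Z Z1.
  have [->|[x xZ]] := set_0Vmem Z.
    by rewrite cards0 /lowcount big_ord0; apply: indep0.
  have -> : Z = [set x].
    apply/setP => y; rewrite inE; apply/idP/eqP => [yZ|->//].
    by apply/rowP => i; rewrite ord1 !Z1.
  rewrite cards1 /lowcount big_ord_recl big_ord0 /=.
  exists (fun _ y => y 0 0 ^+ D) => [i|a aZ i].
    by have := hform_expr D (@hform_coord F 1 0); rewrite mul1n.
  have := aZ x; rewrite inE eqxx => /(_ isT); rewrite big_ord_recl big_ord0.
  rewrite Z1 // expr1n mulr1 addr0 => a0.
  by have -> : i = ord0 by apply: val_inj; case: i => [[]].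
pose lst (x : 'rV[F]_m.+2) := x 0 ord_max.
pose slice v := [set x in Z | lst x == v].
have x0E (x : 'rV[F]_m.+2) : x \in Z -> x 0 0 = 1 by apply: Z1.
pose pr (x : 'rV[F]_m.+2) : 'rV[F]_m.+1 := \row_i x 0 (widen_ord (leqnSn _) i).
have prI v : {in slice v &, injective pr}.
  move=> x y; rewrite !inE => /andP[xZ /eqP xv] /andP[yZ /eqP yv] /rowP xy.
  apply/rowP => i; case: (ltnP i m.+1) => im.
    by have := xy (Ordinal im); rewrite !mxE; congr (_ = _); congr (_ 0 _); apply: val_inj.
  have -> : i = ord_max by apply: val_inj; apply/eqP; rewrite eqn_leq im -ltnS ltn_ord.
  by rewrite -/(lst x) -/(lst y) xv yv.
have pr1 v x : x \in [set pr x | x in slice v] -> x 0 0 = 1.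
  case/imsetP=> {}x xs ->; rewrite mxE -[RHS](x0E x); last by move: xs; rewrite inE => /andP[].
  by congr (x _ _); apply: val_inj.
have ind_slice v b E : (b <= E)%N ->
    indep (@hform F m.+2 (E - b)) (fun x => x \in slice v) (lowcount q m b E #|slice v|).
  move=> bE.
  pose M : 'M[F]_(m.+2, m.+1) := \matrix_(i, j) (i == widen_ord (leqnSn _) j)%:R.
  have prE x : pr x = x *m M.
    apply/rowP => j; rewrite !mxE (bigD1 (widen_ord (leqnSn _) j)) //= !mxE eqxx mulr1.
    by rewrite big1 ?addr0 // => i ij; rewrite mxE (negPf ij) mulr0.
  have := IH (E - b)%N [set pr x | x in slice v] (@pr1 v).
  have -> : lowcount q m 0 (E - b) #|[set pr x | x in slice v]| = lowcount q m b E #|slice v|.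
    rewrite (card_in_imset (@prI v)); apply: eq_bigr => n _; congr (nat_of_bool _).
    by rewrite addn0 leq_subRL 1?addnC.
  case=> fam famP ind; exists (fun i x => fam i (pr x)) => [i|a aZ].
    by apply: (eq_hform (hform_comp M (famP i))) => x; rewrite prE.
  by apply: ind => _ /imsetP[x xs ->]; apply: aZ.
have peel vs : uniq vs -> forall b (Z' : {set 'rV[F]_m.+2}), (b <= D)%N ->
    (forall v, v \in vs -> slice v \subset Z') -> 
    indep (@hform F m.+2 (D - b)) (fun x => x \in Z')
      (\sum_(i < size vs) lowcount q m (b + i) D #|slice (nth 0%R vs i)|).
  elim: vs => [_ b Z' bD sub|v vs IHv /= /andP[vvs uvs] b Z' bD sub].
    by rewrite big_ord0; apply: indep0.
  rewrite big_ord_recl /= addn0.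
  have subv : slice v \subset Z' by apply: sub; rewrite mem_head.
  (* At [b = D] only constants are left for the current slice, and the counts of all later slices
     are zero. *)
  have [bD'|Db] := ltnP b D; last first.
    have -> : b = D by apply/eqP; rewrite eqn_leq bD.
    rewrite big1 ?addn0 => [|i _]; last by rewrite digsum_lowcount0 // addnS ltnS leq_addr.
    by apply: (indep_sub _ (ind_slice v D D (leqnn _))) => x; apply/subsetP.
  have -> : (\sum_(i < size vs) lowcount q m (b + bump 0 i) D #|slice (nth 0%R vs i)|)%N =
     (\sum_(i < size vs) lowcount q m (b.+1 + i) D #|slice (nth 0%R vs i)|)%N.
    by apply: eq_bigr => i _; rewrite /bump add1n addnS addSn.
  pose Z1' := [set x in Z | lst x \in vs].
  have sub1 w : w \in vs -> slice w \subset Z1'.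
    by move=> wvs; apply/subsetP => x; rewrite !inE => /andP[-> /eqP ->].
  have ind1 := IHv uvs b.+1 Z1' bD' sub1.
  pose f (x : 'rV[F]_m.+2) := lst x - v * x 0 0.
  have hf : hform 1 f.
    exact: (hformB (@hform_coord F _ ord_max) (hformZ v (@hform_coord F _ 0))).
  apply: (indep_glue (f := f) _ _ _ _ _ (ind_slice v b D bD) ind1).
  - by move=> x; apply/subsetP.
  - by move=> x; rewrite inE /f => /andP[xZ /eqP ->]; rewrite x0E // mulr1 subrr.
  - by [].
  - by move=> g hg; have := hformM hf hg; rewrite add1n subnSK.
  - move=> N fam a _ fz x; rewrite inE => /andP[xZ xvs].
    have xZ' : x \in Z' by apply: (subsetP (sub (lst x) _)); rewrite inE ?xvs ?orbT // xZ eqxx.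
    have /eqP := fz x xZ'; rewrite mulf_eq0 /f x0E // mulr1 subr_eq0 => /orP[/eqP xv|/eqP //].
    by rewrite xv (negPf vvs) in xvs.
pose vs := sort (fun u v => #|slice v| <= #|slice u|)%N (enum F).
have szvs : size vs = q by rewrite size_sort -cardE.
have uvs : uniq vs by rewrite sort_uniq enum_uniq.
have subZ v : v \in vs -> slice v \subset Z.
  by move=> _; apply/subsetP => x; rewrite inE => /andP[].
have := peel vs uvs 0%N Z (leq0n _) subZ; rewrite subn0.
apply: indep_leq; rewrite szvs.
pose G i := #|slice (nth 0%R vs i)|.
(* Beyond the [q] slices [nth] returns its default 0, whose slice need not be empty; the cut-off
   makes the sequence decreasing on all of [nat], as [lowcount_slices] requires. *)
have -> : #|Z| = (\sum_(i < q) if (i < q)%N then G i else 0)%N.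
  rewrite -sum1_card (partition_big lst predT) //=.
  transitivity (\sum_(v : F) #|slice v|)%N.
    by apply: eq_bigr => v _; rewrite -sum1_card; apply: eq_bigl => x; rewrite inE.
  rewrite -big_enum (perm_big vs) /=; last by rewrite perm_sym /vs perm_sort.
  by rewrite (big_nth 0) big_mkord szvs; apply: eq_bigr => i _; rewrite ltn_ord.
have Gq i : (G i <= q ^ m)%N.
  by rewrite /G -(card_in_imset (@prI _)); apply: affine_card (@pr1 _).
have Gd i j : (i <= j)%N -> ((if (j < q)%N then G j else 0) <= (if (i < q)%N then G i else 0))%N.
  move=> ij; case: ifP => // jq; rewrite (leq_ltn_trans ij jq).
  have tot : total (fun u v => #|slice v| <= #|slice u|)%N by move=> u v; apply: leq_total.
  have trs : transitive (fun u v => #|slice v| <= #|slice u|)%N.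
    by move=> u v w uv wu; apply: leq_trans wu uv.
  apply: (sorted_leq_nth trs _ 0 (sort_sorted tot _)) => //;
    by rewrite inE -/vs szvs // (leq_ltn_trans ij jq).
apply: leq_trans (lowcount_slices q_gt0 _ _ Gd _) _.
  by rewrite q_gt0.
by apply: leq_sum => i _; rewrite ltn_ord.
Qed.

Lemma move_linf n (l : 'cV[F]_n.+1) : l != 0 ->
  exists2 M : 'M[F]_n.+1, M \in unitmx & forall x : 'rV[F]_n.+1, linf l x = (x *m M) 0 0.
Proof.
move=> l0; have rl : \rank l = 1%N.
  by apply/eqP; rewrite eqn_leq rank_leq_col lt0n mxrank_eq0.
pose a := row_ebase l 0 0.
have lE : l = a *: (col_ebase l *m delta_mx 0 0).
  rewrite -{1}(mulmx_ebase l) rl [row_ebase l]mx11_scalar mul_mx_scalar -/a.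
  congr (_ *: (_ *m _)); apply/matrixP => i j; rewrite !mxE ord1 eqxx andbT.
  by congr (_%:R); rewrite -val_eqE /=; case: (i : nat) => [|[]].
have a0 : a != 0 by apply: contraNneq l0 => a0; rewrite lE a0 scale0r.
exists (a *: col_ebase l) => [|x].
  by rewrite unitmxZ ?unitfE // col_ebase_unit.
by rewrite /linf {1}lE -!scalemxAr mulmxA -colE !mxE.
Qed.

Lemma indep_affine_linf m D (l : 'cV[F]_m.+1) (Z : {set 'rV[F]_m.+1}) : l != 0 ->
  (forall x, x \in Z -> linf l x = 1) ->
  indep (@hform F m.+1 D) (fun x => x \in Z) (lowcount q m 0 D #|Z|).
Proof.
move=> /move_linf[M Mu lM] Zl.
have MI : injective (fun x : 'rV[F]_m.+1 => x *m M) by move=> x y /(can_inj (mulmxK Mu)).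
have Z1 x : x \in [set x *m M | x in Z] -> x 0 0 = 1.
  by case/imsetP=> {}x xZ ->; rewrite -lM Zl.
have [] := indep_affine D Z1; rewrite (card_imset _ MI) => fam famP ind.
exists (fun i x => fam i (x *m M)) => [i|a aZ]; first exact: hform_comp.
by apply: ind => _ /imsetP[x xZ ->]; apply: aZ.
Qed.

Lemma affine_zeros_bound m D (l : 'cV[F]_m.+1) (Z : {set 'rV[F]_m.+1})
    (s : seq (dhomog m.+1 F D)) : l != 0 ->
  (forall x, x \in Z -> linf l x = 1) -> free s ->
  (forall (p : dhomog m.+1 F D) x, p \in s -> x \in Z -> (p : {mpoly F[m.+1]}).@[x 0] = 0) ->
  (lowcount q m 0 D #|Z| + size s <= 'C(D + m, m))%N.
Proof.
move=> l0 Zl fs sZ.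
exact: indep_bound (indep_affine_linf D l0 Zl) fs sZ.
Qed.

(** Numbers above [D * q ^ m] have digit sum above [D]. So more than [D * q ^ m] zeros would impose
    as many conditions as the whole affine space, and no nonzero form of degree [D] would be
    left. *)
Lemma form_affine_zeros m D (l : 'cV[F]_m.+2) f : l != 0 -> (D < q)%N -> hform D f ->
  (exists x, linf l x = 1 /\ f x <> 0) ->
  (#|[set x | (linf l x == 1)%R && (f x == 0)%R]| <= D * q ^ m)%N.
Proof.
move=> l0 Dq hf [x0 [lx0 fx0]]; have [p fE] := hform_mpoly hf.
set Z := [set x | _]; rewrite leqNgt; apply/negP => ltZ.
have Zl x : x \in Z -> linf l x = 1 by rewrite inE => /andP[/eqP].
have fp : free [:: p].
  by rewrite seq1_free; apply/eqP => p0; apply: fx0; rewrite fE p0 meval0.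
have pZ (p' : dhomog m.+2 F D) x : p' \in [:: p] -> x \in Z -> (p' : {mpoly F[m.+2]}).@[x 0] = 0.
  by rewrite !inE => /eqP -> /andP[_ /eqP]; rewrite fE.
have := affine_zeros_bound l0 Zl fp pZ; rewrite /= addn1 ltnNge => /negP; apply.
have -> : 'C(D + m.+1, m.+1) = lowcount q m.+1 0 D (q ^ m.+1) by rewrite lowcount_full // subn0.
have Zq : (#|Z| <= q ^ m.+1)%N.
  have [M Mu lM] := move_linf l0.
  rewrite -(card_imset _ (can_inj (mulmxK Mu))); apply: affine_card => _ /imsetP[x xZ ->].
  by rewrite -lM Zl.
rewrite -(subnKC Zq) lowcountD -[leqRHS]addn0 leq_add2l leqn0 sum_nat_eq0.
apply/forallP => n; apply/implyP => _; rewrite eqb0 addn0 -ltnNge.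
have h := @digsum_ge q q_gt0 m (#|Z| + n).
have nq : (#|Z| + n < q ^ m.+1)%N by have := ltn_ord n; rewrite -ltn_subRL.
have {}h := h nq; have := leq_trans (leq_trans ltZ (leq_addr n _)) h.
by rewrite ltn_mul2r => /andP[].
Qed.

(** The [q ^ m] affine points impose ['C(D + m, m)] conditions, which is the dimension of the space
    of forms. *)
Lemma meval_inj m D (p : {mpoly F[m.+1]}) : (D < q)%N -> p \is D.-homog ->
  (forall x : 'rV[F]_m.+1, p.@[x 0] = 0) -> p = 0.
Proof.
move=> Dq hp p0; apply/eqP; apply/negPn/negP => pn0.
pose Z := [set x : 'rV[F]_m.+1 | linf (delta_mx 0 0) x == 1].
have l0 : delta_mx 0 0 != 0 :> 'cV[F]_m.+1.
  by apply/eqP => /matrixP/(_ 0 0)/eqP; rewrite !mxE !eqxx oner_eq0.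
have Zl x : x \in Z -> linf (delta_mx 0 0) x = 1 by rewrite inE => /eqP.
have fp : free [:: DHomog hp].
  by rewrite seq1_free; apply: contra pn0 => /eqP/(congr1 val) /= ->.
have pZ (p' : dhomog m.+1 F D) x : p' \in [:: DHomog hp] -> x \in Z ->
    (p' : {mpoly F[m.+1]}).@[x 0] = 0 by rewrite inE => /eqP ->.
have := affine_zeros_bound l0 Zl fp pZ; rewrite /= addn1 ltnNge => /negP; apply.
rewrite -[X in 'C(X + _, _)]subn0 -(lowcount_full q_gt0) //; apply: leq_lowcount.
pose e (y : 'rV[F]_m) : 'rV[F]_m.+1 := row_mx (1%:M : 'M_1) y.
have eI : injective e by move=> x y /(@eq_row_mx _ 1 1 m)[].
have -> : (q ^ m)%N = #|[set e y | y in [set: 'rV[F]_m]]|.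
  by rewrite (card_imset _ eI) cardsT card_mx mul1n.
apply: subset_leq_card; apply/subsetP => _ /imsetP[y _ ->].
rewrite inE linf_delta mxE; case: splitP => j // _.
by rewrite mxE ord1 eqxx.
Qed.

(** Let [U] be a linear subspace of maximal dimension on which [f] vanishes; by hypothesis this
    dimension is at most [n]. For [v] outside [U], the restriction of [f] to the span of [U] and [v]
    is nonzero by maximality and divisible by the equation of [U]; the quotient has degree [c],
    which bounds the zeros on [v + U]. Averaging over the translates gives [c * q ^ n.+1], and [U]
    itself adds at most [q ^ n]. *)
Lemma form_zeros_no_hyperplane n c f : (c < q)%N -> @hform F n.+2 c.+1 f ->
  (forall l, l != 0 -> exists2 x, linf l x = 0 & f x != 0) ->
  (#|[set x | (f x == 0)%R]| <= c * q ^ n.+1 + q ^ n)%N.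
Proof.
move=> cq hf nohyp.
pose P k := [exists U : 'M[F]_(k, n.+2), row_free U && [forall y : 'rV_k, f (y *m U) == 0]].
have P0 : exists k, P k.
  exists 0%N; apply/existsP; exists 0; rewrite /row_free mxrank0 eqxx /=.
  by apply/forallP => y; rewrite mulmx0 (hform_vanish0 hf).
have Pn k : P k -> (k <= n.+2)%N.
  by case/existsP=> U /andP[Uf _]; rewrite -(eqP Uf); apply: rank_leq_col.
case: (ex_maxnP P0 Pn) => k Pk kmax; have /existsP[U /andP[Uf /forallP fU]] := Pk.
have fU0 (x : 'rV_n.+2) : (x <= U)%MS -> f x = 0.
  by case/submxP=> y ->; apply/eqP.
have kn : (k <= n)%N.
  rewrite leqNgt; apply/negP => nk.
  (* A subspace of dimension above [n] contains a hyperplane: any one if it is the whole space,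
     otherwise itself, with a nonzero column of its cokernel as equation. *)
  have [l l0 lU] : exists2 l : 'cV[F]_n.+2, l != 0 & forall x, linf l x = 0 -> (x <= U)%MS.
    have [kn2|kn2] := eqVneq k n.+2.
      exists (const_mx 1) => [|x _].
        by apply/eqP => /matrixP/(_ 0 0)/eqP; rewrite !mxE oner_eq0.
      by apply: submx_full; rewrite /row_full (eqP Uf) kn2.
    have kn1 : k = n.+1 by have := Pn _ Pk; lia.
    have /matrix0Pn[i [j Uij]] : cokermx U != 0.
      by rewrite -mxrank_eq0 mxrank_coker (eqP Uf) kn1; lia.
    exists (col j (cokermx U)) => [|x xl].
      by apply/eqP => /matrixP/(_ i 0)/eqP; rewrite mxE [X in _ == X]mxE (negPf Uij).
    have sUk : (U <= kermx (col j (cokermx U)))%MS.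
      by apply/sub_kermxP; rewrite colE mulmxA mulmx_coker mul0mx.
    have xk : (x <= kermx (col j (cokermx U)))%MS.
      by apply/sub_kermxP/matrixP => a b; rewrite !ord1 [RHS]mxE.
    have : \rank (kermx (col j (cokermx U))) = n.+1.
      rewrite mxrank_ker (_ : \rank _ = 1%N) ?subn1 //.
      apply/eqP; rewrite eqn_leq rank_leq_col lt0n mxrank_eq0.
      by apply/eqP => /matrixP/(_ i 0)/eqP; rewrite mxE [X in _ == X]mxE (negPf Uij).
    move=> rk; have [_ e] := mxrank_leqif_sup sUk.
    by apply: submx_trans xk _; rewrite -e rk (eqP Uf) kn1.
  by have [x /lU/fU0 ->] := nohyp _ l0; rewrite eqxx.
pose S := [set x : 'rV[F]_n.+2 | (x <= U)%MS].
have cS : #|S| = (q ^ k)%N.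
  have -> : S = [set y *m U | y in [set: 'rV_k]].
    apply/setP => x; rewrite inE; apply/submxP/imsetP => [[y ->]|[y _ ->]]; last by exists y.
    by exists y.
  by rewrite card_imset ?cardsT ?card_mx ?mul1n //; apply: row_free_inj.
have cSC : (#|~: S| = q ^ n.+2 - q ^ k)%N.
  by rewrite cardsCs setCK cS card_mx mul1n.
case: k => [|k] in Pk kmax U Uf fU fU0 kn S cS cSC *.
  apply: (@leq_trans 1); last by rewrite (leq_trans _ (leq_addl _ _)) // expn_gt0 q_gt0.
  apply: leq_trans (_ : #|S| <= 1)%N; last by rewrite cS.
  apply/subset_leq_card/subsetP => x; rewrite !inE => /eqP fx.
  apply: contraTT isT => xU; have x0 : x != 0 by apply: contraNneq xU => ->; apply: sub0mx.
  suff /kmax : P 1%N by [].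
  apply/existsP; exists x; rewrite /row_free rank_rV x0 /=.
  apply/forallP => y; rewrite [y]mx11_scalar mul_scalar_mx.
  by rewrite (hform_homog _ _ hf) fx mulr0.
have fiber v : v \notin S -> (#|[set y : 'rV[F]_k.+1 | (f (v + y *m U) == 0)%R]| <= c * q ^ k)%N.
  rewrite inE => vU; pose M : 'M[F]_(1 + k.+1, n.+2) := col_mx v U.
  have hg := hform_comp M hf.
  pose l : 'cV[F]_(k.+2) := delta_mx 0 0.
  have l0 : l != 0 by apply/eqP => /matrixP/(_ 0 0)/eqP; rewrite !mxE !eqxx oner_eq0.
  have lE (z : 'rV[F]_(1 + k.+1)) : linf l z = lsubmx z 0 0.
    by rewrite linf_delta mxE; congr (z _ _); apply: val_inj.
  have zE (z : 'rV[F]_(1 + k.+1)) : z *m M = lsubmx z *m v + rsubmx z *m U.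
    by rewrite -{1}[z]hsubmxK mul_row_col.
  have [|g1 hg1 g1E] := hform_factor l0 hg.
    move=> z; rewrite lE => lz; rewrite zE [X in X *m v]mx11_scalar lz mul_scalar_mx.
    by rewrite scale0r add0r; apply: fU0; apply: submxMl.
  have [z gz] : exists z, f (z *m M) != 0.
    apply/existsP; apply: contraT; rewrite negb_exists => /forallP fz.
    suff /kmax : P k.+2 by rewrite ltnn.
    apply/existsP; exists M; apply/andP; split; last by apply/forallP => y; rewrite -[_ == _]negbK.
    have rM : \rank M = \rank (U + v)%MS by rewrite addsmxC addsmxE.
    rewrite /row_free eqn_leq rank_leq_row rM /=.
    apply: leq_trans (_ : (\rank U).+1 <= _)%N; first by rewrite (eqP Uf).
    rewrite ltn_neqAle mxrankS ?addsmxSl // andbT.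
    apply/eqP => e; move: vU; apply/negP; rewrite negbK.
    have [_ e'] := mxrank_leqif_sup (addsmxSl U v).
    by apply: submx_trans (addsmxSr U v) _; rewrite -e' e.
  have gz' := gz; rewrite g1E mulf_eq0 negb_or in gz'; case/andP: gz' => lz g1z.
  have ex1 : exists x, linf l x = 1 /\ g1 x <> 0.
    exists ((linf l z)^-1 *: z); rewrite linfZ mulVf //; split=> //; apply/eqP.
    by rewrite (hform_homog _ _ hg1) mulf_neq0 // expf_neq0 // invr_eq0.
  apply: leq_trans (form_affine_zeros l0 cq hg1 ex1).
  pose e (y : 'rV[F]_k.+1) : 'rV[F]_(1 + k.+1) := row_mx 1%:M y.
  have eI : injective e by move=> x y /eq_row_mx[].
  rewrite -(card_imset _ eI); apply/subset_leq_card/subsetP => _ /imsetP[y yP ->].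
  rewrite inE lE /e row_mxKl mxE eqxx /=.
  move: yP; rewrite inE -[v in v + _]mul1mx.
  have := g1E (e y); rewrite zE lE /e row_mxKl row_mxKr => ->.
  by rewrite [_ 0 0]mxE eqxx mul1r eqxx.
have zerosE : [set x | (f x == 0)%R] = S :|: [set x in ~: S | (f x == 0)%R].
  apply/setP => x; rewrite !inE; case: (boolP (x <= U)%MS) => //= xU.
  by rewrite fU0 ?eqxx.
rewrite zerosE; apply: leq_trans (leq_card_setU _ _) _; rewrite cS addnC; apply: leq_add; last first.
  by rewrite leq_exp2l ?finNzRing_gt1.
set Z := [set x in _ | _].
(* Double counting: a zero outside [U] is met once for each [y], from the base point obtained by
   subtracting [y *m U]. *)
have sumZ : (\sum_(v in ~: S) #|[set y : 'rV[F]_k.+1 | (f (v + y *m U) == 0)%R]| = q ^ k.+1 * #|Z|)%N.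
  under eq_bigr do rewrite -sum1dep_card big_mkcond.
  rewrite exchange_big /=.
  transitivity (\sum_(y : 'rV[F]_k.+1) #|Z|)%N; last by rewrite sum_nat_const card_mx mul1n.
  apply: eq_bigr => y _.
  rewrite -big_mkcondr -sum1_card /= (reindex_inj (addIr (- (y *m U)))) /=.
  apply: eq_bigl => x; rewrite !inE subrK; congr (~~ _ && _).
  apply/idP/idP => h; last by rewrite addmx_sub // eqmx_opp submxMl.
  by rewrite -[x](subrK (y *m U)) addmx_sub // submxMl.
have : (q ^ k.+1 * #|Z| <= (q ^ n.+2 - q ^ k.+1) * (c * q ^ k))%N.
  by rewrite -sumZ -cSC -sum_nat_const; apply: leq_sum => v; rewrite inE; apply: fiber.
rewrite expnS -mulnA mulnCA [leqRHS]mulnCA [leqRHS]mulnA [leqRHS]mulnC leq_pmul2l ?expn_gt0 ?q_gt0 //.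
move=> h; rewrite -(leq_pmul2l q_gt0); apply: leq_trans h _.
by rewrite mulnCA -expnS leq_mul2l leq_subr orbT.
Qed.

End AffinePoints.

(** * Factorial domains *)

Section Factorial.
Local Open Scope ring_scope.

Definition divides (R : comRingType) (a b : R) := exists c, b = c * a.

Definition prime_elt (R : idomainType) (p : R) :=
  [/\ p != 0, p \isn't a GRing.unit &
      forall a b, divides p (a * b) -> divides p a \/ divides p b].

Definition prime_factors (R : idomainType) (a : R) (s : seq R) :=
  (forall p, p \in s -> prime_elt p) /\
  exists2 u, u \is a GRing.unit & a = u * \prod_(p <- s) p.

(** The factors are prime and not merely irreducible, so that uniqueness is implied by existence. *)
Definition factorial_domain (R : idomainType) :=
  forall a : R, a != 0 -> exists s, prime_factors a s.

Section Divisibility.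
Variable R : idomainType.
Implicit Types a b p : R.

Lemma divides_prod p (s : seq R) : prime_elt p ->
  divides p (\prod_(x <- s) x) -> exists2 x, x \in s & divides p x.
Proof.
move=> [p0 pU pP]; elim: s => [|x s IH].
  rewrite big_nil => -[c e]; case/negP: pU.
  by apply/unitrP; exists c; rewrite [p * c]mulrC -e.
rewrite big_cons => /pP[px|/IH[y ys py]]; first by exists x; rewrite ?mem_head.
by exists y; rewrite // inE ys orbT.
Qed.

Lemma divides_unit p u a : u \is a GRing.unit -> divides p (u * a) -> divides p a.
Proof. by move=> uU [c e]; exists (u^-1 * c); rewrite -mulrA -e mulKr. Qed.

Lemma prime_assoc p x : prime_elt p -> prime_elt x -> divides p x ->
  exists2 c, c \is a GRing.unit & x = c * p.
Proof.
move=> [p0 pU _] [x0 xU xP] [c e]; exists c => //.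
have xcp : divides x (c * p) by exists 1; rewrite mul1r.
case: (xP _ _ xcp) => [[k ck]|[k pk]].
  case/negP: pU; apply/unitrP; exists k.
  have : 1 * x = (k * p) * x by rewrite mul1r {1}e {1}ck; ring.
  by move/(mulIf x0) => e1; rewrite [p * k]mulrC -e1.
apply/unitrP; exists k.
have : 1 * p = (c * k) * p by rewrite mul1r {1}pk e; ring.
by move/(mulIf p0) => e1; rewrite [k * c]mulrC -e1.
Qed.

Lemma prime_factors_div a p b s : prime_factors a s -> prime_elt p -> a = b * p ->
  exists2 s', prime_factors b s' & (size s = (size s').+1)%N.
Proof.
move=> [sP [u uU aE]] pP abp.
have : divides p (u * \prod_(x <- s) x) by exists b; rewrite -aE.
move/(divides_unit uU)/(divides_prod pP) => [x xs px].
have [c cU xE] := prime_assoc pP (sP _ xs) px.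
exists (rem x s); last by rewrite size_rem // prednK //; case: (s) xs.
split=> [y /mem_rem/sP //|]; exists (u * c); first by rewrite unitrM uU.
have [p0 _ _] := pP; apply: (mulIf p0); rewrite -abp aE (perm_big _ (perm_to_rem xs)) big_cons /=.
by move: (\prod_(y <- rem x s) y) => P; rewrite xE; ring.
Qed.

End Divisibility.

(** * Gauss's lemma: polynomials over a factorial domain *)

Section Gauss.
Variable R : idomainType.
Implicit Types (p c : R) (f g h : {poly R}).

Lemma divides_polyC p f : (forall i, divides p f`_i) -> divides p%:P f.
Proof.
move=> /choice[k fk]; exists (\poly_(i < size f) k i); apply/polyP => i.
rewrite coefMC coef_poly; case: ltnP => [_|fi]; first by rewrite fk.
by rewrite mul0r nth_default.
Qed.

Lemma polyC_divides p f : divides p%:P f -> forall i, divides p f`_i.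
Proof. by move=> [k ->] i; exists k`_i; rewrite coefMC. Qed.

Lemma divides_sum (I : Type) (r : seq I) (P : pred I) (G : I -> R) p :
  (forall i, P i -> divides p (G i)) -> divides p (\sum_(i <- r | P i) G i).
Proof.
move=> pG; elim/big_rec: _ => [|i x /pG[c ->] [d ->]]; first by exists 0; rewrite mul0r.
by exists (c + d); rewrite mulrDl.
Qed.

(** If [p] divides neither [f] nor [g], let [i] and [j] be the least indices of coefficients that it
    does not divide. In the coefficient [i + j] of the product all terms but one are divisible by
    [p]. *)
Lemma prime_polyC p : prime_elt p -> prime_elt p%:P.
Proof.
move=> [p0 pU pP]; split; first by rewrite polyC_eq0.
  by rewrite poly_unitE coefC eqxx negb_and pU orbT.
have least f : ~ divides p%:P f -> exists2 i, ~ divides p f`_i &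
    forall j, (j < i)%N -> divides p f`_j.
  move=> nf; have [i ni] : exists i, ~~ `[< divides p f`_i >].
    by apply: contra_notP nf => /forallNP h; apply: divides_polyC => i; have /negP := h i; rewrite negbK => /asboolP.
  have ex : exists i, ~~ `[< divides p f`_i >] by exists i.
  case: (ex_minnP ex) => k /asboolP nk kmin; exists k => // j jk.
  by apply/asboolP; apply: contraTT jk => /kmin; rewrite -leqNgt.
move=> f g fg; apply: contrapT => /not_orP[/least[i ni imin] /least[j nj jmin]].
have /polyC_divides/(_ (i + j)%N) := fg; rewrite coefM.
have ij : (i < (i + j).+1)%N by rewrite ltnS leq_addr.
rewrite (bigD1 (Ordinal ij)) //= addKn => -[c e].
suff : divides p (f`_i * g`_j) by case/pP.
have [d dE] : divides p (\sum_(k < (i + j).+1 | k != Ordinal ij) f`_k * g`_(i + j - k)).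
  apply: divides_sum => k ki; case: (ltngtP k i) => kij.
  - by have [c' ->] := imin _ kij; exists (c' * g`_(i + j - k)); ring.
  - have [|c' ->] := jmin (i + j - k)%N; first by have := ltn_ord k; lia.
    by exists (f`_k * c'); ring.
  - by rewrite -val_eqE /= kij eqxx in ki.
by exists (c - d); rewrite mulrBl -e -dE addrK.
Qed.

Definition primitive f := forall p, prime_elt p -> ~ divides p%:P f.

Hypothesis RF : factorial_domain R.

(** The primes of [c] are cancelled one by one: each divides the cofactor, since it cannot divide
    the primitive [f]. *)
Lemma primitive_div f g c : primitive f -> c != 0 -> divides f (c *: g) -> divides f g.
Proof.
move=> fP /RF[s [sP [u uU ->]]].
elim: s g sP => [|p s IH] g sP.
  rewrite big_nil mulr1 => -[h e]; exists (u^-1 *: h).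
  by rewrite -scalerAl -e scalerA mulVr ?scale1r.
rewrite big_cons => -[h e].
have pP := sP p (mem_head _ _).
have [_ _ /(_ h f) pdiv] := prime_polyC pP.
have {}pdiv : divides p%:P h.
  case: pdiv => // [|/fP //].
  exists ((u * \prod_(j <- s) j) *: g); rewrite -e [_ * p%:P]mulrC mul_polyC scalerA; congr (_ *: _).
  by ring.
case: pdiv => k hk; apply: (IH g) => [x xs|]; first by apply: sP; rewrite inE xs orbT.
have [p0 _ _] := pP; exists k.
apply: (@mulfI _ p%:P); first by rewrite polyC_eq0.
have -> : p%:P * (k * f) = h * f by rewrite hk; ring.
by rewrite -e mul_polyC scalerA; congr (_ *: _); ring.
Qed.

(* A factorization of [c f] gives one of [f] with factors of the same degrees, since each
   prime of [c] divides one of the two factors. *)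
Lemma factor_scaled f c a b : c != 0 -> c *: f = a * b ->
  exists a' b', [/\ f = a' * b', size a' = size a & size b' = size b].
Proof.
move=> /RF[s [sP [u uU ->]]].
elim: s a b sP => [|p s IH] a b sP.
  rewrite big_nil mulr1 => e; exists (u^-1 *: a), b; split=> //.
    by rewrite -scalerAl -e scalerA mulVr ?scale1r.
  by rewrite size_scale ?invr_eq0 //; apply: contraTneq uU => ->; rewrite unitr0.
rewrite big_cons => e; have pP := sP p (mem_head _ _).
have [p0 _ _] := pP.
have szp k : size (k * p%:P) = size k by rewrite mulrC mul_polyC size_scale.
have sP' x : x \in s -> prime_elt x by move=> xs; apply: sP; rewrite inE xs orbT.
have [_ _ /(_ a b) pdiv] := prime_polyC pP.
have {}pdiv : divides p%:P a \/ divides p%:P b.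
  apply: pdiv; exists ((u * \prod_(j <- s) j) *: f).
  by rewrite -e [_ * p%:P]mulrC mul_polyC scalerA; congr (_ *: _); ring.
have cancel k : p%:P * ((u * \prod_(j <- s) j) *: f) = p%:P * k ->
    (u * \prod_(j <- s) j) *: f = k.
  by apply: mulfI; rewrite polyC_eq0.
have eE : p%:P * ((u * \prod_(j <- s) j) *: f) = a * b.
  by rewrite -e mul_polyC scalerA; congr (_ *: _); ring.
case: pdiv => -[k kE].
  have [|a' [b' [fE sa sb]]] := IH k b sP'.
    by apply: cancel; rewrite eE kE; ring.
  by exists a', b'; rewrite kE szp.
have [|a' [b' [fE sa sb]]] := IH a k sP'.
  by apply: cancel; rewrite eE kE; ring.
by exists a', b'; rewrite kE szp.
Qed.

(** Over a domain [%|] means divisibility up to a nonzero scalar, as over the fraction field,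
    whereas [divides] is exact. *)
Lemma pseudo_dvdp f g : f %| g -> exists2 c, c != 0 & divides f (c *: g).
Proof.
by move=> /Pdiv.WeakIdomain.dvdpP[[c k] /= c0 e]; exists c => //; exists k.
Qed.

(** The gcd is taken up to scalars. If it is trivial, [f] divides [h] up to a scalar; otherwise
    irreducibility gives it the degree of [f], and [f] divides [g] up to a scalar. The scalar is
    removed by primitivity. *)
Lemma primitive_irreducible_prime f : primitive f -> (1 < size f)%N ->
  (forall a b, f = a * b -> (size a <= 1)%N \/ (size b <= 1)%N) -> prime_elt f.
Proof.
move=> fP sf irr; have f0 : f != 0 by rewrite -size_poly_gt0 ltnW.
split=> //; first by rewrite poly_unitE negb_and neq_ltn sf orbT.
move=> g h [k ghE].
have fgh : f %| g * h by rewrite ghE Pdiv.CommonIdomain.dvdp_mull.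
have [cop|ncop] := boolP (coprimep f g).
  rewrite Pdiv.CommonIdomain.Gauss_dvdpr // in fgh.
  by have [c c0 /(primitive_div fP c0)] := pseudo_dvdp fgh; right.
have [c c0 [e eE]] := pseudo_dvdp (Pdiv.CommonIdomain.dvdp_gcdl f g).
have d0 : gcdp f g != 0 by rewrite Pdiv.CommonIdomain.gcdp_eq0 negb_and f0.
have sd : (1 < size (gcdp f g))%N.
  rewrite ltn_neqAle size_poly_gt0 d0 andbT eq_sym.
  by rewrite Pdiv.CommonIdomain.coprimep_def in ncop.
have [a [b [fE sa sb]]] := factor_scaled c0 eE.
have se : (size e <= 1)%N.
  by case: (irr a b fE); [rewrite sa | rewrite sb leqNgt sd].
have /size_poly1P[e0 e00 ee] : size e == 1%N.
  rewrite eqn_leq se size_poly_gt0; apply: contraTneq (c0) => e0.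
  by have /eqP := eE; rewrite e0 mul0r scale_poly_eq0 (negPf f0) orbF negbK.
have fd : f %| gcdp f g.
  apply/Pdiv.WeakIdomain.dvdpP; exists (e0, c%:P) => //=.
  by rewrite mul_polyC eE ee mul_polyC.
have fg : f %| g.
  by apply: Pdiv.CommonIdomain.dvdp_trans fd (Pdiv.CommonIdomain.dvdp_gcdr f g).
by have [c' c0' /(primitive_div fP c0')] := pseudo_dvdp fg; left.
Qed.

Lemma unit_polyC (u : R) : u \is a GRing.unit -> u%:P \is a GRing.unit.
Proof.
move=> uU; have u0 : u != 0 by apply: contraTneq uU => ->; rewrite unitr0.
by rewrite poly_unitE size_polyC u0 coefC eqxx.
Qed.

Lemma prime_factors_cat (S : idomainType) (a b : S) s t :
  prime_factors a s -> prime_factors b t -> prime_factors (a * b) (s ++ t).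
Proof.
move=> [sP [u uU ->]] [tP [v vU ->]]; split=> [p|].
  by rewrite mem_cat => /orP[/sP|/tP].
by exists (u * v); [rewrite unitrM uU | rewrite big_cat /=; ring].
Qed.

(** A prime that divides [f] divides its leading coefficient, so the extraction stops after as many
    steps as that coefficient has prime factors. *)
Lemma factor_content f : f != 0 ->
  exists s g, [/\ forall p, p \in s -> prime_elt p, f = (\prod_(p <- s) p)%:P * g & primitive g].
Proof.
move=> f0; have /RF[t] : lead_coef f != 0 by rewrite lead_coef_eq0.
elim: {t}(size t) {-2}t (erefl (size t)) f f0 => [|k IH] t st f f0 ft.
  exists [::], f; rewrite big_nil mul1r; split=> // p pP [g fg].
  have lE : lead_coef f = lead_coef g * p by rewrite fg lead_coefM lead_coefC.
  by have [s'] := prime_factors_div ft pP lE; rewrite st.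
have [fP|] := pselect (primitive f).
  by exists [::], f; rewrite big_nil mul1r.
move/existsNP=> [p /not_implyP[pP /contrapT[g fg]]].
have lE : lead_coef f = lead_coef g * p by rewrite fg lead_coefM lead_coefC.
have [s' gs' ss'] := prime_factors_div ft pP lE.
have g0 : g != 0 by apply: contraNneq f0 => g0; rewrite fg g0 mul0r.
have [|s [h [sP gE hP]]] := IH s' _ g g0 gs'; first by rewrite ss' in st; case: st.
exists (p :: s), h; split=> // [x|]; first by rewrite inE => /orP[/eqP -> //|/sP].
by rewrite fg gE big_cons polyCM; ring.
Qed.

(** Once the content is split off, a primitive polynomial is a unit, or prime because irreducible,
    or a product of two factors of smaller degree. *)
Lemma factorial_poly : factorial_domain {poly R}.
Proof.
move=> f; elim: {f}(size f) {-2}f (leqnn (size f)) => [|n IH] f sf f0.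
  by rewrite leqn0 size_poly_eq0 (negPf f0) in sf.
have [s [g [sP fE gP]]] := factor_content f0.
have [g0 p0] : g != 0 /\ (\prod_(p <- s) p)%:P != 0.
  by apply/andP; rewrite andbC -negb_or -mulf_eq0 -fE.
have sg : size g = size f by rewrite fE mul_polyC size_scale // -polyC_eq0.
have ps : prime_factors (\prod_(p <- s) p)%:P [seq p%:P | p <- s].
  split=> [_ /mapP[p pS ->]|]; first by apply: prime_polyC; apply: sP.
  by exists 1; rewrite ?unitr1 // mul1r big_map rmorph_prod.
suff [t gt] : exists t, prime_factors g t.
  by exists ([seq p%:P | p <- s] ++ t); rewrite fE; apply: prime_factors_cat.
have [sg1|sg1] := leqP (size g) 1.
  have /size_poly1P[c c0 gE] : size g == 1%N by rewrite eqn_leq sg1 size_poly_gt0.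
  have [t [tP [u uU cE]]] := RF c0.
  case: t tP cE => [|p t] tP cE.
    exists [::]; split=> //; exists u%:P; first exact: unit_polyC.
    by rewrite gE cE !big_nil !mulr1.
  case: (gP p (tP _ (mem_head _ _))); exists (u * \prod_(j <- t) j)%:P.
  by rewrite gE cE big_cons -polyCM; congr (_ %:P); ring.
have [irr|] := pselect (forall a b, g = a * b -> (size a <= 1)%N \/ (size b <= 1)%N).
  exists [:: g]; split=> [p|]; last by exists 1; rewrite ?unitr1 // mul1r big_seq1.
  by rewrite inE => /eqP ->; apply: primitive_irreducible_prime.
move/existsNP=> [a /existsNP[b /not_implyP[gab /not_orP[/negP sa /negP sb]]]].
rewrite -!ltnNge in sa sb.
have [a0 b0] : a != 0 /\ b != 0 by apply/andP; rewrite -negb_or -mulf_eq0 -gab.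
have sgab : (size g).+1 = (size a + size b)%N.
  by rewrite gab size_mul // prednK // addn_gt0 size_poly_gt0 a0.
have [|s1 as1] := IH a _ a0; first by lia.
have [|s2 bs2] := IH b _ b0; first by lia.
by exists (s1 ++ s2); rewrite gab; apply: prime_factors_cat.
Qed.

End Gauss.

Section Transport.
Variables (R S : idomainType) (phi : {rmorphism R -> S}) (psi : {rmorphism S -> R}).
Hypotheses (phiK : cancel phi psi) (psiK : cancel psi phi).

Lemma divides_iso a b : divides (phi a) (phi b) -> divides a b.
Proof. by move=> [c e]; exists (psi c); apply: (can_inj phiK); rewrite rmorphM psiK. Qed.

Lemma prime_elt_iso p : prime_elt p -> prime_elt (phi p).
Proof.
move=> [p0 pU pP]; split.
- by apply: contraNneq p0 => e; rewrite -(phiK p) e rmorph0.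
- by apply: contra pU => /(rmorph_unit psi); rewrite phiK.
- move=> a b; rewrite -(psiK a) -(psiK b) -rmorphM => /divides_iso/pP.
  by case=> -[c e]; [left|right]; exists (phi c); rewrite e rmorphM.
Qed.

Lemma factorial_iso : factorial_domain R -> factorial_domain S.
Proof.
move=> RF a a0.
have [|s [sP [u uU aE]]] := RF (psi a).
  by apply: contraNneq a0 => e; rewrite -(psiK a) e rmorph0.
exists [seq phi p | p <- s]; split=> [_ /mapP[p ps ->]|]; first by apply/prime_elt_iso/sP.
exists (phi u); first exact: rmorph_unit.
by rewrite -(psiK a) aE rmorphM rmorph_prod big_map.
Qed.

End Transport.

(** * Multivariate polynomials: factoriality, homogeneous factors, common factors *)

Section MultivariateFactorial.
Variable F : fieldType.

Lemma mpoly0_const (p : {mpoly F[0]}) : p = (p@_0)%:MP.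
Proof.
apply/mpolyP => m; rewrite mcoeffC; have -> : m = 0%MM by apply/mnmP => -[].
by rewrite eqxx mulr1.
Qed.

Lemma mpoly_rmorph_id n (h : {rmorphism {mpoly F[n]} -> {mpoly F[n]}}) :
  (forall c, h c%:MP = c%:MP) -> (forall i, h 'X_i = 'X_i) -> forall p, h p = p.
Proof.
move=> hC hX p; rewrite [p]mpolyE rmorph_sum; apply: eq_bigr => m _.
rewrite -mul_mpolyC rmorphM hC mpolyXE_id rmorph_prod; congr (_ * _).
by apply: eq_bigr => i _; rewrite rmorphXn hX.
Qed.

Section Univariate.
Variable n : nat.

(** [psi] singles out the last variable; its inverse [phi] substitutes that variable back. *)
Let psi : {rmorphism {mpoly F[n.+1]} -> {poly {mpoly F[n]}}} := @muni n F.
Let phi : {rmorphism {poly {mpoly F[n]}} -> {mpoly F[n.+1]}} :=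
  (horner_eval ('X_ord_max : {mpoly F[n.+1]}) \o map_poly (@mwiden n F))%FUN.

Let muniX m :
  muni 'X_[F, m] = 'X_[[multinom (m (widen_ord (leqnSn n) i)) | i < n]] *: 'X^(m ord_max).
Proof. by rewrite muniE msuppX big_seq1 mcoeffX eqxx scale1r. Qed.

Let phiX : phi 'X = 'X_ord_max.
Proof. by rewrite /phi /= map_polyX /horner_eval hornerX. Qed.

Let phiC (c : {mpoly F[n]}) : phi c%:P = mwiden c.
Proof. by rewrite /phi /= map_polyC /horner_eval hornerC. Qed.

Let muniXmax : muni 'X_ord_max = 'X :> {poly {mpoly F[n]}}.
Proof.
rewrite muniX mnm1E eqxx expr1 (_ : [multinom _ | _ < n] = 0%MM) ?mpolyX0 ?scale1r //.
by apply/mnmP => j; rewrite mnmE mnm1E mnm0E -val_eqE /= gtn_eqF.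
Qed.

Let muni_mwiden (c : {mpoly F[n]}) : muni (mwiden c) = c%:P.
Proof.
rewrite [c]mpolyE; elim: (msupp c) => [|m s IH].
  by rewrite big_nil mwiden0 muni0 polyC0.
rewrite big_cons mwidenD muniD polyCD IH; congr (_ + _).
rewrite mwidenZ mwidenX muniZ muniX mnmwiden_ordmax expr0 -[in RHS]mul_mpolyC polyCM.
rewrite -mul_polyC alg_polyC; congr (_ * _); congr (_%:P); congr 'X_[_].
by apply/mnmP => i; rewrite mnmE mnmwiden_widen.
Qed.

Let phiK : cancel phi psi.
Proof.
elim/poly_ind => [|p c IH]; first by rewrite !rmorph0.
by rewrite !rmorphD !rmorphM IH phiX phiC /psi /= muniXmax muni_mwiden.
Qed.

Let psiK : cancel psi phi.
Proof.
apply: (@mpoly_rmorph_id n.+1 (phi \o psi)) => [c|i].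
  transitivity (phi (c%:MP)%:P); [congr (phi _); apply: muniC | by rewrite -[RHS]mwidenC; apply: phiC].
have [->|im] := eqVneq i ord_max.
  by transitivity (phi 'X); [congr (phi _); apply: muniXmax | apply: phiX].
have lt_in : (i < n)%N by have := ltn_ord i; rewrite ltnS leq_eqVlt -val_eqE /= in im *; rewrite (negPf im).
have -> : i = widen_ord (leqnSn n) (Ordinal lt_in) by apply: val_inj.
move: (Ordinal lt_in) => {lt_in im} {}i.
rewrite -mnmwiden1 -mwidenX; move: 'X_[_] => c.
by transitivity (phi c%:P); [congr (phi _); apply: muni_mwiden | apply: phiC].
Qed.

Lemma factorial_mpolyS : factorial_domain {mpoly F[n]} -> factorial_domain {mpoly F[n.+1]}.
Proof. by move=> /factorial_poly; apply: factorial_iso phiK psiK. Qed.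

End Univariate.

Lemma factorial_mpoly n : factorial_domain {mpoly F[n]}.
Proof.
elim: n => [|n IH]; last exact: factorial_mpolyS.
move=> p; rewrite [p]mpoly0_const mpolyC_eq0 => c0; exists [::]; split=> //.
exists (p@_0)%:MP; last by rewrite big_nil mulr1.
by apply/unitrP; exists ((p@_0)^-1)%:MP; rewrite -!mpolyCM mulVf ?mulfV.
Qed.

Lemma monomial_divisors (R : idomainType) D (e : R) (A B : {poly R}) : e != 0 ->
  A * B = e *: 'X^D -> exists a b c c', [/\ A = a *: 'X^c, B = b *: 'X^c' & D = (c + c')%N].
Proof.
move=> e0; elim: D A B => [|D IH] A B AB.
  have AB0 : A * B != 0 by rewrite AB scale_poly_eq0 (negPf e0) /= expr0 oner_eq0.
  have [A0 B0] : A != 0 /\ B != 0 by apply/andP; rewrite -negb_or -mulf_eq0.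
  have sAB : (size A + size B)%N = 2.
    have := size_mul A0 B0; rewrite AB size_scale // expr0 size_poly1.
    by have := size_poly_gt0 A; rewrite A0; lia.
  have [sA sB] : size A = 1%N /\ size B = 1%N.
    by have := size_poly_gt0 A; have := size_poly_gt0 B; rewrite A0 B0; lia.
  exists A`_0, B`_0, 0%N, 0%N; rewrite expr0 !alg_polyC.
  by split=> //; apply: size1_polyC; rewrite ?sA ?sB.
have shift (C : {poly R}) : C`_0 = 0 -> exists C', C = C' * 'X.
  move=> C0; exists (\poly_(i < size C) C`_i.+1); apply/polyP => -[|i]; rewrite coefMX //=.
  by rewrite coef_poly; case: ltnP => // Ci; rewrite nth_default // leqW.
have /eqP : A`_0 * B`_0 = 0 by rewrite -coef0M AB coefZ coefXn mulr0.
have X0 : 'X != 0 :> {poly R} by rewrite polyX_eq0.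
rewrite mulf_eq0 => /orP[/eqP/shift[C CE]|/eqP/shift[C CE]].
  have [|a [b [c [c' [CE' BE ->]]]]] := IH C B.
    by apply: (mulIf X0); rewrite -scalerAl -exprSr -AB CE; ring.
  by exists a, b, c.+1, c'; rewrite CE CE' exprSr scalerAl.
have [|a [b [c [c' [AE CE' ->]]]]] := IH A C.
  by apply: (mulIf X0); rewrite -scalerAl -exprSr -AB CE; ring.
by exists a, b, c, c'.+1; rewrite CE CE' exprSr scalerAl addnS.
Qed.

Section Homogenize.
Variable n : nat.

(* Replacing each variable [x] by [x t] multiplies the component of degree [c] by [t ^ c]. *)
Let theta : {rmorphism {mpoly F[n]} -> {poly {mpoly F[n]}}} :=
  mmap (polyC \o @mpolyC n F) (fun i => ('X_i)%:P * 'X).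

Let thetaE p : theta p = \sum_(m <- msupp p) (p@_m *: 'X_[m]) *: 'X^(mdeg m).
Proof.
rewrite /theta /= /mmap; apply: eq_bigr => m _ /=.
rewrite -[in RHS]mul_polyC -[in RHS]mul_mpolyC polyCM -mulrA; congr (_ * _).
rewrite /mmap1 (eq_bigr (fun i => ('X_i ^+ m i)%:P * 'X^(m i))); last first.
  by move=> i _; rewrite exprMn_comm ?rmorphXn //; apply: mulrC.
by rewrite big_split /= -rmorph_prod -mpolyXE_id prodrXr -mdegE.
Qed.

Let theta_coef p k : (theta p)`_k = pihomog mdeg k p.
Proof.
rewrite thetaE coef_sum pihomogE [RHS]big_mkcond; apply: eq_bigr => m _ /=.
by rewrite coefZ coefXn eq_sym; case: eqP => _; rewrite ?mulr1 ?mulr0.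
Qed.

Let theta_homog p a c : theta p = a *: 'X^c -> p \is c.-homog.
Proof.
move=> pE; rewrite (pihomog_partitionE (leqnn (mmeasure mdeg p))).
apply: rpred_sum => k _; have [<-|kc] := eqVneq (k : nat) c; first exact: pihomogP.
by rewrite -theta_coef pE coefZ coefXn (negPf kc) mulr0 rpred0.
Qed.

(** [theta] turns a form into a monomial in [t], and over a domain the factors of a monomial are
    monomials. *)
Lemma homog_divisors D (p q : {mpoly F[n]}) : p * q != 0 -> p * q \is D.-homog ->
  exists c c', [/\ p \is c.-homog, q \is c'.-homog & D = (c + c')%N].
Proof.
move=> pq0 hpq.
have pqE : theta p * theta q = (p * q) *: 'X^D.
  rewrite -rmorphM; apply/polyP => k; rewrite theta_coef coefZ coefXn.
  have [->|kD] := eqVneq k D; first by rewrite mulr1 pihomog_dE.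
  by rewrite mulr0 (@pihomog_ne0 _ _ _ D) // eq_sym.
have [a [b [c [c' [/theta_homog hp /theta_homog hq ->]]]]] := monomial_divisors pq0 pqE.
by exists c, c'.
Qed.

End Homogenize.

(** The target degree [t] is kept apart from [e + u], so that multiplications by different forms can
    share a target space and their images can be intersected. *)
Lemma mul_homog m e u t (G : {mpoly F[m.+1]}) : G \is e.-homog -> t = (e + u)%N ->
  exists g : 'Hom(dhomog m.+1 F u, dhomog m.+1 F t),
    (forall w, (g w : {mpoly F[m.+1]}) = G * (w : {mpoly F[m.+1]})) /\ (G != 0 -> lker g = 0%VS).
Proof.
move=> hG ->.
have hmul (w : dhomog m.+1 F u) : G * (w : {mpoly F[m.+1]}) \is (e + u).-homog.
  by apply: dhomogM => //; apply: dhomog_is_dhomog.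
pose f w := DHomog (hmul w).
have f_lin : linear f.
  by move=> c v w; apply: val_inj => /=; rewrite mulrDr scalerAr.
pose fL := GRing.isLinear.Build F _ _ _ f f_lin.
pose g : {linear dhomog m.+1 F u -> dhomog m.+1 F (e + u)} := HB.pack f fL.
have gE w : linfun g w = f w by rewrite lfunE.
exists (linfun g); split=> [w|G0]; first by rewrite gE.
apply/eqP/lker0P => v w; rewrite !gE => /(congr1 val) /= /(mulfI G0) vw.
exact: val_inj.
Qed.

(** [G] is a common divisor of maximal degree: a further common factor [h] of [W'] would make
    [G * h] a larger one. *)
Lemma extract_common_factor m d (W : {vspace dhomog m.+1 F d}) : W != 0%VS ->
  exists c D G (W' : {vspace dhomog m.+1 F D}),
    [/\ (d = c + D)%N /\ \dim W' = \dim W, G \is c.-homog,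
        forall w, w \in W -> exists2 w', w' \in W' & (w : {mpoly F[m.+1]}) = G * (w' : {mpoly F[m.+1]}),
        forall w', w' \in W' -> exists2 w, w \in W & (w : {mpoly F[m.+1]}) = G * (w' : {mpoly F[m.+1]}) &
        forall e h, h \is e.-homog -> (forall w', w' \in W' -> divides h (w' : {mpoly F[m.+1]})) -> e = 0%N].
Proof.
move=> W0; have [w0 w0W w00] : exists2 w, w \in W & w != 0.
  by exists (vpick W); rewrite ?memv_pick ?vpick0.
pose P c := `[< exists G : {mpoly F[m.+1]}, [/\ G \is c.-homog, G != 0 &
   forall w, w \in W -> divides G (w : {mpoly F[m.+1]})] >].
have P0 : exists c, P c.
  exists 0%N; apply/asboolP; exists 1; split=> [||w _]; first exact: dhomog1.
    exact: oner_neq0.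
  by exists (w : {mpoly F[m.+1]}); rewrite mulr1.
have Pd c : P c -> (c <= d)%N.
  move/asboolP=> [G [hG G0 /(_ _ w0W)[k w0E]]].
  have kG0 : k * G != 0 by rewrite -w0E; apply: contra w00 => /eqP e; apply/eqP/val_inj.
  have [|c1 [c2 [_ hG' ->]]] := @homog_divisors _ d k G kG0; first by rewrite -w0E; apply: dhomog_is_dhomog.
  by rewrite (dhomog_uniq G0 hG hG') leq_addl.
case: (ex_maxnP P0 Pd) => c Pc cmax; have cd := Pd _ Pc.
move/asboolP: Pc => [G [hG G0 GW]].
have [g [gE /(_ G0) g0]] := mul_homog hG (esym (subnKC cd)).
have GWd w : w \in W -> exists w', w = g w'.
  move=> wW; have [->|wn0] := eqVneq w 0; first by exists 0; rewrite linear0.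
  have [k wE] := GW _ wW.
  have kG0 : k * G != 0 by rewrite -wE; apply: contra wn0 => /eqP e; apply/eqP/val_inj.
  have [|c1 [c2 [hk hG' dE]]] := @homog_divisors _ d k G kG0.
    by rewrite -wE; apply: dhomog_is_dhomog.
  have hk' : k \is (d - c).-homog by rewrite dE (dhomog_uniq G0 hG hG') addnK.
  by exists (DHomog hk'); apply: val_inj; rewrite /= gE wE mulrC.
have WG : (W <= limg g)%VS.
  by apply/subvP => w /GWd[w' ->]; apply: memv_img (memvf _).
have imW' : (g @: (g @^-1: W))%VS = W by apply: lpreimK.
exists c, (d - c)%N, G, (g @^-1: W)%VS; split=> //.
- split; first by rewrite subnKC.
  by rewrite -[in RHS]imW' limg_dim_eq // g0 capv0.
- move=> w wW; have [w' wE] := GWd _ wW; exists w'; last by rewrite wE gE.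
  by rewrite -memv_preim -wE.
- by move=> w'; rewrite -memv_preim => ww; exists (g w'); rewrite ?gE.
- move=> e h hh hW'; have [h0|hn0] := eqVneq h 0.
    have [w1 w1E] := GWd _ w0W.
    have /hW'[k w1k] : w1 \in (g @^-1: W)%VS by rewrite -memv_preim -w1E.
    by case/eqP: w00; apply: val_inj; rewrite /= w1E gE w1k h0 !mulr0.
  have /cmax : P (c + e)%N; last by lia.
  apply/asboolP; exists (G * h); split; first exact: dhomogM.
    by rewrite mulf_neq0.
  move=> w wW; have [w' wE] := GWd _ wW.
  have /hW'[k w'k] : w' \in (g @^-1: W)%VS by rewrite -memv_preim -wE.
  by exists k; rewrite wE gE w'k; ring.
Qed.

End MultivariateFactorial.
End Factorial.

(** * Growth of binomial coefficients *)

Section BinomialGrowth.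

Lemma bin_le_exp t k : 'C(t + k, k) <= t.+1 ^ k.
Proof.
elim: k => [|k IH]; first by rewrite bin0.
rewrite -(leq_pmul2l (ltn0Sn k)) addnS -mul_bin_diag expnS mulnA.
by apply: leq_mul IH; rewrite mulSn mulnS; lia.
Qed.

Lemma exp_le_bin s n : s ^ n <= n`! * 'C(s + n, n).
Proof.
elim: n => [|n IH]; first by rewrite bin0.
rewrite factS expnS [n.+1 * _]mulnC -mulnA addnS -mul_bin_diag mulnCA.
by apply: leq_mul IH; lia.
Qed.

Lemma bin_diff u d k : 'C(u + d + k.+1, k.+1) =
  'C(u + k.+1, k.+1) + \sum_(i < d) 'C(u + i.+1 + k, k).
Proof.
elim: d => [|d IH]; first by rewrite big_ord0 !addn0.
rewrite big_ord_recr /= addnA -IH [u + d.+1 + k.+1](_ : _ = (u + d + k.+1).+1); last by lia.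
by rewrite binS; congr (_ + 'C(_, _)); lia.
Qed.

Lemma leq_expl k a b : a <= b -> a ^ k <= b ^ k.
Proof. by move=> ab; elim: k => // k IH; rewrite !expnS leq_mul. Qed.

Lemma bin_diff_le u d k : 'C(u + d + k.+1, k.+1) <= 'C(u + k.+1, k.+1) + d * (u + d).+1 ^ k.
Proof.
rewrite bin_diff leq_add2l -[d in d * _]card_ord -sum_nat_const; apply: leq_sum => i _.
apply: leq_trans (bin_le_exp _ _) _; apply: leq_expl; rewrite ltnS leq_add2l.
exact: ltn_ord.
Qed.

(** A second difference of a polynomial of degree [k + 2] has order [k]. In degree [u + d + e] it is
    the codimension of the span of the multiples of two coprime forms of degrees [d] and [e], as the
    first difference above is for a single form. *)
Lemma bin_diff2_le u d e k : 'C(u + d + e + k.+2, k.+2) + 'C(u + k.+2, k.+2) <=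
  'C(u + d + k.+2, k.+2) + 'C(u + e + k.+2, k.+2) + d * (e * (u + d + e).+1 ^ k).
Proof.
rewrite [u + d + e]addnAC bin_diff [in leqRHS]bin_diff.
set S := \sum_(i < d) 'C(u + e + _ + _, _); set T := \sum_(i < d) 'C(u + _ + _, _).
suff : S <= T + d * (e * (u + d + e).+1 ^ k) by rewrite [u + e + d]addnAC; lia.
set X := e * _; have -> : d * X = \sum_(i < d) X by rewrite sum_nat_const card_ord.
rewrite -big_split; apply: leq_sum => i _ /=.
rewrite [u + e + _]addnAC; apply: leq_trans (bin_diff_le _ _ _) _.
rewrite leq_add2l leq_mul2l; apply/orP; right; apply: leq_expl.
by have := ltn_ord i; lia.
Qed.

Lemma bin_growth n k B c c' : (forall s, 'C(s + n, n) <= B * (c * s + c') ^ k) -> n <= k.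
Proof.
move=> h; rewrite leqNgt; apply/negP => kn.
pose X := n`! * (B * (c + c') ^ k); pose s := X.+1.
have : s ^ n <= X * s ^ k.
  apply: leq_trans (exp_le_bin _ _) _; rewrite /X -!mulnA leq_pmul2l ?fact_gt0 //.
  apply: leq_trans (h s) _; rewrite leq_mul2l -expnMn; apply/orP; right; apply: leq_expl.
  by rewrite mulnDl leq_add2l leq_pmulr.
rewrite -(subnKC kn) expnD expnSr -mulnA leqNgt => /negP; apply.
rewrite mulnC ltn_pmul2l ?expn_gt0 //.
by apply: (@leq_trans s) => //; rewrite leq_pmulr // expn_gt0.
Qed.

End BinomialGrowth.

(** * Hilbert functions along chains of irreducible closed sets *)

Section Chains.
Local Open Scope ring_scope.
Import classical_sets.
Local Open Scope classical_set_scope.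
Variables (K : fieldType) (m : nat).
Implicit Types Z : set (proj_space K m).

(** One normalized vector for each point: a form vanishes on these exactly when it vanishes on all
    multiples. *)
Definition cone Z (x : 'rV[K]_m.+1) := exists2 z, Z z & x = sval z.

Definition vanishes (f : 'rV[K]_m.+1 -> K) Z := forall z, Z z -> f (sval z) = 0.

Lemma proj_coord (z : proj_space K m) : exists i, sval z 0 i = 1.
Proof. by have /existsP[i /andP[/eqP zi _]] := svalP z; exists i. Qed.

Lemma closed_cut e (p : {mpoly K[m.+1]}) Z : p \is e.-homog -> zariski_closed Z ->
  zariski_closed (Z `&` [set z : proj_space K m | p.@[sval z 0] = 0]).
Proof.
move=> hp [S Shom ->]; exists (S `|` [set p]).
  by move=> q [/Shom //|->]; apply/homogP; exists e.
apply/seteqP; split=> z /=.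
  by move=> [zS zp] q [/zS|->].
by move=> zSp; split=> [q Sq|]; apply: zSp; [left|right].
Qed.

Lemma irreducible_prime D E f g Z : irreducible_closed Z -> hform D f -> hform E g ->
  vanishes (fun x => f x * g x) Z -> vanishes f Z \/ vanishes g Z.
Proof.
move=> [Zc _ Zirr] /hform_mpoly[p pE] /hform_mpoly[r rE] fg.
have cut D' (p' : dhomog m.+1 K D') := closed_cut (dhomog_is_dhomog p') Zc.
have [|ZE|ZE] := Zirr _ _ (cut _ p) (cut _ r).
- apply/seteqP; split=> [z Zz|z [[]|[]]] //.
  have /eqP := fg _ Zz; rewrite mulf_eq0 pE rE => /orP[] /eqP h; first by left.
  by right.
- by left=> z; rewrite ZE => -[_]; rewrite pE.
- by right=> z; rewrite ZE => -[_]; rewrite rE.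
Qed.

Lemma proper_closed_form Z0 Z1 : irreducible_closed Z0 -> zariski_closed Z1 -> Z0 `<` Z1 ->
  exists e f, [/\ (0 < e)%N, hform e f, vanishes f Z0 & ~ vanishes f Z1].
Proof.
move=> [[S Shom Z0E] [z0 Z0z0] _] _ [Z01 /existsNP[z /not_implyP[Z1z nZ0z]]].
have /existsNP[p /not_implyP[Sp pz]] : ~ (forall p, S p -> p.@[sval z 0] = 0).
  by move=> h; apply: nZ0z; rewrite Z0E.
have /homogP[e hp] := Shom _ Sp.
have pZ0 : vanishes (fun x => p.@[x 0]) Z0 by move=> y; rewrite Z0E; apply.
exists e, (fun x => p.@[x 0]); split; [|exact: mpoly_hform|exact: pZ0|by move=> /(_ z Z1z)].
case: e hp => // hp; case: pz.
have [c pc] := hform_constP (mpoly_hform hp).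
by have := pZ0 _ Z0z0; rewrite !pc.
Qed.

(** On the irreducible [Z1], multiplication by [f] is injective, and its image consists of forms
    vanishing on [Z0]. So the Hilbert function of [Z1] in degree [t] is at least that of [Z0] in
    degree [t] plus its own in degree [t - e]. *)
Lemma indep_chain_step Z0 Z1 e f t N0 N1 : irreducible_closed Z1 -> (forall z, Z0 z -> Z1 z) ->
  hform e f -> vanishes f Z0 -> ~ vanishes f Z1 -> (e <= t)%N ->
  indep (@hform K m.+1 t) (cone Z0) N0 -> indep (@hform K m.+1 (t - e)) (cone Z1) N1 ->
  indep (@hform K m.+1 t) (cone Z1) (N0 + N1).
Proof.
move=> Z1i Z01 hf f0 f1 et ind0 ind1; apply: (indep_glue (f := f) _ _ _ _ _ ind0 ind1).
- by move=> x [z Z0z ->]; exists z => //; apply: Z01.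
- by move=> x [z Z0z ->]; apply: f0.
- by [].
- by move=> g hg; have := hformM hf hg; rewrite subnKC.
move=> N fam a hfam fz x [z Z1z ->].
pose h x := \sum_i a i * fam i x.
have hh : hform (t - e) h.
  by apply: hform_sum => i; apply: hformZ; apply: hfam.
have [|//|hZ1] := irreducible_prime Z1i hf hh; last exact: hZ1.
by move=> y Z1y; apply: fz; exists y.
Qed.

(* Along a chain the Hilbert functions grow like successive binomial coefficients. *)
Lemma indep_chain n (Z : nat -> set (proj_space K m)) :
  (forall i, (i <= n)%N -> irreducible_closed (Z i)) ->
  (forall i, (i < n)%N -> Z i `<` Z i.+1) ->
  exists c, forall s t, (c * s <= t)%N -> indep (@hform K m.+1 t) (cone (Z n)) 'C(s + n, n).
Proof.
elim: n => [|n IH] Zi Zs.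
  exists 0%N => s t _; rewrite bin0; have [_ [z Z0z] _] := Zi 0%N (leqnn _).
  have [i zi] := proj_coord z; exists (fun _ x => x 0 i ^+ t) => [_|a aZ j].
    by have := hform_expr t (@hform_coord K m.+1 i); rewrite mul1n.
  have := aZ (sval z); rewrite big_ord_recl big_ord0 addr0 zi expr1n mulr1 (ord1 j).
  by apply; exists z.
have [i ni|i ni|c hc] := IH; [exact: Zi (leqW ni)|exact: Zs (leqW ni)|].
have [Z01 _] := Zs n (ltnSn n).
have [e [f [e0 hf f0 f1]]] := proper_closed_form (Zi n (leqnSn n))
  (let: And3 Zc _ _ := Zi n.+1 (leqnn _) in Zc) (Zs n (ltnSn n)).
(* Pascal's rule uses degree [t] on [Z n] and degree [t - e] on [Z n.+1]; degree [c + e] for each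
   unit of [s] suffices for both. *)
exists (c + e)%N => s; elim: s => [|s IHs] t st.
  rewrite add0n binn; have := hc 0%N t; rewrite muln0 add0n binn => /(_ (leq0n _)).
  by apply: indep_sub => x [z Znz ->]; exists z => //; apply: Z01.
have -> : 'C(s.+1 + n.+1, n.+1) = ('C(s.+1 + n, n) + 'C(s + n.+1, n.+1))%N.
  by rewrite [(s.+1 + n)%N]addSnnS addSn binS addnC.
apply: (indep_chain_step (Zi n.+1 (leqnn _)) Z01 hf f0 f1).
- by apply: leq_trans st; nia.
- by apply: hc; apply: leq_trans st; nia.
- by apply: IHs; nia.
Qed.

End Chains.

(** * Dimension of the common zeros of forms *)

Section DimensionBounds.
Local Open Scope ring_scope.
Import classical_sets.
Local Open Scope classical_set_scope.
Variables (F K : fieldType) (iota : {rmorphism F -> K}) (m : nat).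
Implicit Types Z : set (proj_space K m).

Definition vanishes_on (p : {mpoly F[m.+1]}) Z := forall z, Z z -> (map_mpoly iota p).@[sval z 0] = 0.

Lemma map_dhomog t (p : {mpoly F[m.+1]}) : p \is t.-homog -> map_mpoly iota p \is t.-homog.
Proof.
move=> /dhomogP hp; apply/dhomogP => mu; rewrite mcoeff_msupp mcoeff_map_mpoly => nz.
by apply: hp; rewrite mcoeff_msupp; apply: contraNneq nz => pmu; rewrite pmu; exact/eqP/raddf0.
Qed.

Definition scalar_ext t (p : dhomog m.+1 F t) : dhomog m.+1 K t :=
  DHomog (map_dhomog (dhomog_is_dhomog p)).

(** The rank of the matrix of coefficients does not change under a field extension. *)
Lemma free_scalar_ext t (s : seq (dhomog m.+1 F t)) : free s -> free [seq scalar_ext p | p <- s].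
Proof.
move=> fs.
have fs' : free (in_tuple s) := fs.
have fE : [seq scalar_ext p | p <- s] = [tuple of map (@scalar_ext t) (in_tuple s)] by [].
rewrite fE; apply/freeP => b b0 j.
pose I : finType := 'X_{1..m.+1 < t.+1}.
pose A : 'M[F]_(size s, #|I|) := \matrix_(i, k) (s`_i : {mpoly F[m.+1]})@_(bmnm (enum_val k)).
have coefE (p : dhomog m.+1 F t) :
    (forall k : 'I_#|I|, (p : {mpoly F[m.+1]})@_(bmnm (enum_val k)) = 0) -> p = 0.
  move=> pk; apply: val_inj; apply/mpolyP => mu; rewrite mcoeff0.
  have [mt|mt] := eqVneq (mdeg mu) t; last first.
    exact: dhomog_nemf_coeff (dhomog_is_dhomog p) mt.
  have mut : (mdeg mu < t.+1)%N by rewrite mt.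
  by have := pk (enum_rank (BMultinom mut : I)); rewrite enum_rankK.
have Af : row_free A.
  rewrite -kermx_eq0; apply/rowV0P => v /sub_kermxP vA.
  have /freeP/(_ (fun i => v 0 i)) := fs' => h; apply/rowP => i; rewrite mxE; apply: h.
  apply: coefE => k; have /rowP/(_ k) := vA; rewrite !mxE => e.
  rewrite -[RHS]e !raddf_sum /=; apply: eq_bigr => i' _.
  by rewrite mcoeffZ mxE.
have : (\row_i b i) *m map_mx iota A = 0.
  apply/rowP => k; rewrite !mxE.
  have /(congr1 (fun p : dhomog m.+1 K t => (p : {mpoly K[m.+1]})@_(bmnm (enum_val k)))) := b0.
  rewrite /= mcoeff0 => e; rewrite -[RHS]e !raddf_sum /=; apply: eq_bigr => i _.
  by rewrite mcoeffZ !mxE (nth_map 0) // mcoeff_map_mpoly.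
have Af' : row_free (map_mx iota A) by rewrite row_free_map.
move/eqP; rewrite mulmx_free_eq0 // => /eqP/rowP/(_ j).
by rewrite !mxE.
Qed.

Lemma indep_vspace_bound t Z N (J : {vspace dhomog m.+1 F t}) :
  indep (@hform K m.+1 t) (cone Z) N -> (forall p : dhomog m.+1 F t, p \in J -> vanishes_on p Z) ->
  (N + \dim J <= 'C(t + m, m))%N.
Proof.
move=> ind JZ.
have fs := free_scalar_ext (basis_free (vbasisP J)).
have := indep_bound ind fs; rewrite size_map size_tuple; apply.
by move=> _ x /mapP[p pJ ->] [z Zz ->]; apply: JZ Zz; apply: vbasis_mem.
Qed.

Variables (n : nat) (Z : nat -> set (proj_space K m)).
Hypothesis Zirr : forall i, (i <= n)%N -> irreducible_closed (Z i).
Hypothesis Zchain : forall i, (i < n)%N -> Z i `<` Z i.+1.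

Lemma chain_in_hypersurface d (p : {mpoly F[m.+1]}) : p \is d.-homog -> p != 0 -> vanishes_on p (Z n) -> (n <= m.-1)%N.
Proof.
move=> hp p0 pZ; have [c hc] := indep_chain Zirr Zchain.
have key s : ('C(s + n, n) + 'C(c * s + m, m) <= 'C(c * s + d + m, m))%N.
  have ind := hc s (c * s + d)%N (leq_addr _ _).
  have [g [gE /(_ p0) g0]] := mul_homog hp (addnC (c * s) d)%N.
  have := indep_vspace_bound ind _ (J := limg g); rewrite limg_dim_eq ?g0 ?capv0 //.
  rewrite dim_dhomog; apply.
  by move=> _ /memv_imgP[w _ ->] z Zz; rewrite gE rmorphM mevalM pZ // mul0r.
move: key; case: (m) => [|m'] key; first by have := key 0%N; rewrite !bin0 add0n binn.
apply: (@bin_growth n m' d c d.+1) => s.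
rewrite addnS; have := key s; have := bin_diff_le (c * s) d m'.
lia.
Qed.

(** Since the prime [p] does not divide [g], the common multiples of [p] and [g] are multiples of
    [p * g]. This bounds from below the dimension of the span of all multiples, with a codimension
    of order [s ^ (m - 2)]. *)
Lemma chain_in_codim2 e (p : {mpoly F[m.+1]}) d (g : {mpoly F[m.+1]}) : prime_elt p -> p \is e.-homog -> vanishes_on p (Z n) ->
  g \is d.-homog -> vanishes_on g (Z n) -> ~ divides p g -> (n <= m.-2)%N.
Proof.
move=> [p0 pU pP] hp pZ hg gZ png; have [c hc] := indep_chain Zirr Zchain.
have g0 : g != 0 by apply/eqP => g0; apply: png; exists 0; rewrite g0 mul0r.
have key s : ('C(s + n, n) + ('C(c * s + d + m, m) + 'C(c * s + e + m, m))
     <= 'C(c * s + d + e + m, m) + 'C(c * s + m, m))%N.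
  set u := (c * s)%N.
  have uude : (u <= u + d + e)%N by rewrite -addnA leq_addr.
  have ind := hc s _ uude.
  have [fp [fpE /(_ p0) fp0]] := mul_homog hp (addnC (u + d) e)%N.
  have e1 : (u + d + e = d + (u + e))%N by lia.
  have [fg [fgE /(_ g0) fg0]] := mul_homog hg e1.
  have e2 : (u + d + e = (e + d) + u)%N by lia.
  have [fpg [fpgE /(_ (mulf_neq0 p0 g0)) fpg0]] := mul_homog (dhomogM hp hg) e2.
  have cap : (limg fp :&: limg fg <= limg fpg)%VS.
    apply/subvP => w; rewrite memv_cap => /andP[/memv_imgP[a _ aE] /memv_imgP[b _ bE]].
    have pab : p * (a : {mpoly F[m.+1]}) = g * (b : {mpoly F[m.+1]}) by rewrite -fpE -fgE -aE -bE.
    have [//|[k bk]] : divides p g \/ divides p (b : {mpoly F[m.+1]}).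
      by apply: pP; exists (a : {mpoly F[m.+1]}); rewrite -pab mulrC.
    have [b0|bn0] := eqVneq (b : {mpoly F[m.+1]}) 0.
      have -> : w = 0 by rewrite bE; apply: val_inj; rewrite /= fgE b0 mulr0.
      exact: mem0v.
    have kp0 : k * p != 0 by rewrite -bk.
    have [|k1 [k2 [hk hp' kE]]] := @homog_divisors _ _ (u + e) k p kp0.
      by rewrite -bk; apply: dhomog_is_dhomog.
    have ek := dhomog_uniq p0 hp hp'.
    have hk' : k \is u.-homog by have -> : u = k1 by lia.
    have -> : w = fpg (DHomog hk').
      by rewrite bE; apply: val_inj; rewrite /= fgE fpgE bk /=; ring.
    exact: memv_img (memvf _).
  have := dimv_sum_cap (limg fp) (limg fg); have := dimvS cap.
  rewrite !limg_dim_eq ?fp0 ?fg0 ?fpg0 ?capv0 // !dim_dhomog => capd sumd.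
  have := indep_vspace_bound ind _ (J := (limg fp + limg fg)%VS).
  suff H : forall w : dhomog m.+1 F (u + d + e), w \in (limg fp + limg fg)%VS -> vanishes_on w (Z n).
    by move/(_ H) => h; rewrite -sumd addnA; apply: leq_add h capd.
  move=> _ /memv_addP[_ /memv_imgP[a _ ->] [_ /memv_imgP[b _ ->] ->]] z Zz.
  by rewrite /= rmorphD mevalD fpE fgE !rmorphM /= pZ // gZ // !mul0r addr0.
(* For [m <= 1] the inequality fails already at [s = 0]: two such forms have no common zero. *)
move: key; case: (m) => [|[|m']] key.
- by have := key 0%N; rewrite !bin0; have := bin_gt0 (0 + n) n; rewrite leq_addl; lia.
- by have := key 0%N; rewrite !bin1; have := bin_gt0 (0 + n) n; rewrite leq_addl; lia.
apply: (@bin_growth n m' (d * e) c (d + e).+1) => s.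
have := key s; have := bin_diff2_le (c * s) d e m'.
rewrite [(c * s + (d + e).+1)%N](_ : _ = (c * s + d + e).+1); last by lia.
rewrite -mulnA; lia.
Qed.

(* [Z n] being irreducible, it lies on one of the prime factors of any form vanishing on it. *)
Lemma chain_no_common_factor D (W : {vspace dhomog m.+1 F D}) : W != 0%VS ->
  (forall p : dhomog m.+1 F D, p \in W -> vanishes_on p (Z n)) ->
  (forall e (h : {mpoly F[m.+1]}), h \is e.-homog ->
     (forall w : dhomog m.+1 F D, w \in W -> divides h (w : {mpoly F[m.+1]})) -> e = 0%N) ->
  (n <= m.-2)%N.
Proof.
move=> W0 WZ noc.
have [f fW f0] : exists2 f, f \in W & f != 0.
  by exists (vpick W); rewrite ?memv_pick ?vpick0.
have [|s [sP [u uU fE]]] := @factorial_mpoly F m.+1 (f : {mpoly F[m.+1]}).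
  by apply: contra f0 => /eqP e; apply/eqP/val_inj.
have fn0 : (f : {mpoly F[m.+1]}) != 0 by apply: contra f0 => /eqP e; apply/eqP/val_inj.
have hf := dhomog_is_dhomog f.
have [_ [z0 Zz0] _] := Zirr (leqnn n).
have hs (p : {mpoly F[m.+1]}) : p \in s -> exists c, p \is c.-homog.
  move=> ps; have fE' : (f : {mpoly F[m.+1]}) = (u * \prod_(x <- rem p s) x) * p.
    by rewrite fE (perm_big _ (perm_to_rem ps)) big_cons /=; ring.
  have [||c [c' [_ hp _]]] := @homog_divisors _ _ D (u * \prod_(x <- rem p s) x) p.
  - by rewrite -fE'.
  - by rewrite -fE'.
  - by exists c'.
have [p ps pZ] : exists2 p, p \in s & vanishes_on p (Z n).
  have : vanishes_on (\prod_(x <- s) x) (Z n).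
    move=> z Zz; have := WZ f fW z Zz; rewrite fE rmorphM mevalM => /eqP.
    rewrite mulf_eq0 => /orP[|/eqP //].
    have : map_mpoly iota u \is a GRing.unit by apply: rmorph_unit.
    move=> /unitrP[v [vu _]] /eqP uz; have := congr1 (fun p => p.@[sval z 0]) vu.
    by rewrite mevalM uz mulr0 rmorph1 => /eqP; rewrite eq_sym oner_eq0.
  elim: (s) hs => [_ /(_ _ Zz0)|x t IH hs].
    by rewrite big_nil !rmorph1 => /eqP; rewrite oner_eq0.
  rewrite big_cons => xZ.
  have ht (p : {mpoly F[m.+1]}) : p \in t -> exists c, p \is c.-homog by move=> pt; apply: hs; rewrite inE pt orbT.
  have [c hx] := hs x (mem_head _ _).
  have /homogP[c' hprod] : \prod_(p <- t) p \is homog mdeg.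
    by apply: homog_prod; apply/allP => p /ht[k hk]; apply/homogP; exists k.
  have := irreducible_prime (Zirr (leqnn n)) (mpoly_hform (map_dhomog hx)) (mpoly_hform (map_dhomog hprod)).
  case=> [z Zz|xv|tv].
  - by have := xZ z Zz; rewrite rmorphM mevalM.
  - by exists x; rewrite ?mem_head.
  - by have [p pt pv] := IH ht tv; exists p; rewrite // inE pt orbT.
have [c hp] := hs p ps; have pP := sP p ps.
(* Otherwise [p] would be a common factor of [W], hence of degree 0, but nonzero constants are
   units. *)
have [g gW png] : exists2 g : dhomog m.+1 F D, g \in W & ~ divides p (g : {mpoly F[m.+1]}).
  apply: contrapT => /forall2NP h.
  have c0 : c = 0%N.
    by apply: (noc c p hp) => w wW; have [//|/contrapT] := h w.
  have [p0 pU _] := pP; case/negP: pU; subst c.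
  have [k pk] : exists k, p = k%:MP.
    exists (p@_0); apply/mpolyP => mu; rewrite mcoeffC.
    have [->|mu0] := eqVneq mu 0%MM; first by rewrite mulr1.
    rewrite mulr0; apply: dhomog_nemf_coeff hp _.
    by rewrite mdeg_eq0.
  have k0 : k != 0 by apply: contraNneq p0 => k0; rewrite pk k0 mpolyC0.
  by rewrite pk; apply/unitrP; exists (k^-1)%:MP; rewrite -!mpolyCM mulVf ?mulfV.
exact: chain_in_codim2 pP hp pZ (dhomog_is_dhomog g) (WZ g gW) png.
Qed.

End DimensionBounds.

(** * Ranks among the numbers of bounded digit sum *)

Section Encoding.
Variable q : nat.
Hypothesis q_gt0 : 0 < q.

(** The first entry is the most significant digit, which makes the order of numbers the
    lexicographic one. *)
Fixpoint enc (s : seq nat) := if s is x :: s' then x * q ^ size s' + enc s' else 0.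

Lemma encE s : enc s = \sum_(i < size s) nth 0 s i * q ^ (size s - i.+1).
Proof.
elim: s => [|x s IH]; first by rewrite big_ord0.
by rewrite big_ord_recl /= subSS subn0 IH.
Qed.

Lemma enc_lt s : all (fun x => x < q) s -> enc s < q ^ size s.
Proof.
elim: s => //= x s IH /andP[xq /IH sq]; rewrite expnS.
by apply: leq_trans (_ : x.+1 * q ^ size s <= _); [rewrite mulSn addnC ltn_add2r|rewrite leq_mul2r xq orbT].
Qed.

Lemma enc_ge_nth s i : nth 0 s i * q ^ (size s - i.+1) <= enc s.
Proof.
elim: s i => [|x s IH] [|i] //=; first by rewrite subSS subn0 leq_addr.
by rewrite subSS; apply: leq_trans (IH i) (leq_addl _ _).
Qed.

Lemma digsum_small m n : n < q ^ m -> digsum q m.+1 n = digsum q m n.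
Proof.
elim: m n => [|m IH] n nq.
  have -> : n = 0 by move: nq; rewrite expn0; case: n.
  by rewrite /= mod0n.
by rewrite -[digsum q m.+2 n]/(n %% q + digsum q m.+1 (n %/ q)) IH // ltn_divLR // -expnSr.
Qed.

Lemma digsum_enc s : all (fun x => x < q) s -> digsum q (size s) (enc s) = sumn s.
Proof.
elim: s => //= x s IH /andP[xq sq]; have es := enc_lt sq.
by have := digsum_add_top q_gt0 es xq; rewrite /= => ->;
  have := digsum_small es; rewrite /= => ->; rewrite IH // addnC.
Qed.

Lemma enc_cons_le x y s t : enc s < q ^ size s -> enc t < q ^ size t -> size s = size t ->
  (enc (x :: s) <= enc (y :: t)) = (x <= y) && ((y <= x) ==> (enc s <= enc t)).
Proof.
move=> es et st /=; rewrite -st in et *; case: (ltngtP x y) => xy /=.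
- have : x.+1 * q ^ size s <= y * q ^ size s by rewrite leq_mul2r xy orbT.
  by rewrite mulSn; lia.
- have : y.+1 * q ^ size s <= x * q ^ size s by rewrite leq_mul2r xy orbT.
  by rewrite mulSn; lia.
- by rewrite xy leq_add2l.
Qed.

Lemma dec_exists m n : n < q ^ m -> exists2 s, size s = m & all (fun x => x < q) s /\ enc s = n.
Proof.
elim: m n => [|m IH] n nq.
  by exists [::] => //; split=> //=; move: nq; rewrite expn0; case: n.
have qm : 0 < q ^ m by rewrite expn_gt0 q_gt0.
have [s sm [sq sn]] := IH (n %% q ^ m) (ltn_pmod _ qm).
exists (n %/ q ^ m :: s) => /=; first by rewrite sm.
by rewrite sq ltn_divLR // -expnS nq sm sn; split=> //; rewrite -divn_eq.
Qed.

Definition upcount m D n := \sum_(N < q ^ m) ((n <= N) && (digsum q m N <= D)).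

Lemma lowcount_up m D n : n <= q ^ m -> lowcount q m 0 D n + upcount m D n = lowcount q m 0 D (q ^ m).
Proof.
move=> nq; rewrite /lowcount /upcount.
rewrite (big_ord_widen _ (fun N => nat_of_bool (digsum q m N + 0 <= D)) nq) big_mkcond -big_split.
apply: eq_bigr => N _ /=; rewrite addn0; case: (ltnP N n) => _ //=.
by rewrite addn0.
Qed.

Lemma leq_upcount m D n n' : n <= n' -> upcount m D n' <= upcount m D n.
Proof.
move=> nn'; apply: leq_sum => N _; case: (leqP n' N) => //= n'N.
by rewrite (leq_trans nn' n'N).
Qed.

Lemma upcount_lt m D n n' : n < q ^ m -> digsum q m n <= D -> n < n' ->
  upcount m D n' < upcount m D n.
Proof.
move=> nq nD nn'; rewrite /upcount (bigD1 (Ordinal nq)) //= [X in _ < X](bigD1 (Ordinal nq)) //=.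
have -> : (n' <= n) = false by rewrite leqNgt nn'.
rewrite leqnn nD /= ltnS; apply: leq_sum => N _.
by case: (leqP n' N) => //= n'N; rewrite (leq_trans (ltnW nn') n'N).
Qed.

(** [n] is the [r]-th largest admissible number; [r] determines it, and all later comparisons
    identify numbers in this way. *)
Definition isrank m D r n := [/\ n < q ^ m, digsum q m n <= D & upcount m D n = r].

(** Turns independent conditions into a bound on points. The numbers below [n] account for all
    conditions but [r], and [n] itself is admissible, so [G > n] would give one condition too
    many. *)
Lemma rank_bound m D r n G : D < q -> isrank m D r n ->
  lowcount q m 0 D G + r <= 'C(D + m, m) -> G <= n.
Proof.
move=> Dq [nq nD nr] h; rewrite leqNgt; apply/negP => nG.
have := lowcount_up D (ltnW nq); rewrite nr lowcount_full // subn0 => e.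
have := leq_lowcount q m 0 D nG; rewrite -[n.+1]addn1 lowcountD big_ord_recl big_ord0 /=.
by rewrite !addn0 nD; lia.
Qed.

Lemma digsum_add_lead m c n : c < q -> n < (q - c) * q ^ m ->
  digsum q m.+1 (c * q ^ m + n) = digsum q m.+1 n + c.
Proof.
elim: m n => [|m IH] n cq nq.
  by rewrite /= !addn0 muln1 !modn_small; rewrite ?muln1 in nq; lia.
have nq' : n %/ q < (q - c) * q ^ m by rewrite ltn_divLR // -mulnA -expnSr.
rewrite expnSr mulnA -[digsum q m.+2 _]/(_ %% q + digsum q m.+1 (_ %/ q)).
by rewrite modnMDl divnMDl // IH // addnA.
Qed.

(** Numbers of digit sum at most [D] lie below [(q - c) * q ^ m]. Adding [c] to their leading digit
    therefore causes no overflow and maps them onto the numbers of digit sum at most [D + c] that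
    are at least [c * q ^ m]. *)
Lemma rank_shift m D c r n : D + c < q -> isrank m.+1 D r n ->
  isrank m.+1 (D + c) r (c * q ^ m + n).
Proof.
move=> Dcq [nq nD nr]; have cq : c < q by lia.
have low N : N < q ^ m.+1 -> digsum q m.+1 N <= D -> N < (q - c) * q ^ m.
  move=> Nq ND; have := digsum_ge q_gt0 Nq => h.
  apply: leq_ltn_trans h _; by rewrite ltn_mul2r expn_gt0 q_gt0 andTb ltn_subRL addnC; apply: leq_ltn_trans Dcq; rewrite leq_add2r.
have qE : q ^ m.+1 = c * q ^ m + (q - c) * q ^ m by rewrite -mulnDl subnKC ?expnS // ltnW.
have nlow := low n nq nD; split.
- by rewrite qE ltn_add2l.
- by rewrite digsum_add_lead // leq_add2r.
rewrite -nr /upcount.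
have addl N := @digsum_add_lead m c N cq.
move: (digsum q m.+1) low addl {nD nr} => ds low addl.
rewrite qE big_split_ord /= big1 ?add0n; last first.
  move=> N _; rewrite leqNgt (leq_trans (ltn_ord N)) ?leq_addr //.
rewrite [c * _ + _ in RHS]addnC big_split_ord /= [X in _ = _ + X]big1 ?addn0; last first.
  move=> N _; apply/eqP; rewrite eqb0 negb_and -!ltnNge.
  case: (leqP n _) => //= _; rewrite ltnNge; apply/negP => /low.
  rewrite qE addnC ltn_add2r ltn_ord => /(_ isT).
  by rewrite ltnNge leq_addl.
by apply: eq_bigr => N _; rewrite leq_add2l addl // leq_add2r.
Qed.

End Encoding.

(** * Exponent tuples and their numbers *)

Section Tuples.
Variables (q d m : nat).
Hypothesis dq : d < q.
Let q_gt0 : 0 < q := leq_ltn_trans (leq0n d) dq.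
Implicit Types alpha beta : m.-tuplelexi 'I_d.+1.

Definition natseq (s : seq 'I_d.+1) : seq nat := [seq nat_of_ord a | a <- s].

Lemma natseq_lt s : all (fun x => x < q) (natseq s).
Proof. by apply/allP => _ /mapP[a _ ->]; apply: leq_ltn_trans dq; rewrite -ltnS. Qed.

Definition encT alpha := enc q (natseq alpha).

Lemma natseq_size alpha : size (natseq alpha) = m.
Proof. by rewrite size_map size_tuple. Qed.

Lemma natseq_nth alpha (i : 'I_m) : nth 0 (natseq alpha) i = tnth alpha i.
Proof. by rewrite (nth_map ord0) ?size_tuple // -tnth_nth. Qed.

Lemma encT_lt alpha : encT alpha < q ^ m.
Proof. by have := enc_lt (natseq_lt alpha); rewrite natseq_size. Qed.

Lemma encTE alpha : encT alpha = \sum_(i < m) tnth alpha i * q ^ (m - i.+1).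
Proof.
rewrite /encT encE natseq_size; apply: eq_bigr => i _.
by rewrite natseq_nth.
Qed.

Lemma sumn_natseq alpha : sumn (natseq alpha) = \sum_(i < m) tnth alpha i.
Proof.
rewrite sumnE big_map big_tuple; exact: eq_bigr.
Qed.

Lemma digsum_encT alpha : digsum q m (encT alpha) = \sum_(i < m) tnth alpha i.
Proof. by rewrite -sumn_natseq -(digsum_enc q_gt0 (natseq_lt alpha)) natseq_size. Qed.

Lemma enc_lexi (s t : seqlexi 'I_d.+1) : size s = size t ->
  (s <= t)%O = (enc q (natseq s) <= enc q (natseq t)).
Proof.
elim: s t => [|x s IH] [|y t] //= [st].
have sz (u : seq 'I_d.+1) : size (natseq u) = size u by rewrite size_map.
have lt (u : seq 'I_d.+1) : enc q (natseq u) < q ^ size (natseq u) by apply: enc_lt (natseq_lt u).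
have es : size (natseq s) = size (natseq t) by rewrite !sz.
rewrite (enc_cons_le q_gt0 x y (lt s) (lt t) es).
by rewrite Order.SeqLexiOrder.Exports.lexi_cons -IH // !leEord.
Qed.

Lemma encT_le alpha beta : (alpha <= beta)%O = (encT alpha <= encT beta).
Proof. by apply: enc_lexi; rewrite !size_tuple. Qed.

Lemma encT_inj : injective encT.
Proof.
move=> a b ab; apply: Order.POrderTheory.le_anti.
by rewrite !encT_le ab leqnn.
Qed.

Lemma decT n : n < q ^ m -> digsum q m n <= d -> exists alpha, encT alpha = n.
Proof.
move=> /(dec_exists q_gt0)[s sm [sq sn]]; rewrite -sn -{1}sm digsum_enc // => sd.
have sle x : x \in s -> x < d.+1.
  by move=> xs; rewrite ltnS (leq_trans _ sd) // (perm_sumn (perm_to_rem xs)) /= leq_addr.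
pose t := [seq inord x : 'I_d.+1 | x <- s].
have tm : size t == m by rewrite size_map sm.
exists (Tuple tm); rewrite /encT /=; congr enc.
rewrite /natseq -map_comp -[RHS]map_id; apply/eq_in_map => x xs /=.
by rewrite inordK // sle.
Qed.

Definition Delta : {pred m.-tuplelexi 'I_d.+1} := fun alpha => \sum_(i < m) tnth alpha i <= d.

Lemma card_Delta n : #|[pred beta | Delta beta && (n <= encT beta)]| = upcount q m d n.
Proof.
pose f beta := Ordinal (encT_lt beta).
have fI : injective f by move=> a b /(congr1 val)/encT_inj.
rewrite -(card_image fI) /upcount.
transitivity #|[pred N : 'I_(q ^ m) | (n <= N) && (digsum q m N <= d)]|; last first.
  by rewrite -sum1_card big_mkcond; apply: eq_bigr => N _; rewrite inE; case: (_ && _).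
apply: eq_card => N; rewrite !inE; apply/imageP/andP => [[b]|[nN dN]].
  by rewrite inE /Delta -digsum_encT => /andP[bd nb] ->.
have [b bN] := decT (ltn_ord N) dN.
exists b; last by apply: val_inj; rewrite /= bN.
by rewrite inE /Delta -digsum_encT bN dN.
Qed.

Definition delta (j : 'I_m) : m.-tuplelexi 'I_d.+1 :=
  [tuple if i == j then ord_max else ord0 | i < m].

Lemma encT_delta j : encT (delta j) = d * q ^ (m - j.+1).
Proof.
rewrite encTE (bigD1 j) //= tnth_mktuple eqxx big1 ?addn0 // => i ij.
by rewrite tnth_mktuple (negPf ij).
Qed.

Lemma Delta_delta j : Delta (delta j).
Proof.
rewrite /Delta (bigD1 j) //= tnth_mktuple eqxx big1 ?addn0 // => i ij.
by rewrite tnth_mktuple (negPf ij).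
Qed.

(** Among tuples of sum at most [d], each bound by [d - 1] in [Omega'] excludes exactly one; the
    bounds by [q - 1] exclude none, as [d < q]. *)
Lemma Delta_lt beta j : Delta beta -> (tnth beta j < d) = (beta != delta j).
Proof.
rewrite /Delta (bigD1 j) //= => bd; case: (ltnP (tnth beta j) d) => bj.
  apply/esym/eqP => bE; move: bj; rewrite bE tnth_mktuple eqxx ltnn //.
have b0 : \sum_(i < m | i != j) tnth beta i = 0.
  by apply/eqP; rewrite -leqn0 -(leq_add2l d) addn0 (leq_trans _ bd) // leq_add2r.
apply/esym/negbTE; rewrite negbK; apply/eqP/eq_from_tnth => i; apply: val_inj.
rewrite tnth_mktuple; case: eqVneq => [->|ij] /=.
  by apply/eqP; rewrite eqn_leq bj -ltnS ltn_ord.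
by move/eqP: b0; rewrite sum_nat_eq0 => /forallP/(_ i); rewrite ij => /eqP.
Qed.

Lemma Delta_q beta j : Delta beta -> tnth beta j < q.
Proof. by move=> _; apply: leq_ltn_trans dq; rewrite -ltnS. Qed.

Lemma count_sorted_ge (s : seq (m.-tuplelexi 'I_d.+1)) x0 i :
  uniq s -> sorted (fun u v => (v <= u)%O) s -> i < size s ->
  count (fun beta => encT (nth x0 s i) <= encT beta) s = i.+1.
Proof.
move=> us ss si.
have tr : transitive (fun u v : m.-tuplelexi 'I_d.+1 => (v <= u)%O).
  by move=> a b c ab ca; apply: Order.POrderTheory.le_trans ca ab.
have P j : j < size s -> (encT (nth x0 s i) <= encT (nth x0 s j)) = (j <= i).
  move=> sj; rewrite -encT_le; apply/idP/idP => [ij|ji]; last first.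
    by apply: (sorted_leq_nth tr _ x0 ss) => // b; apply: Order.POrderTheory.lexx.
  rewrite leqNgt; apply/negP => lt_ij.
  have ji : (nth x0 s j <= nth x0 s i)%O.
    by apply: (sorted_leq_nth tr _ x0 ss) => //; apply: ltnW.
  have /eqP : nth x0 s i = nth x0 s j by apply: Order.POrderTheory.le_anti; rewrite ij ji.
  by rewrite nth_uniq // (ltn_eqF lt_ij).
rewrite -sum1_count (big_nth x0) big_mkord big_mkcond.
transitivity (\sum_(j < size s) (j < i.+1)).
  by apply: eq_bigr => j _; rewrite P // ltnS; case: (_ <= _).
rewrite (eq_bigr (fun j : 'I_(size s) => nat_of_bool (0 + j <= i))) //.
by rewrite sum_ord_leq; lia.
Qed.

Lemma w'_rank k s : 0 < s <= #|@Omega' d m k q| ->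
  Omega' k q (w' d m k q s) /\
  #|[pred beta | Omega' k q beta && (encT (w' d m k q s) <= encT beta)]| = s.
Proof.
case: s => // s; rewrite /= => sO; rewrite /w' /=.
set srt := sort _ _.
have pe : perm_eq srt (enum (@Omega' d m k q)) by rewrite perm_sort.
have szs : size srt = #|@Omega' d m k q| by rewrite size_sort -cardE.
have us : uniq srt by rewrite sort_uniq enum_uniq.
have ss : sorted (fun u v : m.-tuplelexi 'I_d.+1 => (v <= u)%O) srt.
  by apply: sort_sorted => a b; apply: Order.TotalTheory.le_total.
have ssz : s < size srt by rewrite szs.
split.
  by have := mem_nth (w'_zero d m) ssz; rewrite (perm_mem pe) mem_enum.
rewrite -[RHS](count_sorted_ge (w'_zero d m) us ss ssz) (permP pe).
rewrite -sum1_card -sum1_count big_enum_cond /=; apply: eq_bigl => b.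
by rewrite inE.
Qed.

End Tuples.

Section DigitSums.
Variable q : nat.
Hypothesis q_gt0 : 0 < q.

Lemma digsum0 m : digsum q m 0 = 0.
Proof. by elim: m => //= m IH; rewrite mod0n div0n. Qed.

(** The last nonzero digit, in position [i], is lowered by one. *)
Lemma digsum_pred k n : 0 < n -> n < q ^ k ->
  exists2 i, i < k & q ^ i <= n /\ digsum q k (n - q ^ i) < digsum q k n.
Proof.
elim: k n => [|k IH] n n0 nq; first by move: nq; rewrite expn0 ltnNge n0.
have [nq0|nq0] := posnP (n %% q).
  have nE : n = n %/ q * q by rewrite {1}(divn_eq n q) nq0 addn0.
  have n'0 : 0 < n %/ q by rewrite lt0n; apply: contraTneq n0 => e; rewrite nE e.
  have [|i ik [qi di]] := IH (n %/ q) n'0; first by rewrite ltn_divLR // -expnSr.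
  exists i.+1 => //; split; first by rewrite nE expnSr leq_mul2r qi orbT.
  have -> : n - q ^ i.+1 = (n %/ q - q ^ i) * q by rewrite mulnBl -expnSr -nE.
  by rewrite /= nq0 modnMl mulnK.
exists 0 => //; split; first by rewrite expn0.
have nE : n - q ^ 0 = n %/ q * q + (n %% q - 1) by rewrite {1}(divn_eq n q) expn0 addnBA.
have e : n %% q - 1 < q by apply: leq_ltn_trans (leq_subr _ _) (ltn_pmod n q_gt0).
rewrite nE /= modnMDl (modn_small e) divnMDl // (divn_small e) addn0.
by rewrite ltn_add2r subn1 ltn_predL.
Qed.

End DigitSums.

(** * The conjectural values in terms of ranks *)

Section ConjecturalValues.
Variables (q d m' : nat).
Hypothesis dq : d < q.
Hypothesis d_gt0 : 0 < d.
Local Notation m := m'.+2.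
Local Notation encT := (@encT q d m).
Let q_gt0 : 0 < q := leq_ltn_trans (leq0n d) dq.
Let q_gt1 : 1 < q := leq_ltn_trans d_gt0 dq.
Implicit Types alpha beta : m.-tuplelexi 'I_d.+1.

Lemma enc_lt_lead s f : f <= size s -> all (fun x => x < q) s ->
  (forall i, i < f -> nth 0 s i = 0) -> enc q s < q ^ (size s - f).
Proof.
elim: s f => [|x s IH] [|f] //; try by move=> _ sq _; rewrite subn0; apply: enc_lt sq.
rewrite ltnS => fs /= /andP[_ sq] s0; have -> : x = 0 by apply: (s0 0).
by rewrite mul0n add0n subSS; apply: IH => // i; apply: (s0 i.+1).
Qed.

(** With first nonzero index [l], the number of [alpha] lies in the range from [q ^ (m - l)] up to
    [q ^ (m - l + 1)], so its logarithm is [m - l]. For the zero tuple [trunc_log] is 0, in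
    agreement with an empty contribution. *)
Lemma proj_count_tail alpha k : k <= m ->
  proj_count q (Num.min (m%:Z - (first_nonzero alpha)%:Z - 1) (k%:Z - 1))%R =
  (q ^ (minn (trunc_log q (encT alpha)) k) - 1) %/ (q - 1).
Proof.
move=> km; rewrite /first_nonzero; set f := find _ _.
have pc J : proj_count q (J%:Z - 1)%R = (q ^ J - 1) %/ (q - 1).
  by case: J => [|J]; [rewrite expn0 subnn div0n | have -> : (J.+1%:Z - 1 = J%:Z)%R by lia].
have fm : f <= m by have := find_size (fun a : 'I_d.+1 => a != 0 :> nat) alpha; rewrite size_tuple.
have before i : i < f -> nth 0 (natseq alpha) i = 0.
  move=> fi; have im : i < m by apply: leq_trans fi fm.
  have := before_find ord0 fi; rewrite (nth_map ord0) ?size_tuple // => /negbT.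
  by rewrite negbK => /eqP.
have sz := natseq_size alpha.
have lt : encT alpha < q ^ (m - f).
  by have := enc_lt_lead _ (natseq_lt dq alpha) before; rewrite sz; apply.
have [fm'|fm'] := ltnP f m; last first.
  have ef : f = m by apply/eqP; rewrite eqn_leq fm.
  have -> : encT alpha = 0 by move: lt; rewrite ef subnn expn0; case: encT.
  rewrite trunc_log0 min0n expn0 subnn div0n ef.
  by have -> : (Num.min (m%:Z - m.+1%:Z - 1) (k%:Z - 1) = - 2%:Z)%R by lia.
have ge : q ^ (m - f.+1) <= encT alpha.
  have := enc_ge_nth q (natseq alpha) f; rewrite sz; apply: leq_trans.
  rewrite leq_pmull // lt0n (nth_map ord0) ?size_tuple //.
  by apply: (nth_find ord0 (a := fun a : 'I_d.+1 => a != 0 :> nat)); rewrite has_find size_tuple.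
have -> : trunc_log q (encT alpha) = m - f.+1.
  by apply: trunc_log_eq => //; rewrite ge -subSn.
rewrite -pc; congr proj_count.
by lia.
Qed.

Lemma encT_quot alpha : encT alpha %/ q ^ m'.+1 = tnth alpha ord0.
Proof.
case/tupleP: alpha => x s; have sz := natseq_size s; rewrite tnth0.
rewrite -[encT _]/(x * q ^ size (natseq s) + enc q (natseq s)) sz divnMDl ?expn_gt0 ?q_gt0 // divn_small ?addn0 //.
by have := enc_lt (natseq_lt dq s); rewrite sz.
Qed.

Lemma upcount_total : upcount q m d 0 = 'C(d + m, m).
Proof.
have := lowcount_up d (leq0n (q ^ m)).
by rewrite lowcount_full // subn0 /lowcount big_ord0.
Qed.

Lemma upcount_top : upcount q m d (d * q ^ m'.+1) = 1.
Proof.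
have topE : d * q ^ m'.+1 = encT (delta d ord0) by rewrite encT_delta subSS subn0.
have top_lt : d * q ^ m'.+1 < q ^ m by rewrite topE; apply: encT_lt.
have top_d : digsum q m (d * q ^ m'.+1) <= d by rewrite topE digsum_encT //; apply: Delta_delta.
rewrite /upcount (bigD1 (Ordinal top_lt)) // leqnn top_d big1 // => N Ntop.
apply/eqP; rewrite eqb0; apply: contra Ntop => /andP[topN dN]; apply/eqP/val_inj/eqP.
rewrite /= eqn_leq topN andbT; apply: leq_trans (digsum_ge q_gt0 (ltn_ord N)) _.
by rewrite leq_mul2r dN orbT.
Qed.

Let i1 : 'I_m := Ordinal (isT : 1 < m).

Lemma Omega'_hyper beta : Omega' m'.+1 q beta = Delta beta && (beta != delta d ord0).
Proof.
rewrite /Omega' subSnn andbC -/(Delta beta); case bD: (Delta beta) => //=.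
rewrite -Delta_lt //; apply/forallP/idP => [/(_ ord0) //|b0 i].
case: i => -[|i] im /=; last exact: (Delta_q dq _ bD).
by rewrite (_ : Ordinal im = ord0) //; apply: val_inj.
Qed.

Lemma Omega'_codim2 beta :
  Omega' m' q beta = Delta beta && ((beta != delta d ord0) && (beta != delta d i1)).
Proof.
rewrite /Omega' subSn ?leqnSn // subSnn andbC -/(Delta beta); case bD: (Delta beta) => //=.
rewrite -!Delta_lt //; apply/forallP/andP => [b|[b0 b1] i].
  by have := b ord0; have := b i1.
case: i => -[|[|i]] im /=.
- by rewrite (_ : Ordinal im = ord0) //; apply: val_inj.
- by rewrite (_ : Ordinal im = i1) //; apply: val_inj.
- exact: (Delta_q dq _ bD).
Qed.

Lemma card_Omega_hyper n :
  #|[pred beta | Omega' m'.+1 q beta && (n <= encT beta)]| + (n <= d * q ^ m'.+1) = upcount q m d n.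
Proof.
rewrite -(card_Delta _ dq) [RHS](cardD1 (delta d ord0)) !inE Delta_delta encT_delta subSS subn0 /= addnC.
by congr (_ + _); apply: eq_card => b; rewrite !inE Omega'_hyper andbAC andbC.
Qed.

Lemma card_Omega_codim2 n :
  #|[pred beta | Omega' m' q beta && (n <= encT beta)]| + (n <= d * q ^ m'.+1) + (n <= d * q ^ m')
  = upcount q m d n.
Proof.
rewrite -(card_Delta _ dq) [RHS](cardD1 (delta d ord0)) !inE Delta_delta encT_delta subSS subn0 /=.
rewrite [in RHS]addnC addnAC; congr (_ + _); rewrite [RHS](cardD1 (delta d i1)) !inE Delta_delta.
rewrite encT_delta /= !subSS subn0 addnC.
have -> : delta d i1 != delta d ord0.
  apply/eqP => /(congr1 encT)/eqP; rewrite !encT_delta /= !subSS !subn0 eqn_pmul2l //.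
  by rewrite eqn_exp2l // ltn_eqF.
congr (_ + _); apply: eq_card => b; rewrite !inE Omega'_codim2.
by case: Delta; case: (b == _); case: (b == _); rewrite ?andbF ?andbT.
Qed.

(** For [k = m - 1] only the largest tuple [(d, 0, ..., 0)] is missing from [Omega'], so its element
    of index [r - 1] has rank [r] among all tuples. *)
Lemma rank_hyper r : 1 < r <= 'C(d + m, m) ->
  isrank q m d r (encT (w' d m m'.+1 q r.-1)).
Proof.
move=> /andP[r1 rC].
have cO : #|@Omega' d m m'.+1 q| + 1 = 'C(d + m, m).
  rewrite -upcount_total -card_Omega_hyper leq0n; congr (_ + _).
  by apply: eq_card => b; rewrite inE andbT.
have [] := @w'_rank q d m dq m'.+1 r.-1; first by lia.
set a := w' _ _ _ _ _ => Oa ca; move: (Oa); rewrite Omega'_hyper => /andP[Da _].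
have dga : digsum q m (encT a) <= d by rewrite digsum_encT.
have a_top : encT a <= d * q ^ m'.+1.
  have := digsum_ge q_gt0 (encT_lt dq a); move/leq_trans; apply.
  by rewrite leq_mul2r dga orbT.
split; [exact: encT_lt | exact: dga |].
by rewrite -card_Omega_hyper ca a_top; lia.
Qed.

Lemma w'_zeroE : w'_zero d m = delta d ord0.
Proof. by apply: eq_from_tnth => i; rewrite !tnth_mktuple. Qed.

(** For [k = m - 2] the tuple [(0, d, 0, ..., 0)], of number [d * q ^ m'], is missing too. The
    element of index [r - 2] thus has rank [r] if it lies below that number and [r - 1] if above. *)
Lemma rank_codim2 r : 1 < r <= 'C(d + m, m) -> let a := encT (w' d m m' q (r - 2)) in
  [/\ a < q ^ m, digsum q m a <= d & upcount q m d a + (d * q ^ m' < a) = r].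
Proof.
move=> /andP[r1 rC] a.
have top_e : d * q ^ m' < d * q ^ m'.+1 by rewrite ltn_pmul2l // ltn_exp2l.
have cO : #|@Omega' d m m' q| + 2 = 'C(d + m, m).
  rewrite -upcount_total -card_Omega_codim2 !leq0n -addnA; congr (_ + _).
  by apply: eq_card => b; rewrite inE andbT.
(* Index 0 is the conventional tuple [(d, 0, ..., 0)], which is not in [Omega']. *)
have [r2|r2] := eqVneq r 2.
  have aE : a = d * q ^ m'.+1.
    by rewrite /a r2 /w' /= w'_zeroE encT_delta subSS subn0.
  have aE' : a = encT (delta d ord0) by rewrite aE encT_delta subSS subn0.
  split; [by rewrite aE' encT_lt | by rewrite aE' digsum_encT //; apply: Delta_delta |].
  by rewrite aE upcount_top top_e r2.
have [] := @w'_rank q d m dq m' (r - 2); first by lia.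
rewrite -/a => Oa ca; move: (Oa); rewrite Omega'_codim2 => /andP[Da _].
have dga : digsum q m a <= d by rewrite digsum_encT.
have a_top : a <= d * q ^ m'.+1.
  have := digsum_ge q_gt0 (encT_lt dq (w' d m m' q (r - 2))); move/leq_trans; apply.
  by rewrite leq_mul2r dga orbT.
split=> //; first exact: encT_lt.
rewrite -card_Omega_codim2 ca a_top; case: leqP => _; lia.
Qed.

Lemma fP_hyper r : 1 < r <= 'C(d + m, m) ->
  let n := encT (w' d m m'.+1 q r.-1) in
  fP d m m'.+1 q r = n + (q ^ trunc_log q n - 1) %/ (q - 1).
Proof.
move=> /andP[r1 _] n; rewrite /fP /fA subSnn subn1 r1 proj_count_tail //.
congr (_ + _).
  rewrite big1 ?add0n => [|i]; last by rewrite ltnS ltn0.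
  by rewrite /n encTE; apply: eq_bigl => i; rewrite ltn0Sn.
congr ((q ^ _ - 1) %/ _); apply/minn_idPl.
have := encT_lt dq (w' d m m'.+1 q r.-1); rewrite -/n => nq.
have [->|n0] := posnP n; first by rewrite trunc_log0.
by rewrite -ltnS -(ltn_exp2l _ _ q_gt1); apply: leq_ltn_trans nq; apply: trunc_logP.
Qed.

(** The leading exponent has weight [d * q ^ m'] in the formula but [q ^ m'.+1] in the number; the
    difference is added on the left to avoid a subtraction. *)
Lemma fP_codim2 r : 1 < r ->
  let a := encT (w' d m m' q (r - 2)) in
  fP d m m' q r + (a %/ q ^ m'.+1) * ((q - d) * q ^ m') =
  a + (q ^ minn (trunc_log q a) m' - 1) %/ (q - 1).
Proof.
move=> r1 a; rewrite /fP /fA subSn ?leqnSn // subSnn proj_count_tail; last by apply: leq_trans (leqnSn _) (leqnSn _).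
rewrite addnAC; congr (_ + _); rewrite -/a.
have a0 : a %/ q ^ m'.+1 = tnth (w' d m m' q (r - 2)) ord0 by apply: encT_quot.
have aE : a = tnth (w' d m m' q (r - 2)) ord0 * q ^ m'.+1 +
    \sum_(i < m'.+1) tnth (w' d m m' q (r - 2)) (lift ord0 i) * q ^ (m'.+1 - i.+1).
  by rewrite /a encTE big_ord_recl subSS subn0; congr (_ + _); apply: eq_bigr => i _; rewrite subSS.
have qE x : x * d * q ^ m' + x * ((q - d) * q ^ m') = x * q ^ m'.+1.
  by rewrite -mulnA -mulnDr -mulnDl subnKC ?expnS // ltnW.
case: ifP => r2; last first.
  have r2' : r = 2 by lia.
  have w0 : w' d m m' q (r - 2) = delta d ord0.
    by rewrite r2' /w' /= w'_zeroE.
  have aE' : a = d * q ^ m'.+1 by rewrite /a w0 encT_delta subSS subn0.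
  have -> : a %/ q ^ m'.+1 = d by rewrite a0 w0 tnth_mktuple eqxx.
  by rewrite aE' -mulnn qE.
rewrite a0 [in RHS]aE.
have -> : \sum_(i < m | i.+1 < 2) tnth (w' d m m' q (r - 2)) i * d ^ (2 - i.+1) * q ^ m' =
    tnth (w' d m m' q (r - 2)) ord0 * d * q ^ m'.
  rewrite (bigD1 ord0) //= big1 ?addn0 ?expn1 //.
  by case=> -[|i] im /andP[].
have -> : \sum_(i < m | 2 <= i.+1) tnth (w' d m m' q (r - 2)) i * q ^ (m - i.+1) =
    \sum_(i < m'.+1) tnth (w' d m m' q (r - 2)) (lift ord0 i) * q ^ (m'.+1 - i.+1).
  rewrite [LHS]big_mkcond [LHS]big_ord_recl; apply: etrans (add0n _) _.
  by apply: eq_bigr => i _; rewrite -[in RHS]subSS.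
by rewrite addnAC qE.
Qed.

(* With [a] the number of the tuple on the left: decreasing the last nonzero digit of [a] lowers it by
   at most [q ^ m'], and if only the leading digit is nonzero a smaller tuple is explicit. *)
Lemma fP_codim2_le r b : 1 < r <= 'C(d + m, m) -> isrank q m d r b ->
  fP d m m' q r <= b + (q ^ minn (trunc_log q b) m' - 1) %/ (q - 1).
Proof.
move=> hr [bq bd br]; have [aq ad ar] := rank_codim2 hr.
have /andP[r1 _] := hr; have := fP_codim2 r1.
move: aq ad ar; set a := encT _ => aq ad ar fE.
have [ae|ea] := leqP a (d * q ^ m').
  rewrite ltnNge ae addn0 in ar.
  have ab : a = b.
    case: (ltngtP a b) => // lt.
      by have := upcount_lt aq ad lt; rewrite ar br ltnn.
    by have := upcount_lt bq bd lt; rewrite ar br ltnn.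
  by rewrite -ab -fE leq_addr.
rewrite ea addn1 in ar.
have ba : b < a.
  rewrite ltnNge; apply/negP => /(leq_upcount q m d); rewrite br; lia.
(* [a] and [b] have consecutive ranks, so [b] is the largest admissible number below [a]. An
   admissible number close to [a] thus suffices. *)
have below b0 : b0 < a -> digsum q m b0 <= d -> b0 <= b.
  move=> b0a b0d; rewrite leqNgt; apply/negP => bb0.
  have := upcount_lt bq bd bb0.
  have := upcount_lt (ltn_trans b0a aq) b0d b0a; lia.
set a1 := a %/ q ^ m'.+1 in fE.
have qm0 k : 0 < q ^ k by rewrite expn_gt0 q_gt0.
have aE : a = a1 * q ^ m'.+1 + a %% q ^ m'.+1 by apply: divn_eq.
have a1d : a1 + digsum q m (a %% q ^ m'.+1) <= d.
  have lt := ltn_pmod a (qm0 m'.+1).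
  have a1q : a1 < q by rewrite ltn_divLR // -expnS.
  by move: ad; rewrite {1}aE digsum_add_top // addnC.
have a1_gt0 : 0 < a1.
  rewrite lt0n; apply/eqP => a10; move: ea; rewrite aE a10 mul0n add0n ltnNge => /negP; apply.
  have lt := ltn_pmod a (qm0 m'.+1).
  apply: leq_trans (digsum_ge q_gt0 lt) _; rewrite leq_mul2r -digsum_small //.
  by rewrite (leq_trans _ a1d) ?leq_addl ?orbT.
have a1d' : a1 <= d by apply: leq_trans a1d; apply: leq_addr.
have eb : q ^ m' <= b.
  apply: leq_trans (below _ ea _); first by rewrite leq_pmull.
  have -> : d * q ^ m' = encT (delta d i1) by rewrite encT_delta /= !subSS subn0.
  by rewrite digsum_encT //; apply: Delta_delta.
have tb : minn (trunc_log q b) m' = m' by apply/minn_idPr; apply: trunc_log_max.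
suff : a <= b + a1 * ((q - d) * q ^ m').
  have : (q ^ minn (trunc_log q a) m' - 1) %/ (q - 1) <= (q ^ m' - 1) %/ (q - 1).
    by apply: leq_div2r; apply: leq_sub2r; rewrite leq_exp2l // geq_minr.
  by move: fE; rewrite tb /=; lia.
have [a'0|a'0] := posnP (a %% q ^ m'.+1).
  have cq : d - a1.-1 < q by lia.
  have c_lt : (d - a1.-1) * q ^ m' < q ^ m'.+1 by rewrite expnS ltn_mul2r qm0.
  (* The number with digits [a1 - 1], [d - (a1 - 1)], 0, ..., 0 takes the role of [b0] when only the
     leading digit of [a] is nonzero. *)
  have := below (a1.-1 * q ^ m'.+1 + (d - a1.-1) * q ^ m').
  have -> : digsum q m (a1.-1 * q ^ m'.+1 + (d - a1.-1) * q ^ m') = d.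
    rewrite digsum_add_top //; last by lia.
    rewrite digsum_small //; have := digsum_add_top q_gt0 (qm0 m') cq.
    by rewrite addn0 => ->; rewrite digsum0 add0n; lia.
  rewrite aE a'0 addn0 leqnn => /(_ _ isT) h.
  apply: leq_trans (leq_add (h _) (leqnn _)).
    have small : a1 * q <= a1.-1 * q + (d - a1.-1) + a1 * (q - d).
      rewrite -(prednK a1_gt0) /= !mulSn.
      have := leq_pmulr a1.-1 (_ : 0 < q - d); rewrite subn_gt0 => /(_ dq).
      by move: (a1.-1 * q) (a1.-1 * (q - d)) => x y; lia.
    by rewrite [q ^ m'.+1]expnS !mulnA -!mulnDl leq_mul2r small orbT.
  by rewrite -[in X in _ < X](prednK a1_gt0) mulSn addnC ltn_add2r.
have lt := ltn_pmod a (qm0 m'.+1).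
have [i im [qi di]] := digsum_pred q_gt0 a'0 lt.
have b0E : a1 * q ^ m'.+1 + (a %% q ^ m'.+1 - q ^ i) = a - q ^ i by rewrite [in RHS]aE addnBA.
have h : a - q ^ i <= b.
  apply: below; first by have := qm0 i; lia.
  rewrite -b0E digsum_add_top //; last 2 first.
  - by apply: leq_ltn_trans (leq_subr _ _) lt.
  - lia.
  have lt' : a %% q ^ m'.+1 - q ^ i < q ^ m'.+1 by apply: leq_ltn_trans (leq_subr _ _) lt.
  apply: leq_trans a1d; rewrite addnC leq_add2l.
  by rewrite (digsum_small q_gt0 lt) (digsum_small q_gt0 lt') ltnW.
have qq : q ^ i <= a1 * ((q - d) * q ^ m').
  apply: (@leq_trans (q ^ m')); first by rewrite leq_exp2l // -ltnS.
  by rewrite mulnA leq_pmull // muln_gt0 a1_gt0 subn_gt0.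
by apply: leq_trans (leq_add h qq); rewrite addnC -leq_subLR.
Qed.

End ConjecturalValues.

(** * Counting projective points through vectors *)

Section ProjectiveCounting.
Local Open Scope ring_scope.
Variables (F : finFieldType) (m : nat).
Local Notation q := #|F|.
Let q_gt0 : (0 < q)%N. Proof. by apply/card_gt0P; exists 0. Qed.
Let q_gt1 : (1 < q)%N. Proof. exact: finNzRing_gt1. Qed.
Implicit Type P : pred 'rV[F]_m.+1.

Definition scale_invariant P := forall t x, t != 0 -> P (t *: x) = P x.

Lemma card_units : #|[set t : F | t != 0]| = (q - 1)%N.
Proof. by rewrite -cardsT (cardsD1 0 setT) inE add1n subn1 /=; apply: eq_card => t; rewrite !inE andbT. Qed.

(* Off the hyperplane [l = 0], scale to [l = 1]. *)
Lemma card_linf P (l : 'cV[F]_m.+1) : scale_invariant P ->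
  #|[set x | (x != 0) && P x]| =
  (#|[set x | (x != 0)%R && (linf l x == 0)%R && P x]| +
   (q - 1) * #|[set x | (linf l x == 1)%R && P x]|)%N.
Proof.
move=> Pinv; rewrite -[LHS](cardsID [set x | linf l x == 0]); congr (_ + _)%N.
  by apply: eq_card => x; rewrite !inE andbAC.
rewrite -card_units -cardsX.
pose f (tx : F * 'rV[F]_m.+1) := tx.1 *: tx.2.
rewrite -(card_in_imset (f := f)) => [|[t x] [u y]]; last first.
  rewrite !inE /= => /andP[t0 /andP[/eqP lx _]] /andP[u0 /andP[/eqP ly _]] e.
  have : linf l (t *: x) = linf l (u *: y) by congr linf.
  rewrite !linfZ lx ly !mulr1 => tu; rewrite /f /= tu in e.
  by congr (_, _) => //; apply: (scalerI u0).
apply: eq_card => x; apply/idP/imsetP => [|[[t y]]].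
  rewrite !inE => /andP[lx /andP[x0 Px]]; exists (linf l x, (linf l x)^-1 *: x).
    by rewrite !inE /= lx linfZ mulVf // eqxx Pinv // invr_eq0.
  by rewrite /f /= scalerA mulfV // scale1r.
rewrite !inE /= => /andP[t0 /andP[/eqP ly Py]] ->; rewrite linfZ ly mulr1 t0 Pinv // Py andbT /=.
apply/eqP => /eqP; rewrite scaler_eq0 (negPf t0) => /eqP /= y0.
by move/eqP: ly; rewrite y0 /linf mul0mx mxE eq_sym oner_eq0.
Qed.

(** Every nonzero vector is a nonzero multiple of a normalized one, in a unique way. *)
Lemma card_proj P : scale_invariant P ->
  #|[set x | (x != 0)%R && P x]| = ((q - 1) * #|[pred z : proj_space F m | P (sval z)]|)%N.
Proof.
move=> Pinv.
pose f (tz : F * proj_space F m) := tz.1 *: sval tz.2.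
pose D := setX [set t : F | t != 0] [set z : proj_space F m | P (sval z)].
have -> : #|[pred z : proj_space F m | P (sval z)]| = #|[set z : proj_space F m | P (sval z)]|.
  by apply: eq_card => z; rewrite !inE.
rewrite -card_units -cardsX -/D.
have lead (z : proj_space F m) : exists2 i, sval z 0 i = 1 & forall j : 'I_m.+1, (j < i)%N -> sval z 0 j = 0.
  have /existsP[i /andP[/eqP zi /forallP zj]] := svalP z; exists i => // j ji.
  by have := zj j; rewrite ji => /eqP.
rewrite -(card_in_imset (f := f)) => [|[t z] [u y]]; last first.
  rewrite !inE /= => /andP[t0 _] /andP[u0 _]; rewrite /f /= => e.
  have [i zi zj] := lead z; have [k yk yj] := lead y.
  have e' j : t * sval z 0 j = u * sval y 0 j by have /rowP/(_ j) := e; rewrite !mxE.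
  have ik : i = k.
    apply: val_inj; case: (ltngtP i k) => // lt.
      by have /eqP := e' i; rewrite zi yj // mulr1 mulr0 (negPf t0).
    by have /eqP := e' k; rewrite yk zj // mulr1 mulr0 eq_sym (negPf u0).
  have tu : t = u by have := e' i; rewrite zi ik yk !mulr1.
  by rewrite tu in e *; congr (_, _); apply: val_inj; apply: (scalerI u0).
apply: eq_card => x; apply/idP/imsetP => [|[[t z]]].
  rewrite !inE => /andP[x0 Px].
  have ex : exists i, (fun i : nat => [exists j : 'I_m.+1, (j == i :> nat) && (x 0 j != 0)]) i.
    have /existsP[j xj] : [exists j, x 0 j != 0].
      apply: contraNT x0 => /existsPn h; apply/eqP/rowP => j; rewrite mxE.
      by apply/eqP; have := h j; rewrite negbK.
    by exists (j : nat); apply/existsP; exists j; rewrite eqxx.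
  case: (ex_minnP ex) => _ /existsP[i /andP[/eqP <- xi]] imin.
  have nz : normalized ((x 0 i)^-1 *: x).
    apply/existsP; exists i; rewrite mxE mulVf // eqxx; apply/forallP => j; apply/implyP => ji.
    rewrite mxE mulf_eq0; apply/orP; right; apply: contraTT ji => xj; rewrite -leqNgt.
    by apply: imin; apply/existsP; exists j; rewrite eqxx.
  exists (x 0 i, exist (fun y => is_true (normalized y)) _ nz); last by rewrite /f /= scalerA mulfV // scale1r.
  by rewrite !inE /= xi Pinv // invr_eq0.
rewrite !inE /= => /andP[t0 Pz] ->; rewrite /f /= Pinv // Pz andbT.
rewrite scaler_eq0 (negPf t0) /=; have [i zi _] := lead z.
by apply/eqP => /rowP/(_ i)/eqP; rewrite zi mxE oner_eq0.
Qed.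

Lemma card_linf0 (l : 'cV[F]_m.+1) : l != 0 -> (#|[set x | linf l x == 0%R]| <= q ^ m)%N.
Proof.
move=> /move_linf[M Mu lM]; pose r (x : 'rV[F]_m.+1) := \row_(i < m) (x *m M) 0 (lift 0 i).
have rI : {in [set x | linf l x == 0] &, injective r}.
  move=> x y; rewrite !inE !lM => /eqP x0 /eqP y0 /rowP xy.
  apply: (can_inj (mulmxK Mu)); apply/rowP => i; case: (unliftP 0 i) => [j|] ->.
    by have := xy j; rewrite !mxE.
  by rewrite x0 y0.
by rewrite -(card_in_imset rI) (leq_trans (max_card _)) // card_mx mul1n.
Qed.

End ProjectiveCounting.

(** * Linear systems of forms and their zeros *)

Section Systems.
Local Open Scope ring_scope.
Variables (F : finFieldType) (m d : nat).
Local Notation q := #|F|.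
Let q_gt0 : (0 < q)%N. Proof. by apply/card_gt0P; exists 0. Qed.
Implicit Type W : {vspace dhomog m.+1 F d}.

Definition common_zero W : pred 'rV[F]_m.+1 :=
  fun x => `[< forall p : dhomog m.+1 F d, p \in W -> (p : {mpoly F[m.+1]}).@[x 0] = 0 >].

Lemma common_zero_scale W : scale_invariant (common_zero W).
Proof.
move=> t x t0; apply: asbool_equiv_eq; split=> h p pW; have := h p pW;
  rewrite (hform_homog t x (mpoly_hform (dhomog_is_dhomog p))) => /eqP.
  by rewrite mulf_eq0 expf_eq0 (negPf t0) andbF => /eqP.
by move/eqP => ->; rewrite mulr0.
Qed.

Lemma card_rational_points W :
  ((q - 1) * #|rational_points W| = #|[set x | (x != 0)%R && common_zero W x]|)%N.
Proof. by rewrite (card_proj (@common_zero_scale W)); congr (_ * _)%N; apply: eq_card. Qed.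

Lemma eP_ge W k : dim_le (vanishing_set W) k -> (#|rational_points W| <= eP F d m k (\dim W))%N.
Proof.
move=> Wk; have lt : (#|rational_points W| < #|{: proj_space F m}|.+1)%N by rewrite ltnS max_card.
rewrite -[X in (X <= _)%N]/(nat_of_ord (Ordinal lt)); apply: leq_bigmax_cond.
by apply/asboolP; exists W.
Qed.

Lemma eP_le k r B : (forall W, \dim W = r -> (#|rational_points W| <= B)%N) -> (eP F d m k r <= B)%N.
Proof. by move=> h; apply/bigmax_leqP => n /asboolP[W [Wr _ <-]]; apply: h. Qed.

Lemma dim_le_proper W : W != 0%VS -> dim_le (vanishing_set W) m.-1.
Proof.
move=> W0 n Z ZW Zs; have [f fW f0] : exists2 f, f \in W & f != 0.
  by exists (vpick W); rewrite ?memv_pick ?vpick0.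
apply: (chain_in_hypersurface (iota := to_alg_closure F) (fun i ni => (ZW i ni).1) Zs
          (dhomog_is_dhomog f)).
  by apply: contra f0 => /eqP e; apply/eqP/val_inj.
by move=> z /(ZW n (leqnn n)).2; apply.
Qed.

Lemma dim_le_coprime W : W != 0%VS ->
  (forall e (h : {mpoly F[m.+1]}), h \is e.-homog ->
     (forall w : dhomog m.+1 F d, w \in W -> divides h (w : {mpoly F[m.+1]})) -> e = 0%N) ->
  dim_le (vanishing_set W) m.-2.
Proof.
move=> W0 noc n Z ZW Zs.
apply: (chain_no_common_factor (iota := to_alg_closure F) (fun i ni => (ZW i ni).1) Zs W0) => //.
by move=> p pW z /(ZW n (leqnn n)).2; apply.
Qed.

End Systems.

(** * The upper bound *)

Section UpperBound.
Local Open Scope ring_scope.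
Variable F : finFieldType.
Local Notation q := #|F|.
Let q_gt0 : (0 < q)%N. Proof. by apply/card_gt0P; exists 0. Qed.
Let q_gt1 : (1 < q)%N. Proof. exact: finNzRing_gt1. Qed.

(* On a hyperplane where the whole system vanishes, its equation can be divided out. *)
Lemma affine_system_bound m d (W : {vspace dhomog m.+1 F d.+1}) (l : 'cV[F]_m.+1) :
  l != 0 -> (d.+1 < q)%N ->
  (forall (p : dhomog m.+1 F d.+1) x, p \in W -> linf l x = 0 -> (p : {mpoly F[m.+1]}).@[x 0] = 0) ->
  (lowcount q m 0 d #|[set x | (linf l x == 1)%R && common_zero W x]| + \dim W <= 'C(d + m, m))%N.
Proof.
move=> l0 dq Wl.
have /choice[G GE] : forall p : dhomog m.+1 F d.+1, exists g : dhomog m.+1 F d, p \in W ->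
    forall x : 'rV_m.+1, (p : {mpoly F[m.+1]}).@[x 0] = linf l x * (g : {mpoly F[m.+1]}).@[x 0].
  move=> p; have [pW|pW] := boolP (p \in W); last by exists 0.
  have [g hg gE] := hform_factor l0 (mpoly_hform (dhomog_is_dhomog p)) (fun y => Wl p y pW).
  by have [g' g'E] := hform_mpoly hg; exists g' => _ x; rewrite gE g'E.
(* Multiplied by [linf l], a relation between the quotients becomes one between the values of a
   basis of [W], and forms of degree below [q] are determined by their values. *)
have fs : free [seq G p | p <- vbasis W].
  have /freeP bW := basis_free (vbasisP W).
  have -> : [seq G p | p <- vbasis W] = [tuple of map G (vbasis W)] by [].
  apply/freeP => a a0; apply: bW; apply: val_inj.
  apply: (meval_inj dq (dhomog_is_dhomog _)) => x.
  rewrite !raddf_sum /=; transitivity (linf l x * (0 : {mpoly F[m.+1]}).@[x 0]).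
    have /(congr1 (fun p : dhomog m.+1 F d => (p : {mpoly F[m.+1]}))) /= <- := a0.
    rewrite !raddf_sum /= mulr_sumr; apply: eq_bigr => i _.
    rewrite !mevalZ (nth_map 0) ?size_tuple // GE; first by rewrite mulrCA.
    by apply: vbasis_mem; rewrite mem_nth ?size_tuple.
  by rewrite meval0 mulr0.
have := affine_zeros_bound l0 _ fs; rewrite size_map size_tuple; apply.
  by move=> x; rewrite inE => /andP[/eqP].
move=> _ x /mapP[p pW ->]; rewrite inE => /andP[/eqP lx /asboolP xW].
have pW' := vbasis_mem pW; have := xW p pW'.
by rewrite GE // lx mul1r.
Qed.

Lemma geometric_sum k : ((q - 1) * ((q ^ k - 1) %/ (q - 1)) = q ^ k - 1)%N.
Proof. by rewrite !subn1 predn_exp mulKn // -subn1 subn_gt0. Qed.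

Lemma rank_uniq m D r n n' : isrank q m D r n -> isrank q m D r n' -> n = n'.
Proof.
move=> [nq nD nr] [nq' nD' nr']; case: (ltngtP n n') => // lt.
  by have := upcount_lt nq nD lt; rewrite nr nr' ltnn.
by have := upcount_lt nq' nD' lt; rewrite nr nr' ltnn.
Qed.

Variables (m' r : nat).
Local Notation m := m'.+2.
Hypothesis r_gt1 : (1 < r)%N.

(** The affine part has at most [n0] points, [n0] being of rank [r] for the degree one less, and
    [n = q ^ m'.+1 + n0]. The [(q ^ m - 1) / (q - 1)] points of the hyperplane supply the other
    [q ^ m'.+1] and the projective count in the claim. *)
Lemma bound_vanishing_hyperplane d (W : {vspace dhomog m.+1 F d}) (l : 'cV[F]_m.+1) n :
  l != 0 -> (0 < d)%N -> (d < q)%N -> \dim W = r -> isrank q m d r n ->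
  (forall (p : dhomog m.+1 F d) x, p \in W -> linf l x = 0 -> (p : {mpoly F[m.+1]}).@[x 0] = 0) ->
  (#|rational_points W| <= n + (q ^ trunc_log q n - 1) %/ (q - 1))%N.
Proof.
case: d W => // d W l0 _ dq dimW nr Wl.
have := affine_system_bound l0 dq Wl; set Z := [set x | _]; rewrite dimW => ZC.
have dq' : (d < q)%N by apply: ltnW.
have rC : (1 < r <= 'C(d + m, m))%N by rewrite r_gt1; apply: leq_trans ZC; apply: leq_addl.
have d0 : (0 < d)%N by move: rC; case: (d) => //; rewrite add0n binn; lia.
have rk := rank_hyper dq' d0 rC; set n0 := encT _ _ in rk.
have Zn := rank_bound q_gt0 dq' rk ZC.
have rk1 := rank_shift q_gt0 (c := 1) _ rk; rewrite addn1 mul1n in rk1.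
have nE := rank_uniq nr (rk1 dq).
have nge : (q ^ m'.+1 <= n)%N by rewrite nE leq_addr.
have [nq _ _] := nr.
have Jn : trunc_log q n = m'.+1 by apply: trunc_log_eq => //; rewrite nge.
rewrite -(leq_pmul2l (_ : 0 < q - 1)%N) ?subn_gt0 // Jn mulnDr geometric_sum.
rewrite card_rational_points (card_linf l (@common_zero_scale _ _ _ W)).
have H : (#|[set x : 'rV[F]_m.+1 | (x != 0)%R && (linf l x == 0)%R && common_zero W x]| <= q ^ m - 1)%N.
  apply: (@leq_trans (#|[set x | linf l x == 0%R]| - 1)%N); last first.
    by apply: leq_sub2r; apply: card_linf0.
  rewrite [X in (_ <= X - 1)%N](cardsD1 0) inE /linf mul0mx mxE eqxx add1n subn1 /=.
  by apply/subset_leq_card/subsetP => x; rewrite !inE => /andP[/andP[-> ->]].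
apply: leq_trans (leq_add H (leq_mul (leqnn _) Zn)) _.
rewrite nE mulnDr addnAC leq_add2r expnS.
have : (0 < q ^ m'.+1)%N by rewrite expn_gt0 q_gt0.
by rewrite mulnBl mul1n; have := q_gt1; nia.
Qed.

Lemma rational_points_product c D d (W : {vspace dhomog m.+1 F d}) (W' : {vspace dhomog m.+1 F D})
    (G : {mpoly F[m.+1]}) : G \is c.-homog ->
  (forall w, w \in W' -> exists2 w', w' \in W & (w' : {mpoly F[m.+1]}) = G * (w : {mpoly F[m.+1]})) ->
  (#|rational_points W| <= #|[pred z : proj_space F m | (G.@[sval z 0] == 0)%R]| + #|rational_points W'|)%N.
Proof.
move=> hG W'W; rewrite -cardUI; apply: leq_trans (leq_addr _ _); apply/subset_leq_card/subsetP => z.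
rewrite !inE => /asboolP zW; have [//|/= Gz] := eqVneq G.@[sval z 0] 0.
apply/asboolP => w /W'W[w' w'W w'E]; have := zW w' w'W.
by rewrite w'E mevalM => /eqP; rewrite mulf_eq0 (negPf Gz) => /eqP.
Qed.

Lemma form_points_no_hyperplane c (G : {mpoly F[m.+1]}) : (c < q)%N -> G \is c.+1.-homog ->
  (forall l : 'cV[F]_m.+1, l != 0 -> exists2 x, linf l x = 0 & G.@[x 0] != 0) ->
  ((q - 1) * #|[pred z : proj_space F m | (G.@[sval z 0] == 0)%R]| + 1 <= c * q ^ m + q ^ m'.+1)%N.
Proof.
move=> cq hG nohyp; have hf := mpoly_hform hG.
have inv : scale_invariant (fun x : 'rV[F]_m.+1 => G.@[x 0] == 0).
  by move=> t x t0; rewrite (hform_homog t x hf) mulf_eq0 expf_eq0 (negPf t0) andbF.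
have := form_zeros_no_hyperplane cq hf nohyp; apply: leq_trans.
rewrite -(card_proj inv) addnC [X in (_ <= X)%N](cardsD1 0) inE (hform_vanish0 hf) eqxx.
by rewrite leq_add2l; apply/subset_leq_card/subsetP => x; rewrite !inE.
Qed.

Lemma rational_points_bound d (W : {vspace dhomog m.+1 F d}) : (0 < d)%N -> (d < q)%N ->
  \dim W = r ->
  (forall D, (1 <= D <= d)%N -> (r <= 'C(D + m, m))%N -> (eP F D m m' r <= fP D m m' q r)%N) ->
  (#|rational_points W| <= fP d m m'.+1 q r)%N.
Proof.
move=> d0 dq dimW he.
have rC : (1 < r <= 'C(d + m, m))%N by rewrite r_gt1 -dimW -(dim_dhomog F) dimvS ?subvf.
rewrite fP_hyper //; have rk := rank_hyper dq d0 rC; set n := encT _ _ in rk *.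
have [[l [l0 Wl]]|nohyp] := pselect (exists l : 'cV[F]_m.+1, l != 0 /\
    forall (p : dhomog m.+1 F d) x, p \in W -> linf l x = 0 -> (p : {mpoly F[m.+1]}).@[x 0] = 0).
  exact: bound_vanishing_hyperplane Wl.
have W0 : W != 0%VS by rewrite -dimv_eq0 dimW; lia.
have [c [D [G [W' [[dE dimW'] hG WG GW noc]]]]] := extract_common_factor W0.
have W'0 : W' != 0%VS by rewrite -dimv_eq0 dimW' dimW; lia.
have rC' : (r <= 'C(D + m, m))%N by rewrite -dimW -dimW' -(dim_dhomog F) dimvS ?subvf.
(* In degree 0 the forms have dimension 1, less than [r]. *)
have D0 : (0 < D)%N by move: rC'; case: (D) => //; rewrite add0n binn; lia.
have Dq : (D < q)%N by lia.
have rCD : (1 < r <= 'C(D + m, m))%N by rewrite r_gt1.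
have rkD := rank_hyper Dq D0 rCD; set b := encT _ _ in rkD.
have W'b : (#|rational_points W'| <= b + (q ^ minn (trunc_log q b) m' - 1) %/ (q - 1))%N.
  apply: leq_trans (fP_codim2_le Dq D0 rCD rkD); apply: leq_trans (he D _ rC'); last by lia.
  by rewrite -dimW -dimW'; apply: eP_ge; apply: dim_le_coprime.
have Gnohyp (l : 'cV[F]_m.+1) : l != 0 -> exists2 x, linf l x = 0 & G.@[x 0] != 0.
  move=> l0; apply: contrapT => /forall2NP h; apply: nohyp; exists l; split=> // p x pW lx.
  have [w' _ ->] := WG p pW; rewrite mevalM.
  have [//|/negP] := h x; rewrite negbK => /eqP ->; exact: mul0r.
have ub := rational_points_product hG GW.
have qJ k j : (k <= j)%N -> ((q ^ k - 1) %/ (q - 1) <= (q ^ j - 1) %/ (q - 1))%N.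
  by move=> kj; apply: leq_div2r; apply: leq_sub2r; rewrite leq_exp2l.
case: c => [|c] in dE hG.
  have nb : n = b by rewrite add0n in dE; subst D; apply: rank_uniq rk rkD.
  have -> : n = b by [].
  apply: leq_trans ub _; rewrite [X in (X + _)%N](_ : _ = 0%N); last first.
    apply: eq_card0 => z; rewrite !inE; apply/negbTE.
    have [k Gk] := hform_constP (mpoly_hform hG).
    have l0 : delta_mx 0 0 != 0 :> 'cV[F]_m.+1.
      by apply/eqP => /matrixP/(_ 0 0)/eqP; rewrite !mxE !eqxx oner_eq0.
    by have [x _] := Gnohyp _ l0; rewrite !Gk.
  rewrite add0n; apply: leq_trans W'b _; rewrite leq_add2l; apply: qJ; exact: geq_minl.
have nE : n = (c.+1 * q ^ m'.+1 + b)%N.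
  apply: rank_uniq rk _; rewrite dE addnC; apply: rank_shift => //; lia.
have nge : (q ^ m'.+1 <= n)%N by rewrite nE mulSn -addnA leq_addr.
have [nq _ _] := rk.
have -> : trunc_log q n = m'.+1 by apply: trunc_log_eq => //; rewrite nge.
have cq : (c < q)%N by lia.
have Gb := form_points_no_hyperplane cq hG Gnohyp.
rewrite -(leq_pmul2l (_ : 0 < q - 1)%N) ?subn_gt0 // mulnDr geometric_sum.
have W'b2 : ((q - 1) * #|rational_points W'| <= (q - 1) * b + (q ^ m' - 1))%N.
  rewrite -geometric_sum -mulnDr leq_mul2l; apply/orP; right; apply: leq_trans W'b _.
  by rewrite leq_add2l; apply: qJ; apply: geq_minr.
have ub' : ((q - 1) * #|rational_points W| <= (q - 1) * #|[pred z : proj_space F m | (G.@[sval z 0] == 0)%R]| +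
    (q - 1) * #|rational_points W'|)%N by rewrite -mulnDr leq_mul2l ub orbT.
have um : (0 < q ^ m')%N by rewrite expn_gt0 q_gt0.
(* What is left to check after multiplying by [q - 1] and cancelling. The degree of [G] is [c + 1],
   and [D > 0] gives [c + 2 <= d < q]. *)
have key : (c.+1 * q ^ m'.+1 + q ^ m' <= q ^ m)%N.
  have cq2 : (c.+2 <= q)%N by lia.
  rewrite ![(q ^ _.+1)%N]expnS !mulnA; apply: (@leq_trans (c.+2 * q * q ^ m')); last first.
    by rewrite leq_mul2r leq_mul2r cq2 !orbT.
  by rewrite [(c.+2 * q)%N]mulSn mulnDl addnC leq_add2r leq_pmull.
have e1 : (q ^ m = (q - 1) * q ^ m'.+1 + q ^ m'.+1)%N by rewrite expnS mulnBl mul1n subnK ?leq_pmull.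
have e2 : (c.+1 * q ^ m = (q - 1) * (c.+1 * q ^ m'.+1) + c.+1 * q ^ m'.+1)%N.
  by rewrite {1}e1 mulnDr mulnCA.
rewrite nE mulnDr; move: ub' Gb W'b2 key e2 um; rewrite [(c.+1 * q ^ m)%N]mulSn.
have : (0 < q ^ m'.+1)%N by rewrite expn_gt0 q_gt0.
move: ((q - 1) * #|rational_points W|)%N ((q - 1) * #|rational_points W'|)%N ((q - 1) * b)%N
  ((q - 1) * (c.+1 * q ^ m'.+1))%N (c.+1 * q ^ m'.+1)%N (c * q ^ m)%N (q ^ m)%N (q ^ m')%N
  (q ^ m'.+1)%N ((q - 1) * _)%N; lia.
Qed.

End UpperBound.

(** * The lower bound: systems vanishing on a grid *)

Section LowerBound.
Local Open Scope ring_scope.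
Variables (F : finFieldType) (m d : nat).
Local Notation q := #|F|.
Hypotheses (d_gt0 : (0 < d)%N) (dq : (d < q)%N).
Let q_gt0 : (0 < q)%N := leq_ltn_trans (leq0n d) dq.
Let q_gt1 : (1 < q)%N := leq_ltn_trans d_gt0 dq.
Local Notation encT := (@encT q d m).
Local Notation xi := (nth (0 : F) (enum F)).
Implicit Types alpha beta : m.-tuplelexi 'I_d.+1.

Lemma leq_trunc_log n : (n < q ^ m)%N -> (trunc_log q n <= m)%N.
Proof.
move=> nq; have [->|n0] := posnP n; first by rewrite trunc_log0.
by rewrite -(leq_exp2l _ _ q_gt1); apply: leq_trans (ltnW nq); apply: trunc_logP.
Qed.

Lemma xi_inj a b : (a < q)%N -> (b < q)%N -> xi a = xi b -> a = b.
Proof.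
move=> aq bq /eqP; rewrite nth_uniq -?cardE ?enum_uniq //; exact: eqP.
Qed.

Definition grid_form alpha (x : 'rV[F]_m.+1) : F :=
  x 0 0 ^+ (d - \sum_(j < m) tnth alpha j) *
  \prod_(j < m) \prod_(c < tnth alpha j) (x 0 (lift 0 j) - xi c * x 0 0).

(** The affine point of number [enc q s], each digit selecting an element of [F] in the order of
    [enum F]. *)
Definition grid_point (s : seq nat) : 'rV[F]_m.+1 :=
  \row_i if unlift 0 i is Some j then xi (nth 0%N s j) else 1.

Lemma grid_point0 s : grid_point s 0 0 = 1.
Proof. by rewrite mxE unlift_none. Qed.

Lemma grid_pointE s j : grid_point s 0 (lift 0 j) = xi (nth 0%N s j).
Proof. by rewrite mxE liftK. Qed.

Lemma grid_point_inj s t : size s = m -> size t = m ->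
  all (fun x => x < q)%N s -> all (fun x => x < q)%N t -> grid_point s = grid_point t -> s = t.
Proof.
move=> sm tm /allP sq /allP tq st; apply: (@eq_from_nth _ 0%N) => [|i]; rewrite sm ?tm // => im.
apply: xi_inj; first by rewrite sq ?mem_nth ?sm.
  by rewrite tq ?mem_nth ?tm.
by have /rowP/(_ (lift 0 (Ordinal im))) := st; rewrite !grid_pointE.
Qed.

Lemma hform_grid alpha : Delta alpha -> hform d (grid_form alpha).
Proof.
move=> ad; have h (j : 'I_m) : hform (\sum_(c < tnth alpha j) 1)
    (fun x : 'rV[F]_m.+1 => \prod_(c < tnth alpha j) (x 0 (lift 0 j) - xi c * x 0 0)).
  apply: (@hform_prod _ _ _ _ (fun=> 1%N) (fun (c : 'I__) (x : 'rV[F]_m.+1) => _ - _ * _)) => c.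
  exact: hformB (hform_coord F (lift 0 j)) (hformZ (xi c) (hform_coord F 0)).
have := hformM (hform_expr (d - \sum_(j < m) tnth alpha j) (hform_coord F 0)) (hform_prod (index_enum _) h).
rewrite mul1n [X in (_ + X)%N](eq_bigr (fun j => nat_of_ord (tnth alpha j))) ?subnK // => j _.
by rewrite sum_nat_const card_ord muln1.
Qed.

(** Nonvanishing forces [alpha] to be at most [s] in every entry. This gives both the zeros at all
    points of number below [n] and the triangularity that makes the forms independent. *)
Lemma grid_form_neq0 alpha s : size s = m -> all (fun x => x < q)%N s ->
  grid_form alpha (grid_point s) != 0 -> (encT alpha <= enc q s)%N.
Proof.
move=> sm /allP sq; rewrite /grid_form mulf_eq0 negb_or => /andP[_ nz].
rewrite encTE encE sm; apply: leq_sum => j _; rewrite leq_mul2r; apply/orP; right.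
rewrite leqNgt; apply/negP => lt; case/negP: nz; rewrite (bigD1 j) //= (bigD1 (Ordinal lt)) //=.
by rewrite grid_pointE grid_point0 mulr1 subrr !mul0r.
Qed.

Lemma grid_form_diag alpha : grid_form alpha (grid_point (natseq alpha)) != 0.
Proof.
rewrite /grid_form grid_point0 expr1n mul1r; apply/prodf_neq0 => j _; apply/prodf_neq0 => c _.
rewrite grid_pointE mulr1 natseq_nth subr_eq0; apply/eqP => /xi_inj e.
have aq : (tnth alpha j < q)%N by apply: leq_ltn_trans dq; rewrite -ltnS.
by have := ltn_ord c; rewrite -e ?ltnn // (ltn_trans (ltn_ord c)).
Qed.

(** If [alpha] has sum below [d], the power of [X_0] vanishes. Otherwise, for [n > 0], the number of
    [alpha] is at least [q ^ J], so one of the first [m - J] entries is nonzero; as [x 0 0 = 0], its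
    factors reduce to a coordinate that vanishes. *)
Lemma grid_form_infinity n alpha (x : 'rV[F]_m.+1) : (n < q ^ m)%N -> Delta alpha -> (n <= encT alpha)%N ->
  (forall i : 'I_m.+1, (i < m.+1 - trunc_log q n)%N -> x 0 i = 0) -> grid_form alpha x = 0.
Proof.
set J := trunc_log q n => nq ad na x0; have Jm : (J <= m)%N := leq_trunc_log nq.
have x00 : x 0 0 = 0 by apply: x0; rewrite subn_gt0.
rewrite /grid_form x00; have [lt|ge] := ltnP (\sum_(j < m) tnth alpha j) d.
  by rewrite expr0n subn_eq0 leqNgt lt mul0r.
suff [j jJ aj] : exists2 j : 'I_m, (j < m - J)%N & (0 < tnth alpha j)%N.
  rewrite [X in _ * X](bigD1 j) //= [X in _ * (X * _)](bigD1 (Ordinal aj)) //= x0 ?mulr0 ?subr0 ?mul0r ?mulr0 //.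
  by rewrite lift0 subSn.
apply: contrapT => noj.
have : (encT alpha < q ^ J)%N.
  rewrite -(subKn Jm); have := @enc_lt_lead q (natseq alpha) (m - J); rewrite natseq_size.
  apply; [exact: leq_subr|exact: natseq_lt|].
  move=> i iJ; have im : (i < m)%N by apply: leq_trans iJ (leq_subr _ _).
  apply/eqP; rewrite -leqn0 leqNgt; apply/negP => ai; apply: noj; exists (Ordinal im) => //.
  by rewrite -natseq_nth.
(* [trunc_log q 0] is 0, so [q ^ J <= n] fails for [n = 0]; there [alpha] would be the zero tuple,
   against its sum being at least [d]. *)
have [n0|n0] := posnP n; last by rewrite ltnNge (leq_trans (trunc_logP q_gt1 n0)).
rewrite /J n0 trunc_log0 expn0 ltnS leqn0 => /eqP a0.
by have := digsum_encT dq alpha; rewrite a0 digsum0 // => /esym e; move: ge; rewrite e; lia.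
Qed.

Lemma grid_system n r : isrank q m d r n -> exists2 W : {vspace dhomog m.+1 F d}, \dim W = r &
  forall x, (forall alpha, Delta alpha -> (n <= encT alpha)%N -> grid_form alpha x = 0) -> common_zero W x.
Proof.
move=> [nq nd nr].
have /choice[p pE] : forall alpha, exists p : dhomog m.+1 F d,
    Delta alpha -> forall x, grid_form alpha x = (p : {mpoly F[m.+1]}).@[x 0].
  move=> alpha; have [ad|] := boolP (Delta alpha); last by exists 0.
  by have [p pE] := hform_mpoly (hform_grid ad); exists p.
pose A := [pred beta : m.-tuplelexi 'I_d.+1 | Delta beta && (n <= encT beta)%N].
pose s := [tuple of map p (enum_tuple A)].
have sE (i : 'I_#|A|) : s`_i = p (enum_val i).
  by rewrite (nth_map (enum_default i)) // size_tuple.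
have AP (i : 'I_#|A|) : Delta (enum_val i) && (n <= encT (enum_val i))%N by have := enum_valP i.
have evs (a : 'I_#|A| -> F) (x : 'rV[F]_m.+1) :
    ((\sum_i a i *: s`_i : dhomog m.+1 F d) : {mpoly F[m.+1]}).@[x 0] = \sum_i a i * grid_form (enum_val i) x.
  rewrite !raddf_sum /=; apply: eq_bigr => i _; rewrite mevalZ sE pE //.
  by have /andP[] := AP i.
have fs : free s.
  apply/freeP => a a0 i; move eN: (encT (enum_val i)) => N.
  (* Evaluation at the grid point of [enum_val i] is triangular: forms of larger number vanish
     there, and those of smaller number have coefficient 0 by induction. *)
  elim/ltn_ind: N i eN => N IH i eN.
  have := evs a (grid_point (natseq (enum_val i))); rewrite a0 meval0 (bigD1 i) //= big1 ?addr0.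
    by move=> /esym/eqP; rewrite mulf_eq0 (negPf (grid_form_diag _)) orbF => /eqP.
  move=> k ki; have [//|/eqP nz] := eqVneq (grid_form (enum_val k) (grid_point (natseq (enum_val i)))) 0.
    by move=> ->; rewrite mulr0.
  have := grid_form_neq0 (natseq_size _) (natseq_lt dq _) (introN eqP nz).
  rewrite leq_eqVlt => /orP[/eqP/(encT_inj dq)/enum_val_inj e|lt]; first by rewrite e eqxx in ki.
  by rewrite (IH _ _ k erefl) ?mul0r // -eN.
exists <<s>>%VS; first by move: fs; rewrite /free size_tuple => /eqP ->; rewrite -nr -(card_Delta _ dq).
move=> x xA; apply/asboolP => w /coord_span ->; rewrite evs big1 // => i _.
by have /andP[ad na] := AP i; rewrite xA ?mulr0.
Qed.

Lemma card_vanishing_lead J : (J <= m.+1)%N ->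
  (q ^ J <= #|[set x : 'rV[F]_m.+1 | [forall i : 'I_m.+1, (i < m.+1 - J)%N ==> (x 0 i == 0)%R]]|)%N.
Proof.
move=> Jm; pose f (y : 'rV[F]_J) : 'rV[F]_m.+1 :=
  \row_i \sum_(a < J) if i == (m.+1 - J + a)%N :> nat then y 0 a else 0.
have fI : injective f.
  move=> y z yz; apply/rowP => a; have im : (m.+1 - J + a < m.+1)%N by have := ltn_ord a; lia.
  have /rowP/(_ (Ordinal im)) := yz.
  have fE (u : 'rV[F]_J) : f u 0 (Ordinal im) = u 0 a.
    rewrite mxE (bigD1 a) //= eqxx big1 ?addr0 // => b ba.
    by rewrite eqn_add2l eq_sym; case: eqP => // /val_inj e; rewrite e eqxx in ba.
  by rewrite !fE.
have -> : (q ^ J = #|[set f y | y : 'rV[F]_J]|)%N by rewrite card_imset //= card_mx mul1n.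
apply/subset_leq_card/subsetP => _ /imsetP[y _ ->]; rewrite inE; apply/forallP => i; apply/implyP => iJ.
by rewrite mxE big1 // => a _; case: eqP => // e; lia.
Qed.

Lemma exists_many_rational_points n r : isrank q m d r n ->
  exists2 W : {vspace dhomog m.+1 F d}, \dim W = r &
    (n + (q ^ trunc_log q n - 1) %/ (q - 1) <= #|rational_points W|)%N.
Proof.
move=> nr; have [W dimW Wz] := grid_system nr; exists W => //; have [nq _ _] := nr.
set J := trunc_log q n; have Jm : (J <= m)%N := leq_trunc_log nq.
rewrite -(leq_pmul2l (_ : 0 < q - 1)%N) ?subn_gt0 // mulnDr geometric_sum card_rational_points.
rewrite (card_linf (delta_mx 0 0) (@common_zero_scale _ _ _ W)) addnC; apply: leq_add.
  (* The part at infinity is a linear subspace of dimension [J], from which the zero vector is taken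
     away. *)
  rewrite leq_subLR; apply: leq_trans (card_vanishing_lead (leqW Jm)) _.
  rewrite [X in (X <= _)%N](cardsD1 0); apply: leq_add; first exact: leq_b1.
  apply/subset_leq_card/subsetP => x; rewrite !inE.
  move=> /andP[-> /forallP xJ] /=.
  have x0 (i : 'I_m.+1) : (i < m.+1 - J)%N -> x 0 i = 0 by move=> iJ; have := xJ i; rewrite iJ => /eqP.
  rewrite linf_delta x0 ?subn_gt0 // eqxx; apply: Wz => alpha ad na; exact: grid_form_infinity x0.
rewrite leq_mul2l; apply/orP; right.
have /choice[g gP] : forall i : 'I_n, exists s, [/\ size s = m, all (fun x => x < q)%N s & enc q s = i].
  by move=> i; have [s sm [sq sE]] := dec_exists q_gt0 (ltn_trans (ltn_ord i) nq); exists s.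
have gI : injective (fun i => grid_point (g i)).
  move=> i j; have [si qi ei] := gP i; have [sj qj ej] := gP j.
  by move=> /(grid_point_inj si sj qi qj) e; apply: val_inj; rewrite /= -ei -ej e.
have -> : (n = #|[set grid_point (g i) | i : 'I_n]|)%N by rewrite card_imset //= card_ord.
apply/subset_leq_card/subsetP => _ /imsetP[i _ ->]; have [si qi ei] := gP i.
rewrite inE linf_delta grid_point0 eqxx; apply: Wz => alpha ad na; apply/eqP/negPn/negP => nz.
by have := grid_form_neq0 si qi nz; rewrite ei leqNgt (leq_trans (ltn_ord i)).
Qed.

End LowerBound.

Theorem proposition1p7 (F : finFieldType) (q d m r : nat)
  (hq : #|F| = q) (hd : 1 <= d) (hm : 2 <= m)
  (hr : 2 <= r <= 'C(m + d, d)) (hdq : d + 1 <= q)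
  (he : forall d' : nat, 1 <= d' <= d -> r <= 'C(m + d', d') ->
     eP F d' m (m - 2) r = fP d' m (m - 2) q r) :
  eP F d m (m - 1) r = fP d m (m - 1) q r.

Proof.
case: m hm hr he => [|[|m']] // _; subst q; rewrite addn1 in hdq.
rewrite !subSS !subn0 => hr he.
have bin D : 'C(m'.+2 + D, D) = 'C(D + m'.+2, m'.+2) by rewrite addnC -bin_sub ?leq_addr // addKn.
move: hr; rewrite bin => hr; have /andP[r_gt1 _] := hr.
have upper (W : {vspace dhomog m'.+3 F d}) : \dim W = r -> #|rational_points W| <= fP d m'.+2 m'.+1 #|F| r.
  move=> dimW; apply: rational_points_bound => // D hD rD.
  by rewrite he // bin.
apply/eqP; rewrite eqn_leq (eP_le _ upper) /=.
have [W dimW W_ge] := exists_many_rational_points hd hdq (rank_hyper hdq hd hr).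
rewrite fP_hyper //; apply: leq_trans W_ge _; rewrite -[in X in _ <= X]dimW; apply: eP_ge.
by apply: dim_le_proper; rewrite -dimv_eq0 dimW -lt0n ltnW.
Qed.
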